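(* Let $\ell$ be a commutative unital ring, $E$ a directed graph, and $R\in\mathrm{Alg}_\ell$. Let $X:\mathrm{Alg}_\ell\to\mathcal T$ be an excisive, homotopy invariant, $E$-stable and $E^0$-additive homology theory. Then the distinguished triangle $j(\ell^{(\operatorname{reg}(E))})\overset{f}{\to}j(\ell^{(E^0)})\to j(L(E))$ in $kk$ described in the context induces (by tensoring with $R$ and applying $X$) a distinguished triangle in $\mathcal T$ $$X(R)^{(\operatorname{reg}(E))}\xrightarrow{\ I-A_E^t\ }X(R)^{(E^0)}\longrightarrow X(L(E)\otimes R).$$
   Context: Graphs and algebras. A directed graph $E=(E^0,E^1,r,s)$ has vertex set $E^0$, edge set $E^1$ and range and source maps $r,s:E^1\to E^0$ (both sets arbitrary). A vertex $v$ is regular if $s^{-1}(v)$ is finite and nonempty; $\operatorname{reg}(E)$ is the set of regular vertices. The Cohn path algebra $C(E)$ over $\ell$ is the quotient of the free associative $\ell$-algebra on $E^0\cup E^1\cup\{e^*:e\in E^1\}$ by the relations $vw=\delta_{v,w}v$ $(v,w\in E^0)$; $s(e)e=e=e\,r(e)$ and $r(e)e^*=e^*=e^*s(e)$ $(e\in E^1)$; $e^*f=\delta_{e,f}r(e)$ $(e,f\in E^1)$. For $v\in\operatorname{reg}(E)$ put $q_v=v-\sum_{s(e)=v}ee^*\in C(E)$; let $\mathcal K(E)\lhd C(E)$ be the ideal generated by the $q_v$, $v\in\operatorname{reg}(E)$, and let $L(E)=C(E)/\mathcal K(E)$ be the Leavitt path algebra. The sequence $0\to\mathcal K(E)\to C(E)\to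 L(E)\to0$ splits $\ell$-linearly. For a set $I$, $\ell^{(I)}$ is the algebra of finitely supported functions $I\to\ell$ with characteristic functions $\chi_i$. The reduced adjacency matrix $A_E$ is indexed by $\operatorname{reg}(E)\times E^0$, with $(A_E)_{v,w}=\#\{e\in E^1:s(e)=v,\ r(e)=w\}$; $I$ is the $E^0\times\operatorname{reg}(E)$-matrix with $I_{v,w}=\delta_{v,w}$. All tensor products are over $\ell$. Homology theories and $kk$. $\mathrm{Alg}_\ell$ is the category of associative, not necessarily unital $\ell$-algebras. A homology theory is a functor $X:\mathrm{Alg}_\ell\to\mathcal T$ to a triangulated category $\mathcal T$ with inverse suspension $\Omega$. An extension is a short exact sequence of algebras $0\to A\to B\to C\to 0$ which splits $\ell$-linearly. $X$ is excisive if it comes equipped with maps $\partial:\Omega X(C)\to X(A)$, one for each extension, natural with respect to morphisms of extensions, such that $\Omega X(C)\to X(A)\to X(B)\to X(C)$ is a distinguished triangle. $X$ is homotopy invariant if it maps each inclusion $A\subset A[t]$ to an isomorphism. For a set $S$, $M_SA$ is the algebra of finitely supported $S\times S$-matrices with entries in $A$; $X$ is $M_S$-stable if for every $A$ and $s\in S$ it maps $A\to M_SA$, $a\mapsto \epsilon_{s,s}\otimes a$ to an isomorphism ($\epsilon_{s,t}$ are the matrix units). $X$ is $E$-stable if it is $M_S$-stable for $S=E^0\sqcup E^1\sqcup\mathbb{N}$. For a set $I$, $X$ is $I$-additive if direct sums of at most $\#I$ summands exist in $\mathcal T$ and the canonical map $\bigoplus_{k\in J}X(A_k)\to X(\bigoplus_{k\in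 J}A_k)$ is an isomorphism for every family of algebras $\{A_k\}_{k\in J}$ with $\#J\le\#I$. $X(R)^{(I)}$ denotes the direct sum of copies of $X(R)$ indexed by $I$. For each infinite set $S$ there is a universal excisive, homotopy invariant, $M_S$-stable homology theory $j:\mathrm{Alg}_\ell\to kk$, i.e. an initial one, where morphisms $X\to Y$ are triangulated functors $G$ with $GX=Y$ compatible with the maps $\partial$; here $j$ is the universal $E$-stable one. For each algebra $R$, $-\otimes R$ induces a triangulated functor $kk\to kk$. The triangle in $kk$. Let $q:\ell^{(\operatorname{reg}(E))}\to\mathcal K(E)$, $q(\chi_v)=q_v$, and $\varphi:\ell^{(E^0)}\to C(E)$, $\varphi(\chi_v)=v$; both become isomorphisms in $kk$. With $\mathrm{inc}:\mathcal K(E)\to C(E)$ the inclusion, set $f=j(\varphi)^{-1}j(\mathrm{inc})j(q)$. The triangle in question is the one associated with the extension $0\to\mathcal K(E)\to C(E)\to L(E)\to 0$, transported along the isomorphisms $j(q)$ and $j(\varphi)$. *)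

(* Defs.v *)
From HB Require Import structures.
From mathcomp Require Import all_boot all_order all_algebra.
From mathcomp Require Import finmap.
From mathcomp Require Import boolp classical_sets functions cardinality fsbigop.

Set Implicit Arguments.
Unset Strict Implicit.
Unset Printing Implicit Defensive.

Import GRing.Theory.
Local Open Scope classical_set_scope.
Local Open Scope ring_scope.
Local Open Scope quotient_scope.

HB.mixin Record isNUAlgebra (l : comPzRingType) A of GRing.Lmodule l A := {
  amul : A -> A -> A;
  amulA : associative amul;
  amulDl : left_distributive amul +%R;
  amulDr : right_distributive amul +%R;
  amulZl : forall (c : l) (x y : A), amul (c *: x) y = c *: amul x y;
  amulZr : forall (c : l) (x y : A), amul x (c *: y) = c *: amul x y
}.

#[short(type="nuAlgType")]
HB.structure Definition NUAlgebra (l : comPzRingType) :=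
  {A of isNUAlgebra l A & GRing.Lmodule l A}.

Notation "x ** y" := (amul x y) (at level 40, left associativity) : ring_scope.

Section AmulTheory.
Variables (l : comPzRingType) (A : nuAlgType l).
Implicit Types x y z : A.

Lemma amul_linear_l y : linear (amul^~ y : A -> A).
Proof. by move=> c x z; rewrite amulDl amulZl. Qed.
Lemma amul_linear_r x : linear (amul x : A -> A).
Proof. by move=> c y z; rewrite amulDr amulZr. Qed.

HB.instance Definition _ x := GRing.isLinear.Build l A A _ (amul x) (amul_linear_r x).

Definition amulr y x := x ** y.
HB.instance Definition _ y := GRing.isLinear.Build l A A _ (amulr y) (amul_linear_l y).

Lemma amulrE y x : amulr y x = x ** y. Proof. by []. Qed.
Lemma amul0l x : 0 ** x = 0 :> A. Proof. exact: (raddf0 (amulr x)). Qed.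
Lemma amul0r x : x ** 0 = 0 :> A. Proof. exact: raddf0. Qed.
Lemma amulNl x y : (- x) ** y = - (x ** y). Proof. exact: (raddfN (amulr y)). Qed.
Lemma amulNr x y : x ** (- y) = - (x ** y). Proof. exact: raddfN. Qed.
Lemma amulBl x y z : (x - y) ** z = x ** z - y ** z. Proof. exact: (raddfB (amulr z)). Qed.
Lemma amulBr x y z : x ** (y - z) = x ** y - x ** z. Proof. exact: raddfB. Qed.
End AmulTheory.

Section BaseAlgebra.
Variable l : comPzRingType.
Lemma regmulDl : left_distributive ( *%R : l^o -> l^o -> l^o) +%R.
Proof. exact: mulrDl. Qed.
Lemma regmulDr : right_distributive ( *%R : l^o -> l^o -> l^o) +%R.
Proof. exact: mulrDr. Qed.
Lemma regmulZl (c : l) (x y : l^o) : (c *: x) * y = c *: (x * y) :> l^o.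
Proof. by rewrite /GRing.scale /= mulrA. Qed.
Lemma regmulZr (c : l) (x y : l^o) : x * (c *: y) = c *: (x * y) :> l^o.
Proof. by rewrite /GRing.scale /= mulrCA. Qed.
HB.instance Definition _ := isNUAlgebra.Build l l^o (@mulrA l) regmulDl regmulDr regmulZl regmulZr.
End BaseAlgebra.

Record algHom (l : comPzRingType) (A B : nuAlgType l) := AlgHom {
  alg_fun :> A -> B;
  alg_funL : linear alg_fun;
  alg_funM : {morph alg_fun : x y / x ** y}
}.

Section AlgHom.
Variable l : comPzRingType.
Implicit Types A B C : nuAlgType l.

HB.instance Definition _ A B (f : algHom A B) :=
  GRing.isLinear.Build l A B _ f (alg_funL f).

Lemma algHomP A B (f g : algHom A B) : f =1 g -> f = g.
Proof.
case: f g => [f fL fM] [g gL gM] /= /funext fg; subst g.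
by congr AlgHom; exact: Prop_irrelevance.
Qed.

Definition idAlg A : algHom A A := @AlgHom l A A id (fun _ _ _ => erefl) (fun _ _ => erefl).

Lemma compAlgL A B C (g : algHom B C) (f : algHom A B) : linear (g \o f).
Proof. by move=> c x y /=; rewrite !linearP. Qed.
Lemma compAlgM A B C (g : algHom B C) (f : algHom A B) : {morph g \o f : x y / x ** y}.
Proof. by move=> x y /=; rewrite !alg_funM. Qed.
Definition compAlg A B C (g : algHom B C) (f : algHom A B) : algHom A C :=
  AlgHom (compAlgL g f) (compAlgM g f).
End AlgHom.

Section DirectSum.
Variables (l : comPzRingType) (J : choiceType) (M : J -> lmodType l).

Record dsum := DSum {
  dval :> forall j, M j;
  _ : `[< finite_set [set j | dval j != 0] >]
}.
HB.instance Definition _ := [isSub for dval].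
HB.instance Definition _ := gen_eqMixin dsum.
HB.instance Definition _ := gen_choiceMixin dsum.
Implicit Types f g h : dsum.

Lemma dsumP f g : (forall j, f j = g j) -> f = g.
Proof. by move=> fg; apply: val_inj; exact: functional_extensionality_dep. Qed.

Lemma dsum_fin f : finite_set [set j | f j != 0].
Proof. by case: f => f /= /asboolP. Qed.

Lemma dsum0_subproof : `[< finite_set [set j | (0 : M j) != 0] >].
Proof.
by apply/asboolP; rewrite (_ : mkset _ = set0) // predeqE => j /=; split=> //; rewrite eqxx.
Qed.
Definition dsum0 := @DSum (fun=> 0) dsum0_subproof.

Lemma dsumD_subproof f g : `[< finite_set [set j | f j + g j != 0] >].
Proof.
apply/asboolP; apply: (@sub_finite_set _ _ ([set j | f j != 0] `|` [set j | g j != 0])).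
  move=> j /=; have [->|] := eqVneq (f j) 0; last by left.
  by rewrite add0r; right.
by rewrite finite_setU; split; exact: dsum_fin.
Qed.
Definition dsumD f g := DSum (dsumD_subproof f g).

Lemma dsumN_subproof f : `[< finite_set [set j | - f j != 0] >].
Proof.
apply/asboolP; apply: (sub_finite_set _ (dsum_fin f)) => j /=.
by rewrite oppr_eq0.
Qed.
Definition dsumN f := DSum (dsumN_subproof f).

Lemma dsumZ_subproof (c : l) f : `[< finite_set [set j | c *: f j != 0] >].
Proof.
apply/asboolP; apply: (sub_finite_set _ (dsum_fin f)) => j /=.
by apply: contra_neq => ->; rewrite scaler0.
Qed.
Definition dsumZ c f := DSum (dsumZ_subproof c f).

Lemma dsumDA : associative dsumD.
Proof. by move=> f g h; apply: dsumP => j /=; rewrite addrA. Qed.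
Lemma dsumDC : commutative dsumD.
Proof. by move=> f g; apply: dsumP => j /=; rewrite addrC. Qed.
Lemma dsum0D : left_id dsum0 dsumD.
Proof. by move=> f; apply: dsumP => j /=; rewrite add0r. Qed.
Lemma dsumND : left_inverse dsum0 dsumN dsumD.
Proof. by move=> f; apply: dsumP => j /=; rewrite addNr. Qed.
HB.instance Definition _ := GRing.isZmodule.Build dsum dsumDA dsumDC dsum0D dsumND.

Lemma dsumZA a b f : dsumZ a (dsumZ b f) = dsumZ (a * b) f.
Proof. by apply: dsumP => j /=; rewrite scalerA. Qed.
Lemma dsumZ1 : left_id 1 dsumZ.
Proof. by move=> f; apply: dsumP => j /=; rewrite scale1r. Qed.
Lemma dsumZDr : right_distributive dsumZ +%R.
Proof. by move=> a f g; apply: dsumP => j /=; rewrite scalerDr. Qed.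
Lemma dsumZDl f : {morph dsumZ^~ f : a b / a + b}.
Proof. by move=> a b; apply: dsumP => j /=; rewrite scalerDl. Qed.
HB.instance Definition _ := GRing.Zmodule_isLmodule.Build l dsum dsumZA dsumZ1 dsumZDr dsumZDl.

Lemma dsumDE f g j : (f + g) j = f j + g j. Proof. by []. Qed.
Lemma dsumZE c f j : (c *: f) j = c *: f j. Proof. by []. Qed.
Lemma dsum0E j : (0 : dsum) j = 0. Proof. by []. Qed.

Lemma dinj_subproof j (a : M j) : `[< finite_set [set i | dfwith (fun k => 0 : M k) a i != 0] >].
Proof.
apply/asboolP; apply: (sub_finite_set _ (finite_set1 j)) => i /=.
by apply: contra_neqP => /eqP ij; rewrite dfwith_out // eq_sym.
Qed.
Definition dinj j (a : M j) : dsum := DSum (dinj_subproof a).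

Lemma dinj_id j (a : M j) : dinj a j = a.
Proof. exact: dfwith_in. Qed.
Lemma dinj_neq j i (a : M j) : j != i -> dinj a i = 0.
Proof. exact: dfwith_out. Qed.

Lemma dinj_linear j : linear (@dinj j).
Proof.
move=> c a b; apply: dsumP => i; rewrite dsumDE dsumZE.
have [<-|ji] := eqVneq j i; first by rewrite !dinj_id.
by rewrite !dinj_neq // scaler0 addr0.
Qed.
HB.instance Definition _ j := GRing.isLinear.Build l (M j) dsum _ (@dinj j) (@dinj_linear j).

Section Lift.
Variables (W : lmodType l) (m : forall j, M j -> W) (mL : forall j, linear (@m j)).

Definition dlift f : W := \sum_(j \in [set: J]) m (f j).

Lemma dliftE f (r : seq J) : uniq r -> (forall j, j \notin r -> f j = 0) ->
  dlift f = \sum_(j <- r) m (f j).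
Proof.
move=> ur rf; have m0 j : m (0 : M j) = 0.
  by rewrite -[0]subr0 (GRing.zmod_morphism_linear (@mL j)) subrr.
rewrite /dlift (fsbigE r) //.
- by apply: eq_bigl => j; rewrite in_setT.
- by move=> j _ /rf ->; rewrite m0.
Qed.

Lemma dsum_supp2 f g : exists r : seq J,
  [/\ uniq r, forall j, j \notin r -> f j = 0 & forall j, j \notin r -> g j = 0].
Proof.
have : finite_set ([set j | f j != 0] `|` [set j | g j != 0]).
  by rewrite finite_setU; split; exact: dsum_fin.
case/finite_fsetP => X EX; exists X; split; first exact: fset_uniq.
  move=> j; apply: contraNeq => fj.
  by have : [set` X] j by rewrite -EX; left.
move=> j; apply: contraNeq => fj.
by have : [set` X] j by rewrite -EX; right.
Qed.

Lemma dlift_linear : linear dlift.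
Proof.
move=> c f g; have [r [ur rf rg]] := dsum_supp2 f g.
rewrite !(@dliftE _ r) //; last by move=> j jr; rewrite dsumDE dsumZE rf // rg // scaler0 addr0.
rewrite scaler_sumr -big_split /=; apply: eq_bigr => j _.
exact: mL.
Qed.

Lemma dlift_inj j (a : M j) : dlift (dinj a) = m a.
Proof.
rewrite (@dliftE _ [:: j]) //; first by rewrite big_seq1 dinj_id.
by move=> i; rewrite inE eq_sym => /dinj_neq.
Qed.
End Lift.

Lemma dsum_sum f (r : seq J) : uniq r -> (forall j, j \notin r -> f j = 0) ->
  f = \sum_(j <- r) dinj (f j).
Proof.
move=> ur rf; apply: dsumP => i.
have E (s : seq J) : (\sum_(j <- s) dinj (f j)) i = \sum_(j <- s) dinj (f j) i.
  by elim: s => [|j s IH]; rewrite ?big_nil // !big_cons dsumDE IH.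
rewrite E; have [ir|ir] := boolP (i \in r).
  rewrite (bigD1_seq i ir ur) dinj_id big1_seq; first exact: (esym (addr0 _)).
  by move=> j /andP[ji _]; rewrite dinj_neq.
rewrite rf // big1_seq // => j /andP[_ jr]; rewrite dinj_neq //.
by apply: contraNneq ir => <-.
Qed.

Lemma dsum_ind (P : dsum -> Prop) : P 0 -> (forall f g, P f -> P g -> P (f + g)) ->
  (forall j (a : M j), P (dinj a)) -> forall f, P f.
Proof.
move=> P0 PD Pi f; have [r [ur rf _]] := dsum_supp2 f f.
rewrite (dsum_sum ur rf); elim: r {ur rf} => [|j r IH]; first by rewrite big_nil.
by rewrite big_cons; apply: PD.
Qed.
End DirectSum.

Arguments dinj {l J M} j a.

Section DirectSumAlgebra.
Variables (l : comPzRingType) (J : choiceType) (A : J -> nuAlgType l).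

Definition dsumAlg := dsum (fun j => A j : lmodType l).
HB.instance Definition _ := GRing.Lmodule.on dsumAlg.
Implicit Types f g h : dsumAlg.

Lemma dsumM_subproof f g : `[< finite_set [set j | f j ** g j != 0] >].
Proof.
apply/asboolP; apply: (sub_finite_set _ (dsum_fin f)) => j /=.
by apply: contra_neq => ->; rewrite amul0l.
Qed.
Definition dsumM f g : dsumAlg := DSum (dsumM_subproof f g).

Lemma dsumMA : associative dsumM.
Proof. by move=> f g h; apply: dsumP => j /=; rewrite amulA. Qed.
Lemma dsumMDl : left_distributive dsumM +%R.
Proof. by move=> f g h; apply: dsumP => j /=; rewrite amulDl. Qed.
Lemma dsumMDr : right_distributive dsumM +%R.
Proof. by move=> f g h; apply: dsumP => j /=; rewrite amulDr. Qed.
Lemma dsumMZl (c : l) f g : dsumM (c *: f) g = c *: dsumM f g.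
Proof. by apply: dsumP => j /=; rewrite amulZl. Qed.
Lemma dsumMZr (c : l) f g : dsumM f (c *: g) = c *: dsumM f g.
Proof. by apply: dsumP => j /=; rewrite amulZr. Qed.
HB.instance Definition _ :=
  isNUAlgebra.Build l dsumAlg dsumMA dsumMDl dsumMDr dsumMZl dsumMZr.

Lemma dsumAlgME f g j : (f ** g) j = (f j : A j) ** g j.
Proof. by []. Qed.

Lemma dsumAlg_ind (Q : dsumAlg -> Prop) : Q 0 -> (forall f g, Q f -> Q g -> Q (f + g)) ->
  (forall j (a : A j), Q (dinj j a)) -> forall f, Q f.
Proof. exact: dsum_ind. Qed.

Lemma dinjM_id j (a b : A j) :
  (dinj j a : dsumAlg) ** (dinj j b : dsumAlg) = (dinj j (a ** b) : dsumAlg).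
Proof.
apply: dsumP => i; rewrite dsumAlgME.
have [<-|ji] := eqVneq j i; first by rewrite !dinj_id.
by rewrite !dinj_neq // amul0l.
Qed.
Lemma dinjM_neq j i (a : A j) (b : A i) : j != i ->
  (dinj j a : dsumAlg) ** (dinj i b : dsumAlg) = 0.
Proof.
move=> ji; apply: dsumP => k; rewrite dsumAlgME.
have [<-|jk] := eqVneq j k; last by rewrite (dinj_neq a jk) amul0l.
by rewrite (@dinj_neq _ _ _ i) ?amul0r // eq_sym.
Qed.

Definition dsumIn j : algHom (A j) dsumAlg :=
  @AlgHom l (A j) dsumAlg (dinj j)
    (@dinj_linear l J (fun i => A i : lmodType l) j) (fun a b => esym (dinjM_id a b)).
End DirectSumAlgebra.

(* The algebra l^(I) of finitely supported functions, with pointwise operations. *)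
Definition funAlg (l : comPzRingType) (I : choiceType) : nuAlgType l :=
  dsumAlg (fun _ : I => l^o : nuAlgType l).

Definition chi (l : comPzRingType) (I : choiceType) (i : I) : funAlg l I :=
  dinj i (1 : l^o).

Section OrthogonalIdempotents.
Variables (l : comPzRingType) (I : choiceType) (A : nuAlgType l) (p : I -> A).
Hypothesis pM : forall i j, p i ** p j = if i == j then p i else 0.

Let m (i : I) (c : l^o) : A := (c : l) *: p i.
Lemma oidem_subproof i : linear (@m i).
Proof. by move=> c x y; rewrite /m scalerDl scalerA. Qed.

Lemma oidemM : {morph (dlift m : funAlg l I -> A) : f g / f ** g}.
Proof.
have mL := dlift_linear oidem_subproof.
pose d : {linear funAlg l I -> A} := HB.pack (dlift m : funAlg l I -> A)
  (GRing.isLinear.Build l (funAlg l I) A _ (dlift m) mL).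
suff H f g : d (f ** g) = d f ** d g by [].
move: f; apply: (@dsumAlg_ind l I (fun=> l^o : nuAlgType l)) => [|f f' IH IH'|i a].
- by rewrite amul0l linear0 amul0l.
- by rewrite amulDl !linearD amulDl IH IH'.
move: g; apply: (@dsumAlg_ind l I (fun=> l^o : nuAlgType l)) => [|f f' IH IH'|j b].
- by rewrite amul0r linear0 amul0r.
- by rewrite amulDr !linearD IH IH'.
have E k (c : l^o) : d (dinj k c) = (c : l) *: p k by exact: (dlift_inj oidem_subproof).
rewrite !E amulZl amulZr pM.
case: eqVneq => [<-|ij]; first by rewrite dinjM_id E scalerA.
by rewrite dinjM_neq // linear0 !scaler0.
Qed.

(* chi_i |-> p_i *)
Definition oidemHom : algHom (funAlg l I) A :=
  @AlgHom l (funAlg l I) A (dlift m) (dlift_linear oidem_subproof) oidemM.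

Lemma oidemHom_chi i : oidemHom (chi l i) = p i.
Proof. by rewrite [LHS](dlift_inj oidem_subproof) /m scale1r. Qed.
End OrthogonalIdempotents.

(* Semigroup algebras of semigroups with zero: the elements are the finitely
   supported families indexed by the nonzero elements of the semigroup, and
   [None] stands for the zero.  Polynomials, finite matrices and free algebras
   are instances. *)

Record semigroup0 := Semigroup0 {
  sg_sort :> choiceType;
  sg_op : sg_sort -> sg_sort -> option sg_sort;
  sg_opA : forall i j k,
    obind (fun u => sg_op u k) (sg_op i j) = obind (sg_op i) (sg_op j k)
}.

Section SemigroupAlgebra.
Variables (l : comPzRingType) (P : semigroup0) (A : nuAlgType l).

Definition sgAlg := dsum (fun _ : P => A : lmodType l).
HB.instance Definition _ := GRing.Lmodule.on sgAlg.
Implicit Types f g h : sgAlg.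

Definition sgIn (o : option P) (a : A) : sgAlg := if o is Some k then dinj k a else 0.
Lemma sgIn_linear o : linear (sgIn o).
Proof. by case: o => [k|] c x y /=; [exact: dinj_linear|rewrite scaler0 addr0]. Qed.
HB.instance Definition _ o := GRing.isLinear.Build l A sgAlg _ (sgIn o) (sgIn_linear o).

Let m1 (i : P) (a : A) (j : P) (b : A) : sgAlg := sgIn (sg_op i j) (a ** b).
Let m2 g (i : P) (a : A) : sgAlg := dlift (m1 i a) g.
Definition sgM f g : sgAlg := dlift (m2 g) f.

Lemma sgM_subproof1 i a j : linear (m1 i a j).
Proof. by move=> c x y; rewrite /m1 amulDr amulZr linearP. Qed.
Lemma sgM_subproof2 g i : linear (m2 g i).
Proof.
move=> c x y; have [r [ur rg _]] := dsum_supp2 g g.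
rewrite /m2 !(@dliftE _ _ _ _ _ (sgM_subproof1 _ _) _ r) //.
rewrite scaler_sumr -big_split /=; apply: eq_bigr => j _.
by rewrite /m1 amulDl amulZl linearP.
Qed.

Lemma sgM_linear_l g : linear (sgM^~ g).
Proof. exact: (dlift_linear (sgM_subproof2 g)). Qed.
Lemma sgM_linear_r f : linear (sgM f).
Proof.
move=> c x y; have [r [ur rf _]] := dsum_supp2 f f.
rewrite /sgM !(@dliftE _ _ _ _ _ (sgM_subproof2 _) _ r) //.
rewrite scaler_sumr -big_split /=; apply: eq_bigr => j _.
exact: (dlift_linear (sgM_subproof1 _ _)).
Qed.
Lemma sgM_inj i j a b : sgM (dinj i a) (dinj j b) = sgIn (sg_op i j) (a ** b).
Proof.
by rewrite /sgM (dlift_inj (sgM_subproof2 _)) /m2 (dlift_inj (sgM_subproof1 _ _)).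
Qed.

Lemma sgMDl : left_distributive sgM +%R.
Proof. by move=> f g h; have := sgM_linear_l h 1 f g; rewrite !scale1r. Qed.
Lemma sgMDr : right_distributive sgM +%R.
Proof. by move=> f g h; have := sgM_linear_r f 1 g h; rewrite !scale1r. Qed.
Lemma sgM0l g : sgM 0 g = 0.
Proof. by apply: (addIr (sgM 0 g)); rewrite -sgMDl !add0r. Qed.
Lemma sgM0r g : sgM g 0 = 0.
Proof. by apply: (addIr (sgM g 0)); rewrite -sgMDr !add0r. Qed.
Lemma sgMZl (c : l) f g : sgM (c *: f) g = c *: sgM f g.
Proof. by have := sgM_linear_l g c f 0; rewrite sgM0l !addr0. Qed.
Lemma sgMZr (c : l) f g : sgM f (c *: g) = c *: sgM f g.
Proof. by have := sgM_linear_r f c g 0; rewrite sgM0r !addr0. Qed.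
Lemma sgMA : associative sgM.
Proof.
apply: (@dsum_ind l P (fun=> A : lmodType l)) => [g h|f f' IH IH' g h|i a].
- by rewrite !sgM0l.
- by rewrite !sgMDl IH IH'.
apply: (@dsum_ind l P (fun=> A : lmodType l)) => [h|f f' IH IH' h|j b].
- by rewrite !(sgM0l, sgM0r).
- by rewrite !(sgMDl, sgMDr) IH IH'.
apply: (@dsum_ind l P (fun=> A : lmodType l)) => [|f f' IH IH'|k c].
- by rewrite !sgM0r.
- by rewrite !sgMDr IH IH'.
rewrite !sgM_inj; have := sg_opA i j k.
case: (sg_op i j) => [u|] /=; case: (sg_op j k) => [v|] /=;
  rewrite ?sgM_inj ?sgM0l ?sgM0r.
- by move=> ->; rewrite amulA.
- by move=> ->.
- by move=> <-.
- by [].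
Qed.
HB.instance Definition _ := isNUAlgebra.Build l sgAlg sgMA sgMDl sgMDr sgMZl sgMZr.

Section Idempotent.
Variables (i : P) (ii : sg_op i i = Some i).
Lemma sgInM : {morph (dinj i : A -> sgAlg) : a b / a ** b}.
Proof. by move=> a b; rewrite [RHS]sgM_inj ii. Qed.
Definition sgInHom : algHom A sgAlg :=
  @AlgHom l A sgAlg (dinj i) (@dinj_linear l P (fun=> A : lmodType l) i) sgInM.
End Idempotent.
End SemigroupAlgebra.

(* the powers t^n *)
Lemma powersA (i j k : nat) : obind (fun u => Some (u + k)%N) (Some (i + j)%N) =
  obind (fun u => Some (i + u)%N) (Some (j + k)%N).
Proof. by rewrite /= addnA. Qed.
Definition powers : semigroup0 := Semigroup0 powersA.

(* the matrix units, indexed by S x S *)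
Definition munit_op (S : choiceType) (x y : S * S) : option (S * S) :=
  if x.2 == y.1 then Some (x.1, y.2) else None.
Lemma munit_opA (S : choiceType) (i j k : S * S) :
  obind (fun u => munit_op u k) (munit_op i j) = obind (munit_op i) (munit_op j k).
Proof.
rewrite /munit_op; case: ifP => ij; case: ifP => jk //=; rewrite ?ij ?jk //.
Qed.
Definition munits (S : choiceType) : semigroup0 := Semigroup0 (@munit_opA S).
Lemma munit_idem (S : choiceType) (s : S) : @sg_op (munits S) (s, s) (s, s) = Some (s, s).
Proof. by rewrite /= /munit_op eqxx. Qed.

(* the nonempty words in the alphabet G; (x, w) is the word x :: w *)
Definition word_op (G : choiceType) (u v : G * seq G) : option (G * seq G) :=
  Some (u.1, u.2 ++ v.1 :: v.2).
Lemma word_opA (G : choiceType) (i j k : G * seq G) :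
  obind (fun u => word_op u k) (word_op i j) = obind (word_op i) (word_op j k).
Proof. by rewrite /= /word_op /= -catA. Qed.
Definition words (G : choiceType) : semigroup0 := Semigroup0 (@word_opA G).

Section SemigroupAlgebraInstances.
Variables (l : comPzRingType) (A : nuAlgType l).
Definition polyAlg : nuAlgType l := sgAlg powers A.
Definition polyConst : algHom A polyAlg := @sgInHom l powers A 0%N erefl.
Definition matAlg (S : choiceType) : nuAlgType l := sgAlg (munits S) A.
(* a |-> epsilon_(s,s) (x) a *)
Definition matCorner (S : choiceType) (s : S) : algHom A (matAlg S) :=
  @sgInHom l (munits S) A (s, s) (munit_idem s).
End SemigroupAlgebraInstances.

Definition freeAlg (l : comPzRingType) (G : choiceType) : nuAlgType l :=
  sgAlg (words G) (l^o : nuAlgType l).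
Definition fgen (l : comPzRingType) (G : choiceType) (x : G) : freeAlg l G :=
  @dinj l (words G) (fun=> l^o) (x, [::]) (1 : l^o).

Record submodule (l : comPzRingType) (M : lmodType l) := Submodule {
  sub_set :> M -> Prop;
  sub0 : sub_set 0;
  subP : forall (c : l) x y, sub_set x -> sub_set y -> sub_set (c *: x + y)
}.

Section Submodule.
Variables (l : comPzRingType) (M : lmodType l).

Section Span.
Variable X : set M.
Definition span_set : set M := [set x | forall N : submodule M, (forall y, X y -> N y) -> N x].
Lemma span0 : span_set 0.
Proof. by move=> N _; exact: sub0. Qed.
Lemma spanP (c : l) x y : span_set x -> span_set y -> span_set (c *: x + y).
Proof. by move=> sx sy N XN; apply: subP; [exact: sx|exact: sy]. Qed.
Definition span : submodule M := Submodule span0 spanP.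
Lemma span_incl x : X x -> span x.
Proof. by move=> Xx N; apply. Qed.
End Span.

Variable N : submodule M.

Lemma subZ (c : l) x : N x -> N (c *: x).
Proof. by move=> Nx; rewrite -[_ *: _]addr0; apply: subP => //; exact: sub0. Qed.
Lemma subD x y : N x -> N y -> N (x + y).
Proof. by move=> Nx Ny; rewrite -[x]scale1r; apply: subP. Qed.
Lemma subB x y : N x -> N y -> N (x - y).
Proof. by move=> Nx Ny; rewrite addrC -scaleN1r; apply: subP. Qed.

Definition sub_pred : {pred M} := fun x => `[< N x >].
Lemma sub_predP x : reflect (N x) (x \in sub_pred).
Proof. exact: asboolP. Qed.
Lemma sub_pred_closed : subsemimod_closed sub_pred.
Proof.
split; last by move=> c x /sub_predP Nx; apply/sub_predP; exact: subZ.
by split; [apply/sub_predP; exact: sub0|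
  move=> x y /sub_predP Nx /sub_predP Ny; apply/sub_predP; exact: subD].
Qed.
Lemma sub_pred_zmod : zmod_closed sub_pred.
Proof.
split; first by apply/sub_predP; exact: sub0.
by move=> x y /sub_predP Nx /sub_predP Ny; apply/sub_predP; exact: subB.
Qed.
HB.instance Definition _ := GRing.isZmodClosed.Build M sub_pred sub_pred_zmod.

Definition quotMod := {ideal_quot sub_pred}.
HB.instance Definition _ := GRing.Zmodule.on quotMod.
Definition quotPi (x : M) : quotMod := \pi_({ideal_quot sub_pred}) x.

Lemma quotPi_surj (x : quotMod) : exists y, quotPi y = x.
Proof. by exists (repr x); exact: reprK. Qed.
Lemma quotPiP x y : quotPi x = quotPi y <-> N (x - y).
Proof.
rewrite /quotPi; split=> [/eqP|Nxy].
  by rewrite -Quotient.idealrBE => /sub_predP.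
by apply/eqP; rewrite -Quotient.idealrBE; apply/sub_predP.
Qed.
Lemma quotPiD : {morph quotPi : x y / x + y}.
Proof. by move=> x y; rewrite /quotPi; exact: (Quotient.pi_add sub_pred). Qed.

Definition quotZ (c : l) (x : quotMod) : quotMod := quotPi (c *: repr x).
Lemma quotPiZ c x : quotZ c (quotPi x) = quotPi (c *: x).
Proof.
apply/quotPiP; rewrite -scalerBr; apply: subZ; apply/quotPiP.
by rewrite /quotPi reprK.
Qed.
Lemma quotZA a b x : quotZ a (quotZ b x) = quotZ (a * b) x.
Proof. by have [y <-] := quotPi_surj x; rewrite !quotPiZ scalerA. Qed.
Lemma quotZ1 : left_id 1 quotZ.
Proof. by move=> x; have [y <-] := quotPi_surj x; rewrite !quotPiZ scale1r. Qed.
Lemma quotZDr : right_distributive quotZ +%R.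
Proof.
move=> a x y; have [x' <-] := quotPi_surj x; have [y' <-] := quotPi_surj y.
by rewrite -quotPiD !quotPiZ scalerDr quotPiD.
Qed.
Lemma quotZDl x : {morph quotZ^~ x : a b / a + b}.
Proof.
by move=> a b; have [y <-] := quotPi_surj x; rewrite !quotPiZ scalerDl quotPiD.
Qed.
HB.instance Definition _ := GRing.Zmodule_isLmodule.Build l quotMod quotZA quotZ1 quotZDr quotZDl.

Lemma quotPi_linear : linear quotPi.
Proof. by move=> c x y; rewrite quotPiD -quotPiZ. Qed.
HB.instance Definition _ := GRing.isLinear.Build l M quotMod _ quotPi quotPi_linear.

Section QuotLift.
Variables (W : lmodType l) (f : {linear M -> W}).
Definition quotLift (x : quotMod) : W := f (repr x).
Hypothesis fN : forall x, N x -> f x = 0.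
Lemma quotLift_pi x : quotLift (quotPi x) = f x.
Proof.
apply/eqP; rewrite -subr_eq0 -linearB /=; apply/eqP/fN/quotPiP.
by rewrite /quotPi reprK.
Qed.
Lemma quotLift_linear : linear quotLift.
Proof.
move=> c x y; have [x' <-] := quotPi_surj x; have [y' <-] := quotPi_surj y.
by rewrite -quotPi_linear !quotLift_pi linearP.
Qed.
End QuotLift.
End Submodule.

Record ideal (l : comPzRingType) (A : nuAlgType l) := Ideal {
  ideal_sub :> submodule A;
  idealMl : forall a x, ideal_sub x -> ideal_sub (a ** x);
  idealMr : forall a x, ideal_sub x -> ideal_sub (x ** a)
}.

Section Ideal.
Variables (l : comPzRingType) (A : nuAlgType l).

Section Generated.
Variable X : set A.
Definition igen_set : set A := [set x | forall I : ideal A, (forall y, X y -> I y) -> I x].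
Lemma igen0 : igen_set 0.
Proof. by move=> N _; exact: sub0. Qed.
Lemma igenP (c : l) x y : igen_set x -> igen_set y -> igen_set (c *: x + y).
Proof. by move=> sx sy N XN; apply: subP; [exact: sx|exact: sy]. Qed.
Lemma igenMl a x : igen_set x -> igen_set (a ** x).
Proof. by move=> sx N XN; apply: idealMl; exact: sx. Qed.
Lemma igenMr a x : igen_set x -> igen_set (x ** a).
Proof. by move=> sx N XN; apply: idealMr; exact: sx. Qed.
Definition idealGen : ideal A := @Ideal l A (Submodule igen0 igenP) igenMl igenMr.
Lemma idealGen_incl x : X x -> idealGen x.
Proof. by move=> Xx I; apply. Qed.
End Generated.

Variable I : ideal A.

Record idealAlg := IdealElt { ival :> A; _ : sub_pred I ival }.
HB.instance Definition _ := [isSub for ival].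
HB.instance Definition _ := [Choice of idealAlg by <:].
HB.instance Definition _ :=
  GRing.SubChoice_isSubLmodule.Build l A (sub_pred I) idealAlg (sub_pred_closed I).

Lemma ivalP (x : idealAlg) : I (ival x).
Proof. by case: x => x /= /asboolP. Qed.
Lemma idealM_subproof (x y : idealAlg) : sub_pred I (ival x ** ival y).
Proof. by apply/asboolP; apply: idealMl; exact: ivalP. Qed.
Definition idealM x y := IdealElt (idealM_subproof x y).
Lemma idealMA : associative idealM.
Proof. by move=> x y z; apply: val_inj => /=; rewrite amulA. Qed.
Lemma idealMDl : left_distributive idealM +%R.
Proof. by move=> x y z; apply: val_inj => /=; rewrite amulDl. Qed.
Lemma idealMDr : right_distributive idealM +%R.
Proof. by move=> x y z; apply: val_inj => /=; rewrite amulDr. Qed.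
Lemma idealMZl (c : l) x y : idealM (c *: x) y = c *: idealM x y.
Proof. by apply: val_inj => /=; rewrite amulZl. Qed.
Lemma idealMZr (c : l) x y : idealM x (c *: y) = c *: idealM x y.
Proof. by apply: val_inj => /=; rewrite amulZr. Qed.
HB.instance Definition _ :=
  isNUAlgebra.Build l idealAlg idealMA idealMDl idealMDr idealMZl idealMZr.

Definition idealInc : algHom idealAlg A :=
  @AlgHom l idealAlg A ival (fun _ _ _ => erefl) (fun _ _ => erefl).

Definition quotAlg := quotMod I.
HB.instance Definition _ := GRing.Lmodule.on quotAlg.
Definition quotM (x y : quotAlg) : quotAlg := quotPi I (repr x ** repr y).
Lemma quotPiM a b : quotM (quotPi I a) (quotPi I b) = quotPi I (a ** b).
Proof.
apply/quotPiP; have rP c : I (repr (quotPi I c) - c).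
  by apply/quotPiP; rewrite /quotPi reprK.
rewrite (_ : _ - _ = (repr (quotPi I a) - a) ** repr (quotPi I b)
                     + a ** (repr (quotPi I b) - b)); last first.
  by rewrite amulBl amulBr addrA subrK.
by apply: subD; [apply: idealMr|apply: idealMl]; exact: rP.
Qed.
Lemma quotMA : associative quotM.
Proof.
move=> x y z; have [x' <-] := quotPi_surj x; have [y' <-] := quotPi_surj y.
by have [z' <-] := quotPi_surj z; rewrite !quotPiM amulA.
Qed.
Lemma quotMDl : left_distributive quotM +%R.
Proof.
move=> x y z; have [x' <-] := quotPi_surj x; have [y' <-] := quotPi_surj y.
have [z' <-] := quotPi_surj z.
by rewrite -quotPiD !quotPiM amulDl quotPiD.
Qed.
Lemma quotMDr : right_distributive quotM +%R.
Proof.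
move=> x y z; have [x' <-] := quotPi_surj x; have [y' <-] := quotPi_surj y.
have [z' <-] := quotPi_surj z.
by rewrite -quotPiD !quotPiM amulDr quotPiD.
Qed.
Lemma quotMZl (c : l) x y : quotM (c *: x) y = c *: quotM x y.
Proof.
have [x' <-] := quotPi_surj x; have [y' <-] := quotPi_surj y.
by rewrite -linearZ /= !quotPiM amulZl linearZ.
Qed.
Lemma quotMZr (c : l) x y : quotM x (c *: y) = c *: quotM x y.
Proof.
have [x' <-] := quotPi_surj x; have [y' <-] := quotPi_surj y.
by rewrite -linearZ /= !quotPiM amulZr linearZ.
Qed.
HB.instance Definition _ := isNUAlgebra.Build l quotAlg quotMA quotMDl quotMDr quotMZl quotMZr.

Lemma quotProjM : {morph (quotPi I : A -> quotAlg) : x y / x ** y}.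
Proof. by move=> x y; rewrite [RHS]quotPiM. Qed.
Definition quotProj : algHom A quotAlg := @AlgHom l A quotAlg (quotPi I) (quotPi_linear I) quotProjM.
End Ideal.

Section TensorModule.
Variables (l : comPzRingType) (M N : lmodType l).

Let F := dsum (fun _ : M * N => l^o : lmodType l).
Let sym (x : M) (y : N) : F := @dinj l (M * N)%type (fun=> l^o) (x, y) (1 : l^o).

Definition tens_rel : set F :=
  [set u | exists x x' y, u = sym (x + x') y - sym x y - sym x' y] `|`
  [set u | exists x y y', u = sym x (y + y') - sym x y - sym x y'] `|`
  [set u | exists (c : l) x y, u = sym (c *: x) y - c *: sym x y] `|`
  [set u | exists (c : l) x y, u = sym x (c *: y) - c *: sym x y].

Definition tensor := quotMod (span tens_rel).
HB.instance Definition _ := GRing.Lmodule.on tensor.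
Definition tens (x : M) (y : N) : tensor := quotPi (span tens_rel) (sym x y).

Lemma tensDl x x' y : tens (x + x') y = tens x y + tens x' y.
Proof.
rewrite /tens -linearD; apply/quotPiP; rewrite opprD addrA.
by apply: span_incl; left; left; left; exists x, x', y.
Qed.
Lemma tensDr x y y' : tens x (y + y') = tens x y + tens x y'.
Proof.
rewrite /tens -linearD; apply/quotPiP; rewrite opprD addrA.
by apply: span_incl; left; left; right; exists x, y, y'.
Qed.
Lemma tensZl (c : l) x y : tens (c *: x) y = c *: tens x y.
Proof.
rewrite /tens -linearZ; apply/quotPiP.
by apply: span_incl; left; right; exists c, x, y.
Qed.
Lemma tensZr (c : l) x y : tens x (c *: y) = c *: tens x y.
Proof.
rewrite /tens -linearZ; apply/quotPiP.
by apply: span_incl; right; exists c, x, y.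
Qed.
Lemma tens0l y : tens 0 y = 0.
Proof. by apply: (addIr (tens 0 y)); rewrite -tensDl !add0r. Qed.
Lemma tens_linear_l y : linear (tens^~ y).
Proof. by move=> c x x'; rewrite tensDl tensZl. Qed.
Lemma tens_linear_r x : linear (tens x).
Proof. by move=> c y y'; rewrite tensDr tensZr. Qed.

Lemma tens_ind (P : tensor -> Prop) : P 0 -> (forall u v, P u -> P v -> P (u + v)) ->
  (forall x y, P (tens x y)) -> forall u, P u.
Proof.
move=> P0 PD Pt u; have [v <-] := quotPi_surj u.
move: v; apply: dsum_ind => [|f g Pf Pg|[x y] c].
- by rewrite linear0.
- by rewrite linearD; apply: PD.
have -> : @dinj l (M * N)%type (fun=> l^o) (x, y) c = (c : l) *: sym x y.
  rewrite /sym -(scalable_linear (@dinj_linear l (M * N)%type (fun=> l^o) (x, y))).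
  by congr dinj; rewrite /GRing.scale /= mulr1.
have <- : tens ((c : l) *: x) y = quotPi (span tens_rel) ((c : l) *: sym x y).
  by rewrite tensZl /tens -linearZ.
exact: Pt.
Qed.

Section TensorLift.
Variables (W : lmodType l) (f : M -> N -> W).
Hypotheses (fl : forall y, linear (f^~ y)) (fr : forall x, linear (f x)).

Let m (p : M * N) (c : l^o) : W := (c : l) *: f p.1 p.2.
Lemma tlift_subproof1 p : linear (@m p).
Proof. by move=> c x y; rewrite /m scalerDl scalerA. Qed.
Let d (u : F) : W := dlift m u.
Lemma tlift_subproof2 : linear d.
Proof. exact: dlift_linear tlift_subproof1. Qed.
HB.instance Definition _ := GRing.isLinear.Build l F W _ d tlift_subproof2.

Definition tlift (u : tensor) : W := quotLift d u.

Lemma tlift_subproof3 x y : d (sym x y) = f x y.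
Proof. by rewrite /d (dlift_inj tlift_subproof1) /m scale1r. Qed.
Lemma tlift_subproof4 u : span tens_rel u -> d u = 0.
Proof.
have K0 : d 0 = 0 by rewrite linear0.
have KP (c : l) x y : d x = 0 -> d y = 0 -> d (c *: x + y) = 0.
  by move=> dx dy; rewrite linearP /= dx dy scaler0 addr0.
move/(_ (Submodule K0 KP)); apply => {}u /=.
have fDl x x' y : f (x + x') y = f x y + f x' y.
  by have := fl y 1 x x'; rewrite !scale1r.
have fDr x y y' : f x (y + y') = f x y + f x y'.
  by have := fr x 1 y y'; rewrite !scale1r.
have f0l y : f 0 y = 0 by apply: (addIr (f 0 y)); rewrite -fDl !add0r.
have f0r x : f x 0 = 0 by apply: (addIr (f x 0)); rewrite -fDr !add0r.
case=> [[[|]|]|] [a [b [c ->]]]; rewrite !linearB ?linearZ /= !tlift_subproof3.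
- by rewrite fDl addrAC addrK subrr.
- by rewrite fDr addrAC addrK subrr.
- by have := fl c a b 0; rewrite f0l !addr0 => ->; rewrite scalerN subrr.
- by have := fr b a c 0; rewrite f0r !addr0 => ->; rewrite scalerN subrr.
Qed.

Lemma tlift_tens x y : tlift (tens x y) = f x y.
Proof. exact: etrans (quotLift_pi tlift_subproof4 _) (tlift_subproof3 _ _). Qed.
Lemma tlift_linear : linear tlift.
Proof. exact: (quotLift_linear tlift_subproof4). Qed.
End TensorLift.

Lemma tens_ext (W : lmodType l) (f g : tensor -> W) : linear f -> linear g ->
  (forall x y, f (tens x y) = g (tens x y)) -> f =1 g.
Proof.
move=> fL gL fg; pose f' : {linear tensor -> W} := HB.pack f
  (GRing.isLinear.Build l tensor W _ f fL).
pose g' : {linear tensor -> W} := HB.pack g (GRing.isLinear.Build l tensor W _ g gL).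
suff H u : f' u = g' u by [].
by move: u; apply: tens_ind => [|u v IH IH'|x y]; rewrite ?linear0 // !linearD IH IH'.
Qed.
End TensorModule.

Section TensorMap.
Variables (l : comPzRingType) (M M' N : lmodType l) (f : {linear M -> M'}).

Let m x y := tens (f x) (y : N).
Lemma tmap_subproofl y : linear (m^~ y).
Proof. by move=> c x x'; rewrite /m linearP tens_linear_l. Qed.
Lemma tmap_subproofr x : linear (m x).
Proof. exact: tens_linear_r. Qed.

(* f (x) id_N *)
Definition tmap : tensor M N -> tensor M' N := tlift m.
Lemma tmap_tens x y : tmap (tens x y) = tens (f x) y.
Proof. exact: (tlift_tens tmap_subproofl tmap_subproofr). Qed.
Lemma tmap_linear : linear tmap.
Proof. exact: (tlift_linear tmap_subproofl tmap_subproofr). Qed.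
HB.instance Definition _ :=
  GRing.isLinear.Build l (tensor M N) (tensor M' N) _ tmap tmap_linear.
Lemma tmap0 : tmap 0 = 0. Proof. exact: linear0. Qed.
Lemma tmapD u v : tmap (u + v) = tmap u + tmap v. Proof. exact: linearD. Qed.
End TensorMap.
Arguments tmap {l M M'} N f u.

Section TensorAlgebra.
Variables (l : comPzRingType) (A B : nuAlgType l).

Definition tensAlg := tensor A B.
HB.instance Definition _ := GRing.Lmodule.on tensAlg.

Let m1 (a : A) (b : B) (a' : A) (b' : B) : tensAlg := tens (a ** a') (b ** b').
Let m2 (v : tensAlg) (a : A) (b : B) : tensAlg := tlift (m1 a b) v.
Definition tensM (u v : tensAlg) : tensAlg := tlift (m2 v) u.

Lemma tensM_subproof1 a b b' : linear ((m1 a b)^~ b').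
Proof. by move=> c x y; rewrite /m1 linearP [LHS]tens_linear_l. Qed.
Lemma tensM_subproof2 a b a' : linear (m1 a b a').
Proof. by move=> c x y; rewrite /m1 linearP [LHS]tens_linear_r. Qed.
Lemma m2_tens a b a' b' : m2 (tens a' b') a b = tens (a ** a') (b ** b').
Proof. exact: (tlift_tens (@tensM_subproof1 _ _) (@tensM_subproof2 _ _)). Qed.
Lemma m2_linear a b : linear (fun v => m2 v a b).
Proof. exact: (tlift_linear (@tensM_subproof1 _ _) (@tensM_subproof2 _ _)). Qed.

Lemma tensM_subproof3 v b : linear ((m2 v)^~ b).
Proof.
move=> c x y; move: v.
have mL : linear (fun v => c *: m2 v x b + m2 v y b).
  move=> d u w; rewrite !m2_linear !scalerDr !scalerA (mulrC c d).
  by rewrite addrACA.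
apply: (@tens_ext _ _ _ tensAlg _ _ (m2_linear _ _) mL) => a' b'.
by rewrite !m2_tens amulDl amulZl tens_linear_l.
Qed.
Lemma tensM_subproof4 v a : linear (m2 v a).
Proof.
move=> c x y; move: v.
have mL : linear (fun v => c *: m2 v a x + m2 v a y).
  move=> d u w; rewrite !m2_linear !scalerDr !scalerA (mulrC c d).
  by rewrite addrACA.
apply: (@tens_ext _ _ _ tensAlg _ _ (m2_linear _ _) mL) => a' b'.
by rewrite !m2_tens amulDl amulZl tens_linear_r.
Qed.

Lemma tensM_tens a b a' b' :
  tensM (tens a b) (tens a' b') = tens (a ** a') (b ** b').
Proof.
by rewrite /tensM (tlift_tens (tensM_subproof3 _) (tensM_subproof4 _)) m2_tens.
Qed.
Lemma tensM_linear_l v : linear (tensM^~ v).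
Proof. exact: (tlift_linear (tensM_subproof3 _) (tensM_subproof4 _)). Qed.
Lemma tensM_linear_r u : linear (tensM u).
Proof.
move=> c x y; move: u.
have mL : linear (fun u => c *: tensM u x + tensM u y).
  move=> d u w; rewrite !tensM_linear_l !scalerDr !scalerA (mulrC c d).
  by rewrite addrACA.
apply: (@tens_ext _ _ _ tensAlg _ _ (tensM_linear_l _) mL) => a b.
by rewrite /tensM !(tlift_tens (tensM_subproof3 _) (tensM_subproof4 _)) m2_linear.
Qed.

Lemma tensMDl : left_distributive tensM +%R.
Proof. by move=> f g h; have := tensM_linear_l h 1 f g; rewrite !scale1r. Qed.
Lemma tensMDr : right_distributive tensM +%R.
Proof. by move=> f g h; have := tensM_linear_r f 1 g h; rewrite !scale1r. Qed.
Lemma tensM0l g : tensM 0 g = 0.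
Proof. by apply: (addIr (tensM 0 g)); rewrite -tensMDl !add0r. Qed.
Lemma tensM0r g : tensM g 0 = 0.
Proof. by apply: (addIr (tensM g 0)); rewrite -tensMDr !add0r. Qed.
Lemma tensMZl (c : l) f g : tensM (c *: f) g = c *: tensM f g.
Proof. by have := tensM_linear_l g c f 0; rewrite tensM0l !addr0. Qed.
Lemma tensMZr (c : l) f g : tensM f (c *: g) = c *: tensM f g.
Proof. by have := tensM_linear_r f c g 0; rewrite tensM0r !addr0. Qed.
Lemma tensMA : associative tensM.
Proof.
apply: tens_ind => [v w|u u' IH IH' v w|a b]; first by rewrite !tensM0l.
  by rewrite !tensMDl IH IH'.
apply: tens_ind => [w|u u' IH IH' w|a' b']; first by rewrite !(tensM0l, tensM0r).
  by rewrite !(tensMDl, tensMDr) IH IH'.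
apply: tens_ind => [|u u' IH IH'|a2 b2]; first by rewrite !tensM0r.
  by rewrite !tensMDr IH IH'.
by rewrite !tensM_tens !amulA.
Qed.
HB.instance Definition _ :=
  isNUAlgebra.Build l tensAlg tensMA tensMDl tensMDr tensMZl tensMZr.
End TensorAlgebra.

Section TensorHom.
Variables (l : comPzRingType) (A A' B : nuAlgType l) (f : algHom A A').

Lemma tensHomM : {morph (tmap B f : tensAlg A B -> tensAlg A' B) : u v / u ** v}.
Proof.
have tD (u v : tensAlg A B) : tmap B f (u + v) = tmap B f u + tmap B f v by exact: raddfD.
move=> u v; move: u; apply: tens_ind => [|u u' IH IH'|a b].
- by rewrite [_ ** _]tensM0l raddf0 [RHS]tensM0l.
- by rewrite [_ ** _]tensMDl !tD IH IH' [RHS]tensMDl.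
move: v; apply: tens_ind => [|v v' IH IH'|a' b'].
- by rewrite [_ ** _]tensM0r raddf0 [RHS]tensM0r.
- by rewrite [_ ** _]tensMDr !tD IH IH' [RHS]tensMDr.
rewrite [_ ** _]tensM_tens !tmap_tens [RHS]tensM_tens.
exact: (congr1 (fun z => tens z _) (alg_funM f a a')).
Qed.
Definition tensHom : algHom (tensAlg A B) (tensAlg A' B) :=
  @AlgHom l (tensAlg A B) (tensAlg A' B) (tmap B f) (tmap_linear (N:=B) f) tensHomM.
End TensorHom.

Lemma tensAlg_ext (l : comPzRingType) (A B C : nuAlgType l) (f g : algHom (tensAlg A B) C) :
  (forall a b, f (tens a b) = g (tens a b)) -> f = g.
Proof. by move=> fg; apply: algHomP; exact: (tens_ext (alg_funL f) (alg_funL g) fg). Qed.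

Lemma tensHom_id (l : comPzRingType) (A B : nuAlgType l) :
  tensHom B (idAlg A) = idAlg (tensAlg A B).
Proof. by apply: tensAlg_ext => a b; rewrite [LHS]tmap_tens. Qed.
Lemma tensHom_comp (l : comPzRingType) (A A' A'' B : nuAlgType l)
    (g : algHom A' A'') (f : algHom A A') :
  tensHom B (compAlg g f) = compAlg (tensHom B g) (tensHom B f).
Proof. by apply: tensAlg_ext => a b; rewrite [LHS]tmap_tens /= !tmap_tens. Qed.

(* r |-> e (x) r, for an idempotent e *)
Section TensorIdempotent.
Variables (l : comPzRingType) (A B : nuAlgType l) (e : A) (ee : e ** e = e).
Lemma tensIdemM : {morph (tens e : B -> tensAlg A B) : x y / x ** y}.
Proof. by move=> x y; rewrite [RHS]tensM_tens ee. Qed.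
Definition tensIdem : algHom B (tensAlg A B) :=
  @AlgHom l B (tensAlg A B) (tens e) (tens_linear_r e) tensIdemM.
End TensorIdempotent.

Record isExtension (l : comPzRingType) (A B C : nuAlgType l)
    (i : algHom A B) (p : algHom B C) : Prop := IsExtension {
  ext_inj : injective i;
  ext_exact : forall b, p b = 0 <-> exists a, b = i a;
  ext_split : exists s : {linear C -> B}, forall c, p (s c) = c
}.

Lemma tensor_extension (l : comPzRingType) (A B C R : nuAlgType l)
    (i : algHom A B) (p : algHom B C) :
  isExtension i p -> isExtension (tensHom R i) (tensHom R p).
Proof.
case=> i_inj ex [s sK].
have pi a : p (i a) = 0 by apply/ex; exists a.
have hr b : exists a, b - s (p b) = i a by apply/ex; rewrite linearB /= sK subrr.
pose r b := projT1 (cid (hr b)).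
have rP b : i (r b) = b - s (p b) by rewrite /r; case: cid.
have rL : linear r.
  move=> c x y; apply: i_inj; rewrite rP (alg_funL i) !rP (alg_funL p) (linearP s).
  by rewrite !scalerBr opprD addrACA.
pose r' : {linear B -> A} := HB.pack r (GRing.isLinear.Build l B A _ r rL).
have r'i : cancel i r' by move=> a; apply: i_inj; rewrite rP pi linear0 subr0.
have ti u : tmap R r' (tmap R i u) = u.
  move: u; apply: tens_ind => [|u v IH IH'|x y].
  - by rewrite !tmap0.
  - by rewrite !tmapD IH IH'.
  - by rewrite !tmap_tens r'i.
have tp u : tmap R p (tmap R s u) = u.
  move: u; apply: tens_ind => [|u v IH IH'|x y].
  - by rewrite !tmap0.
  - by rewrite !tmapD IH IH'.
  - by rewrite !tmap_tens; exact: (congr1 (fun z => tens z y) (sK x)).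
have pi0 v : tmap R p (tmap R i v) = 0.
  move: v; apply: tens_ind => [|v v' IH IH'|x y].
  - by rewrite !tmap0.
  - by rewrite !tmapD IH IH' addr0.
  - by rewrite !tmap_tens -[RHS](tens0l C y); exact: (congr1 (fun z => tens z y) (pi x)).
have E u : tmap R i (tmap R r' u) + tmap R s (tmap R p u) = u.
  move: u; apply: tens_ind => [|v v' IH IH'|x y].
  - by rewrite !tmap0 addr0.
  - by rewrite !tmapD addrACA IH IH'.
  - rewrite !tmap_tens -tensDl; apply: (congr1 (fun z => tens z y)).
    by rewrite [X in X + _]rP subrK.
split.
- exact: can_inj ti.
- move=> u; split=> [pu|[v ->]]; last exact: pi0.
  by exists (tmap R r' u); rewrite -[LHS]E [tmap R p u]pu tmap0 addr0.
- by exists (tmap R s).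
Qed.

(* Every type carries a choiceType structure classically, so that the vertex and
   edge sets are arbitrary. *)
Record graph := Graph {
  vert : choiceType;
  edge : choiceType;
  src : edge -> vert;
  rng : edge -> vert
}.

Section PathAlgebras.
Variables (l : comPzRingType) (E : graph).

Definition out (v : vert E) : set (edge E) := [set e | src e = v].
Definition reg : set (vert E) := [set v | finite_set (out v) /\ out v !=set0].

(* generators v, e and e^* *)
Definition pgen : choiceType := (vert E + edge E + edge E)%type.
Let Fv (v : vert E) : freeAlg l pgen := fgen l (inl (inl v) : pgen).
Let Fe (e : edge E) : freeAlg l pgen := fgen l (inl (inr e) : pgen).
Let Fs (e : edge E) : freeAlg l pgen := fgen l (inr e : pgen).

Inductive cohn_rel : freeAlg l pgen -> freeAlg l pgen -> Prop :=
| RelVV v w : cohn_rel (Fv v ** Fv w) (if v == w then Fv v else 0)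
| RelSE e : cohn_rel (Fv (src e) ** Fe e) (Fe e)
| RelER e : cohn_rel (Fe e ** Fv (rng e)) (Fe e)
| RelRS e : cohn_rel (Fv (rng e) ** Fs e) (Fs e)
| RelSS e : cohn_rel (Fs e ** Fv (src e)) (Fs e)
| RelCK e f : cohn_rel (Fs e ** Fe f) (if e == f then Fv (rng e) else 0).

Definition cohn_ideal : ideal (freeAlg l pgen) :=
  idealGen [set x | exists a b, cohn_rel a b /\ x = a - b].
Definition cohn : nuAlgType l := quotAlg cohn_ideal.
Definition cV v : cohn := quotProj cohn_ideal (Fv v).
Definition cE e : cohn := quotProj cohn_ideal (Fe e).
Definition cS e : cohn := quotProj cohn_ideal (Fs e).

Lemma cohn_relP a b : cohn_rel a b -> quotProj cohn_ideal a = quotProj cohn_ideal b.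
Proof. by move=> r; apply/quotPiP; apply: idealGen_incl; exists a, b. Qed.
Lemma cVV v w : cV v ** cV w = if v == w then cV v else 0.
Proof.
rewrite /cV -alg_funM (cohn_relP (RelVV v w)); case: ifP => // _.
exact: raddf0.
Qed.
Lemma cVE e : cV (src e) ** cE e = cE e.
Proof. by rewrite -[LHS]alg_funM (cohn_relP (RelSE e)). Qed.
Lemma cEV e : cE e ** cV (rng e) = cE e.
Proof. by rewrite -[LHS]alg_funM (cohn_relP (RelER e)). Qed.
Lemma cVS e : cV (rng e) ** cS e = cS e.
Proof. by rewrite -[LHS]alg_funM (cohn_relP (RelRS e)). Qed.
Lemma cSV e : cS e ** cV (src e) = cS e.
Proof. by rewrite -[LHS]alg_funM (cohn_relP (RelSS e)). Qed.
Lemma cSE e f : cS e ** cE f = if e == f then cV (rng e) else 0.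
Proof.
rewrite -[LHS]alg_funM (cohn_relP (RelCK e f)); case: ifP => // _.
exact: raddf0.
Qed.

(* For a vertex emitting infinitely many edges the sum is 0; [qv] is only used
   at regular vertices. *)
Definition qsum (v : vert E) : cohn := \sum_(e \in out v) (cE e ** cS e).
Definition qv (v : vert E) : cohn := cV v - qsum v.

Lemma cVqsum v w : cV v ** qsum w = if v == w then qsum w else 0.
Proof.
rewrite /qsum; have H e : e \in finite_support 0 (out w) (fun e => cE e ** cS e) -> src e = w.
  by move: e; case: finite_supportP => // X XP _ _ e /XP.
rewrite raddf_sum /= big_seq.
have [->|vw] := eqVneq v w.
  rewrite [RHS]big_seq; apply: eq_bigr => e /H <-.
  by rewrite amulA cVE.
apply: big1 => e /H ew; rewrite amulA -(cVE e) amulA cVV ew (negbTE vw).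
by rewrite !amul0l.
Qed.
Lemma qsumcV v w : qsum w ** cV v = if w == v then qsum w else 0.
Proof.
rewrite /qsum; have H e : e \in finite_support 0 (out w) (fun e => cE e ** cS e) -> src e = w.
  by move: e; case: finite_supportP => // X XP _ _ e /XP.
rewrite [LHS](raddf_sum (amulr (cV v))) /= big_seq.
have [<-|wv] := eqVneq w v.
  rewrite [RHS]big_seq; apply: eq_bigr => e /H <-.
  by rewrite amulrE -amulA cSV.
apply: big1 => e /H ew.
by rewrite amulrE -amulA -(cSV e) -(amulA (cS e)) cVV ew (negbTE wv) !amul0r.
Qed.
Lemma qsumM v w : qsum v ** qsum w = if v == w then qsum v else 0.
Proof.
have [<-|vw] := eqVneq v w; last first.
  rewrite -[qsum w](_ : cV w ** qsum w = _); last by rewrite cVqsum eqxx.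
  by rewrite amulA qsumcV (negbTE vw) amul0l.
rewrite {1 3}/qsum [LHS](raddf_sum (amulr (qsum v))) /= big_seq [RHS]big_seq.
apply: eq_bigr => e es.
rewrite amulrE /qsum raddf_sum /= (bigD1_seq e es) /=; last first.
  by rewrite finite_support_uniq.
rewrite big1_seq ?addr0 => [|f /andP[fe _]].
  by rewrite -amulA [cS e ** _]amulA cSE eqxx cVS.
by rewrite -amulA [cS e ** _]amulA cSE eq_sym (negbTE fe) amul0l amul0r.
Qed.
Lemma qvM v w : qv v ** qv w = if v == w then qv v else 0.
Proof.
rewrite /qv amulBl !amulBr cVV cVqsum qsumcV qsumM.
case: eqVneq => [<-|_]; last by rewrite !subrr.
by rewrite subrr subr0.
Qed.

Definition ck_ideal : ideal cohn := idealGen [set x | exists2 v, reg v & x = qv v].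
Definition ckAlg : nuAlgType l := idealAlg ck_ideal.
Definition leavitt : nuAlgType l := quotAlg ck_ideal.
Definition ckInc : algHom ckAlg cohn := idealInc ck_ideal.
Definition leavittProj : algHom cohn leavitt := quotProj ck_ideal.

Lemma ckQ_subproof (v : reg) : sub_pred ck_ideal (qv (set_val v)).
Proof. by apply/asboolP; apply: idealGen_incl; exists (set_val v) => //; exact: set_valP. Qed.
Definition ckQ (v : reg) : ckAlg := IdealElt (ckQ_subproof v).
Lemma ckQM v w : ckQ v ** ckQ w = if v == w then ckQ v else 0.
Proof.
apply: val_inj; rewrite [LHS]qvM -(inj_eq val_inj).
by rewrite [set_val v == _]/(val v == val w); case: ifP.
Qed.

(* q : l^(reg(E)) -> K(E), chi_v |-> q_v *)
Definition qHom : algHom (funAlg l reg) ckAlg := oidemHom ckQM.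
(* phi : l^(E^0) -> C(E), chi_v |-> v *)
Definition phiHom : algHom (funAlg l (vert E)) cohn := oidemHom cVV.
End PathAlgebras.

Arguments reg E : clear implicits.

(* For a regular vertex v the set of edges below is finite. *)
Definition reduced_adjacency (E : graph) (v : reg E) (w : vert E) : nat :=
  #|` fset_set [set e : edge E | src e = set_val v /\ rng e = w]|.
Definition incidence (E : graph) (w : vert E) (v : reg E) : nat := (w == set_val v).
(* the entry of I - A_E^t at (w, v) *)
Definition I_sub_At (E : graph) (w : vert E) (v : reg E) : int :=
  (incidence w v)%:Z - (reduced_adjacency v w)%:Z.

Definition stabSet (E : graph) : choiceType := (vert E + edge E + nat)%type.

Record addCategory := AddCategory {
  ob :> Type;
  mor : ob -> ob -> zmodType;
  idm : forall a, mor a a;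
  comp : forall a b c, mor b c -> mor a b -> mor a c;
  compA : forall a b c d (h : mor c d) (g : mor b c) (f : mor a b),
    comp h (comp g f) = comp (comp h g) f;
  comp1m : forall a b (f : mor a b), comp (idm b) f = f;
  compm1 : forall a b (f : mor a b), comp f (idm a) = f;
  compDl : forall a b c (g g' : mor b c) (f : mor a b),
    comp (g + g') f = comp g f + comp g' f;
  compDr : forall a b c (g : mor b c) (f f' : mor a b),
    comp g (f + f') = comp g f + comp g f';
  zero_ob : exists z, idm z = 0;
  biproduct : forall a b, exists c (i1 : mor a c) (i2 : mor b c)
      (p1 : mor c a) (p2 : mor c b),
    [/\ comp p1 i1 = idm a, comp p2 i2 = idm b &
        comp i1 p1 + comp i2 p2 = idm c]
}.

Notation "g \oc f" := (comp g f) (at level 40, left associativity) : ring_scope.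

Section AddCategory.
Variable T : addCategory.

Definition inverse_of (a b : T) (f : mor a b) (g : mor b a) : Prop :=
  g \oc f = idm a /\ f \oc g = idm b.
Definition isIso (a b : T) (f : mor a b) : Prop := exists g, inverse_of f g.

(* The inverse of an isomorphism; 0 by convention if f is not invertible. *)
Definition invm (a b : T) (f : mor a b) : mor b a :=
  if pselect (isIso f) is left h then projT1 (cid h) else 0.

Lemma invP (a b : T) (f : mor a b) : isIso f -> inverse_of f (invm f).
Proof. by rewrite /invm => h; case: pselect => // h'; case: cid. Qed.

Definition eqhom (a b : T) (e : a = b) : mor a b :=
  match e in _ = c return mor a c with erefl => idm a end.

Definition isDirectSum (J : Type) (Z : J -> T) (S : T) (iota : forall j, mor (Z j) S) : Prop :=
  forall (W : T) (g : forall j, mor (Z j) W), exists! h : mor S W, forall j, h \oc iota j = g j.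

(* h : Z^(J) -> Z^(J') is given by the J' x J integer matrix N.  The sum is over
   the support of the j-th column of N, which has to be finite. *)
Definition isMatrixMap (J : Type) (J' : choiceType) (N : J' -> J -> int) (Z S S' : T)
    (iota : J -> mor Z S) (iota' : J' -> mor Z S') (h : mor S S') : Prop :=
  forall j, h \oc iota j = \sum_(i \in [set: J']) iota' i *~ N i j.
End AddCategory.

Record loopCategory := LoopCategory {
  loop_cat :> addCategory;
  Om : loop_cat -> loop_cat;
  Omf : forall a b : loop_cat, mor a b -> mor (Om a) (Om b);
  Omf1 : forall a : loop_cat, Omf (idm a) = idm (Om a);
  Omf_comp : forall (a b c : loop_cat) (g : mor b c) (f : mor a b),
    Omf (g \oc f) = Omf g \oc Omf f;
  OmfD : forall (a b : loop_cat) (f g : mor a b), Omf (f + g) = Omf f + Omf g;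
  Om_ff : forall a b : loop_cat, bijective (@Omf a b);
  Om_surj : forall b : loop_cat, exists (a : loop_cat) (u : mor (Om a) b), isIso u
}.

(* Omega tC -> tA -> tB -> tC *)
Record triangle (T : loopCategory) := Triangle {
  tA : T; tB : T; tC : T;
  td : mor (Om tC) tA;
  tf : mor tA tB;
  tg : mor tB tC
}.

Definition triMor (T : loopCategory) (t t' : triangle T)
    (u : mor (tA t) (tA t')) (v : mor (tB t) (tB t')) (w : mor (tC t) (tC t')) : Prop :=
  [/\ u \oc td t = td t' \oc Omf w, v \oc tf t = tf t' \oc u & w \oc tg t = tg t' \oc v].
Arguments triMor {T} t t' u v w.

(* The axioms TR1-TR4 in terms of the inverse suspension Omega: they say that the
   opposite category, with suspension Omega and the triangles C -> B -> A -> Omega C,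
   is triangulated in the usual sense. *)
Record triCategory := TriCategory {
  tri_cat :> loopCategory;
  dist : triangle tri_cat -> Prop;
  dist_iso : forall (t t' : triangle tri_cat) u v w, triMor t t' u v w ->
    isIso u -> isIso v -> isIso w -> dist t -> dist t';
  dist_id : forall a z : tri_cat, idm z = 0 ->
    dist (Triangle (0 : mor (Om a) z) 0 (idm a));
  dist_fibre : forall (b c : tri_cat) (g : mor b c),
    exists (a : tri_cat) (d : mor (Om c) a) (f : mor a b), dist (Triangle d f g);
  dist_rot : forall (a b c : tri_cat) (d : mor (Om c) a) (f : mor a b) (g : mor b c),
    dist (Triangle d f g) <-> dist (Triangle (- Omf g) d f);
  dist_fill : forall (t t' : triangle tri_cat)
      (v : mor (tB t) (tB t')) (w : mor (tC t) (tC t')),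
    dist t -> dist t' -> w \oc tg t = tg t' \oc v -> exists u, triMor t t' u v w;
  dist_oct : forall (x y z f1 f2 f3 : tri_cat) (g : mor x y) (h : mor y z)
      (d1 : mor (Om y) f1) (i1 : mor f1 x) (d2 : mor (Om z) f2) (i2 : mor f2 y)
      (d3 : mor (Om z) f3) (i3 : mor f3 x),
    dist (Triangle d1 i1 g) -> dist (Triangle d2 i2 h) -> dist (Triangle d3 i3 (h \oc g)) ->
    exists (u : mor f1 f3) (v : mor f3 f2),
      [/\ dist (Triangle (d1 \oc Omf i2) u v),
          i3 \oc u = i1, i2 \oc v = g \oc i3, v \oc d3 = d2 & u \oc d1 = d3 \oc Omf h]
}.

Record triFunctor (T T' : triCategory) := TriFunctor {
  tri_ob :> T -> T';
  tri_hom : forall a b, mor a b -> mor (tri_ob a) (tri_ob b);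
  tri_hom1 : forall a, tri_hom (idm a) = idm (tri_ob a);
  tri_hom_comp : forall a b c (g : mor b c) (f : mor a b),
    tri_hom (g \oc f) = tri_hom g \oc tri_hom f;
  tri_homD : forall a b (f g : mor a b), tri_hom (f + g) = tri_hom f + tri_hom g;
  tri_theta : forall a, mor (Om (tri_ob a)) (tri_ob (Om a));
  tri_theta_iso : forall a, isIso (tri_theta a);
  tri_theta_nat : forall a b (f : mor a b),
    tri_theta b \oc Omf (tri_hom f) = tri_hom (Omf f) \oc tri_theta a;
  tri_dist : forall (a b c : T) (d : mor (Om c) a) (f : mor a b) (g : mor b c),
    dist (Triangle d f g) ->
    dist (Triangle (tri_hom d \oc tri_theta c) (tri_hom f) (tri_hom g))
}.

Definition mapTriangle (T T' : triCategory) (G : triFunctor T T') (t : triangle T) :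
    triangle T' :=
  Triangle (tri_hom G (td t) \oc tri_theta G (tC t)) (tri_hom G (tf t)) (tri_hom G (tg t)).

Record homologyTheory (l : comPzRingType) (T : triCategory) := HomologyTheory {
  hob :> nuAlgType l -> T;
  hmap : forall A B : nuAlgType l, algHom A B -> mor (hob A) (hob B);
  hmap1 : forall A, hmap (idAlg A) = idm (hob A);
  hmap_comp : forall (A B C : nuAlgType l) (g : algHom B C) (f : algHom A B),
    hmap (compAlg g f) = hmap g \oc hmap f
}.

Record excisiveTheory (l : comPzRingType) (T : triCategory) := ExcisiveTheory {
  exc_theory :> homologyTheory l T;
  bdry : forall (A B C : nuAlgType l) (i : algHom A B) (p : algHom B C),
    isExtension i p -> mor (Om (exc_theory C)) (exc_theory A);
  bdry_nat : forall (A B C A' B' C' : nuAlgType l)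
      (i : algHom A B) (p : algHom B C) (i' : algHom A' B') (p' : algHom B' C')
      (x : isExtension i p) (x' : isExtension i' p')
      (a : algHom A A') (b : algHom B B') (c : algHom C C'),
    compAlg b i = compAlg i' a -> compAlg c p = compAlg p' b ->
    hmap exc_theory a \oc bdry x = bdry x' \oc Omf (hmap exc_theory c);
  bdry_dist : forall (A B C : nuAlgType l) (i : algHom A B) (p : algHom B C)
      (x : isExtension i p),
    dist (Triangle (bdry x) (hmap exc_theory i) (hmap exc_theory p))
}.

Section Theories.
Variables (l : comPzRingType) (T : triCategory).
Implicit Types X : excisiveTheory l T.

Definition homotopyInvariant X : Prop :=
  forall A : nuAlgType l, isIso (hmap X (polyConst A)).

Definition matrixStable (S : choiceType) X : Prop :=
  forall (A : nuAlgType l) (s : S), isIso (hmap X (matCorner A s)).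

Definition additiveTheory (I : choiceType) X : Prop :=
  forall (J : choiceType) (small : exists f : J -> I, injective f),
    (forall Z : J -> T, exists (S : T) (iota : forall j, mor (Z j) S), isDirectSum iota) /\
    (forall (A : J -> nuAlgType l) (S : T) (iota : forall j, mor (X (A j)) S),
      isDirectSum iota ->
      forall u : mor S (X (dsumAlg A)),
        (forall j, u \oc iota j = hmap X (dsumIn A j)) -> isIso u).

(* The boundary map of an extension, extended by 0 to all pairs of composable
   homomorphisms. *)
Definition boundary X (A B C : nuAlgType l) (i : algHom A B) (p : algHom B C) :
    mor (Om (X C)) (X A) :=
  if pselect (isExtension i p) is left x then bdry X x else 0.

Section Tensor.
Variables (R : nuAlgType l) (X : excisiveTheory l T).

Let tob (A : nuAlgType l) : T := X (tensAlg A R).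
Let tmor (A B : nuAlgType l) (f : algHom A B) : mor (tob A) (tob B) := hmap X (tensHom R f).
Lemma tensTheory1 A : tmor (idAlg A) = idm (tob A).
Proof. by rewrite /tmor tensHom_id hmap1. Qed.
Lemma tensTheory_comp A B C (g : algHom B C) (f : algHom A B) :
  tmor (compAlg g f) = tmor g \oc tmor f.
Proof. by rewrite /tmor tensHom_comp hmap_comp. Qed.
Definition tensHomology : homologyTheory l T := HomologyTheory tensTheory1 tensTheory_comp.

Let tbdry A B C (i : algHom A B) (p : algHom B C) (x : isExtension i p) :
  mor (Om (tensHomology C)) (tensHomology A) := bdry X (tensor_extension R x).
Lemma tensTheory_nat A B C A' B' C' (i : algHom A B) (p : algHom B C)
    (i' : algHom A' B') (p' : algHom B' C') (x : isExtension i p) (x' : isExtension i' p')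
    (a : algHom A A') (b : algHom B B') (c : algHom C C') :
  compAlg b i = compAlg i' a -> compAlg c p = compAlg p' b ->
  hmap tensHomology a \oc tbdry x = tbdry x' \oc Omf (hmap tensHomology c).
Proof.
move=> bi cp; apply: (@bdry_nat _ _ X _ _ _ _ _ _ _ _ _ _ _ _
  (tensHom R a) (tensHom R b) (tensHom R c)).
- by rewrite -2!tensHom_comp bi.
- by rewrite -2!tensHom_comp cp.
Qed.
Lemma tensTheory_dist A B C (i : algHom A B) (p : algHom B C) (x : isExtension i p) :
  dist (Triangle (tbdry x) (hmap tensHomology i) (hmap tensHomology p)).
Proof. exact: bdry_dist. Qed.
Definition tensTheory : excisiveTheory l T := ExcisiveTheory tensTheory_nat tensTheory_dist.
End Tensor.
End Theories.

(* G is a morphism from X to Y: the functors G X and Y are equal (not merely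
   isomorphic), compatibly with the boundary maps. *)
Record theoryMorphism (l : comPzRingType) (T T' : triCategory)
    (X : excisiveTheory l T) (Y : excisiveTheory l T') (G : triFunctor T T') : Prop :=
  TheoryMorphism {
    mor_ob : forall A, G (X A) = Y A;
    mor_hom : forall (A B : nuAlgType l) (f : algHom A B),
      eqhom (mor_ob B) \oc tri_hom G (hmap X f) = hmap Y f \oc eqhom (mor_ob A);
    mor_bdry : forall (A B C : nuAlgType l) (i : algHom A B) (p : algHom B C)
        (x : isExtension i p),
      eqhom (mor_ob A) \oc (tri_hom G (bdry X x) \oc tri_theta G (X C)) =
      bdry Y x \oc Omf (eqhom (mor_ob C))
  }.

Definition universalTheory (l : comPzRingType) (S : choiceType) (kk : triCategory)
    (j : excisiveTheory l kk) : Prop :=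
  [/\ homotopyInvariant j, matrixStable S j &
      forall (T : triCategory) (X : excisiveTheory l T),
        homotopyInvariant X -> matrixStable S X ->
        exists! G : triFunctor kk T, theoryMorphism j X G].

(* The triangle of 0 -> K(E) -> C(E) -> L(E) -> 0, transported along j(q) and j(phi) *)
Definition graphTriangle (l : comPzRingType) (E : graph) (kk : triCategory)
    (j : excisiveTheory l kk) : triangle kk :=
  Triangle
    (invm (hmap j (qHom l E)) \oc boundary j (ckInc l E) (leavittProj l E))
    (invm (hmap j (phiHom l E)) \oc hmap j (ckInc l E) \oc hmap j (qHom l E))
    (hmap j (leavittProj l E) \oc hmap j (phiHom l E)).

(* r |-> chi_i (x) r *)
Lemma chi_idem (l : comPzRingType) (I : choiceType) (i : I) : chi l i ** chi l i = chi l i.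
Proof. by rewrite [LHS]dinjM_id; congr dinj; exact: mulr1. Qed.
Definition chiTens (l : comPzRingType) (R : nuAlgType l) (I : choiceType) (i : I) :
    algHom R (tensAlg (funAlg l I) R) := tensIdem R (chi_idem l i).

(* For F : kk -> kk induced by tensoring with R and G : kk -> T induced by X, the
   identity G(F(j(A))) = X(A (x) R). *)
Definition inducedId (l : comPzRingType) (kk T : triCategory) (j : excisiveTheory l kk)
    (X : excisiveTheory l T) (R : nuAlgType l) (F : triFunctor kk kk) (G : triFunctor kk T)
    (hF : theoryMorphism j (tensTheory R j) F) (hG : theoryMorphism j X G) (A : nuAlgType l) :
    mor (G (F (j A))) (X (tensAlg A R)) :=
  eqhom (mor_ob hG (tensAlg A R)) \oc tri_hom G (eqhom (mor_ob hF A)).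

(* Main.v *)
(* For every excisive, homotopy invariant and E-stable theory Y, the maps Y(q) and Y(phi)
   are isomorphisms.  The ideal K(E) is the direct sum over the regular vertices v of the
   finite matrices indexed by the paths ending in v, since the elements a q_v b^* are matrix
   units, which the Fock representation shows to be independent; matricial stability then
   handles q.  For phi one uses the quasi-homomorphism from C(E) to finite matrices given by
   the Fock representation and its restriction to paths of positive length: it is the
   corner embedding after composition with phi, and a rotation homotopy shows that it also
   inverts phi on the other side.  Every index set that occurs is made of words in E^0 and
   E^1, so it embeds in the stabilizing set.  The extension of L(E) by K(E) splits linearly
   through the normal form obtained by choosing an edge e_v out of each regular vertex v and
   eliminating e_v e_v^*.  Finally v is the orthogonal sum of q_v and the idempotents e e^*
   with s(e) = v, and e e^* is equivalent to r(e), which identifies the column of f at v with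
   that of I - A^t. *)
From HB Require Import structures.
From mathcomp Require Import all_boot all_order all_algebra.
From mathcomp Require Import finmap.
From mathcomp Require Import boolp classical_sets functions cardinality fsbigop.
Require Import Defs.
Set Implicit Arguments.
Unset Strict Implicit.
Unset Printing Implicit Defensive.
Import GRing.Theory.
Local Open Scope classical_set_scope.
Local Open Scope ring_scope.

(** * Triangulated categories *)

(** Algebras have no units and extensions split only linearly, and this shapes the tools. A
    quasi-homomorphism is a pair of homomorphisms into a semidirect product of C and N that agree
    modulo N: that extension splits by a homomorphism, so Y(N) is the kernel of the map induced by
    the projection, and the difference of the pair factors through it. Rotations cannot conjugate by
    invertible matrices over a unital algebra; a column and a row of polynomials in t with product 1
    replace them, acting as operators. C(E) is given by generators and relations, so independence
    and normal forms become visible only on modules where the relations are checked by hand: partial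
    injections of a set for the Fock representations, rewriting operators for the splitting.
    Invertibility of q comes from two-out-of-six, which spares the construction of an inverse. The
    final triangle arises by transport, so only its matrix has to be computed; this is done after
    the isomorphism X(phi (x) R), where both sides are classes of idempotents of C(E). *)

Section AddCat.
Variable T : addCategory.
Implicit Types a b c d : T.

Lemma comp0m a b c (f : mor a b) : (0 : mor b c) \oc f = 0.
Proof. by apply: (addIr (0 \oc f)); rewrite -compDl !add0r. Qed.
Lemma compm0 a b c (g : mor b c) : g \oc (0 : mor a b) = 0.
Proof. by apply: (addIr (g \oc 0)); rewrite -compDr !add0r. Qed.
Lemma compNm a b c (g : mor b c) (f : mor a b) : (- g) \oc f = - (g \oc f).
Proof. by apply: (addIr (g \oc f)); rewrite -compDl !addNr comp0m. Qed.
Lemma compmN a b c (g : mor b c) (f : mor a b) : g \oc (- f) = - (g \oc f).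
Proof. by apply: (addIr (g \oc f)); rewrite -compDr !addNr compm0. Qed.
Lemma compmB a b c (g : mor b c) (f f' : mor a b) : g \oc (f - f') = g \oc f - g \oc f'.
Proof. by rewrite compDr compmN. Qed.
Lemma comp_sumr a b c (g : mor b c) (I : Type) (r : seq I) (f : I -> mor a b) :
  g \oc (\sum_(i <- r) f i) = \sum_(i <- r) g \oc f i.
Proof. by elim: r => [|i r IH]; rewrite ?big_nil ?compm0 // !big_cons compDr IH. Qed.

Lemma iso_idm a : isIso (idm a).
Proof. by exists (idm a); split; rewrite comp1m. Qed.
Lemma iso_eqhom a b (e : a = b) : isIso (eqhom e).
Proof. by case: _ / e; exact: iso_idm. Qed.
Lemma iso_comp a b c (g : mor b c) (f : mor a b) : isIso g -> isIso f -> isIso (g \oc f).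
Proof.
move=> [g' [g'g gg']] [f' [f'f ff']]; exists (f' \oc g'); split.
  by rewrite compA -(compA f') g'g compm1.
by rewrite compA -(compA g) ff' compm1.
Qed.
Lemma iso_invm a b (f : mor a b) : isIso f -> isIso (invm f).
Proof. by move=> /invP[? ?]; exists f. Qed.
Lemma invmK a b c (f : mor a b) (g : mor c a) : isIso f -> invm f \oc (f \oc g) = g.
Proof. by move=> /invP[ff _]; rewrite compA ff comp1m. Qed.
Lemma invmKV a b c (f : mor a b) (g : mor c b) : isIso f -> f \oc (invm f \oc g) = g.
Proof. by move=> /invP[_ ff]; rewrite compA ff comp1m. Qed.
Lemma iso_monic a b c (f : mor b c) (g h : mor a b) : isIso f -> f \oc g = f \oc h -> g = h.
Proof. by move=> fi e; rewrite -(invmK g fi) e invmK. Qed.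
Lemma iso_epic a b c (f : mor a b) (g h : mor b c) : isIso f -> g \oc f = h \oc f -> g = h.
Proof. by move=> [f' [_ ff]] e; rewrite -(compm1 g) -ff compA e -compA ff compm1. Qed.
Lemma iso_cancell a b c (g : mor b c) (f : mor a b) : isIso g -> isIso (g \oc f) -> isIso f.
Proof. by move=> gi gf; rewrite -(invmK f gi); apply: iso_comp => //; exact: iso_invm. Qed.
Lemma iso_cancelr a b c (g : mor b c) (f : mor a b) : isIso f -> isIso (g \oc f) -> isIso g.
Proof.
move=> [f1 [f1f ff1]] gf; rewrite -(compm1 g) -ff1 compA; apply: iso_comp => //.
by exists f.
Qed.
Lemma iso_split a b (f : mor a b) (g : mor b a) (h : mor b a) :
  g \oc f = idm a -> f \oc h = idm b -> isIso f.
Proof.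
move=> gf fh; exists g; split=> //.
by rewrite -(compm1 g) -fh (compA g) gf comp1m.
Qed.
(** The middle map g gets a right inverse from [g \oc f] and a left inverse from [h \oc g], so it is
    invertible and f follows by cancellation. *)
Lemma iso_2of6 a b c d (f : mor a b) (g : mor b c) (h : mor c d) :
  isIso (g \oc f) -> isIso (h \oc g) -> isIso f.
Proof.
move=> gf hg; have gi : isIso g.
  have [gf' [_ e]] := gf; have [hg' [e' _]] := hg.
  apply: (@iso_split _ _ g (hg' \oc h) (f \oc gf')); first by rewrite -compA.
  by rewrite compA.
exact: iso_cancell gf.
Qed.
End AddCat.

Section TriCat.
Variable T : triCategory.
Implicit Types a b c : T.

Lemma Omf0 a b : Omf (0 : mor a b) = 0.
Proof. by apply: (addIr (Omf 0)); rewrite -OmfD !add0r. Qed.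

(** The pair of g and the identity of c extends to a map into the trivial triangle z -> c -> c,
    through which [g \oc f] factors over the zero object z. *)
Lemma dist_comp0 a b c (d : mor (Om c) a) (f : mor a b) (g : mor b c) :
  dist (Triangle d f g) -> g \oc f = 0.
Proof.
have [z z0] := zero_ob T => D.
have [u [_ e _]] := @dist_fill T (Triangle d f g) (Triangle 0 0 (idm c)) g (idm c)
  D (dist_id c z0) erefl.
by rewrite [LHS]e comp0m.
Qed.

(** The trivial triangle w -> w -> z maps to the given one by h; the component that [dist_fill]
    supplies is the factorization. *)
Lemma dist_exact a b c w (d : mor (Om c) a) (f : mor a b) (g : mor b c) (h : mor w b) :
  dist (Triangle d f g) -> g \oc h = 0 -> exists k, h = f \oc k.
Proof.
have [z z0] := zero_ob T => D gh.
have Oz0 : idm (Om z) = 0 :> mor (Om z) (Om z) by rewrite -Omf1 z0 Omf0.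
have D' : dist (Triangle (0 : mor (Om z) w) (idm w) (0 : mor w z)).
  by apply/dist_rot; rewrite Omf0 oppr0; exact: dist_id.
have [|k [_ e _]] := @dist_fill T _ _ (h : mor (tB (Triangle 0 (idm w) 0)) (tB (Triangle d f g)))
  (0 : mor z c) D' D.
  by rewrite /= gh comp0m.
by exists k; rewrite -e /= compm1.
Qed.

(** A section of g kills d, since d composed with [Omf g] vanishes in the rotated triangle; by
    exactness k - k' factors through d. *)
Lemma dist_split_monic a b c w (d : mor (Om c) a) (f : mor a b) (g : mor b c) (s : mor c b)
    (k k' : mor w a) :
  dist (Triangle d f g) -> g \oc s = idm c -> f \oc k = f \oc k' -> k = k'.
Proof.
move=> D gs e; have D1 := (dist_rot d f g).1 D.
have d0 : d = 0.
  have := dist_comp0 ((dist_rot _ _ _).1 D1); rewrite compmN => /eqP.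
  rewrite oppr_eq0 => /eqP dg.
  by rewrite -(compm1 d) -Omf1 -gs Omf_comp compA dg comp0m.
have [|m] := dist_exact (h := k - k') D1; first by rewrite compmB e subrr.
by rewrite d0 comp0m => /eqP; rewrite subr_eq0 => /eqP.
Qed.
End TriCat.

Section Functors.
Variables (T T' : triCategory) (G : triFunctor T T').

Lemma tri_hom_iso (a b : T) (f : mor a b) : isIso f -> isIso (tri_hom G f).
Proof.
by move=> [g [gf fg]]; exists (tri_hom G g); split; rewrite -tri_hom_comp ?gf ?fg tri_hom1.
Qed.
End Functors.

(** * Semidirect products and excision *)

Section Semidirect.
Variables (l : comPzRingType) (C N : nuAlgType l).

(** A homomorphism from C to the multiplier algebra of N, spelled out as left and right operators.
    [baLR] is a separate law because N may be degenerate; [baC_mul] is the balance law of a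
    multiplier. *)
Record biaction := Biaction {
  baL : C -> N -> N;
  baR : C -> N -> N;
  baL_lin : forall n, linear (baL^~ n);
  baL_linr : forall c, linear (baL c);
  baR_lin : forall n, linear (baR^~ n);
  baR_linr : forall c, linear (baR c);
  baLM : forall c c' n, baL (c ** c') n = baL c (baL c' n);
  baRM : forall c c' n, baR (c ** c') n = baR c' (baR c n);
  baLR : forall c c' n, baL c (baR c' n) = baR c' (baL c n);
  baL_mul : forall c n m, baL c (n ** m) = baL c n ** m;
  baR_mul : forall c n m, baR c (n ** m) = n ** baR c m;
  baC_mul : forall c n m, n ** baL c m = baR c n ** m
}.

(** The phantom argument keeps the types apart: each biaction puts its own product on the same
    module. *)
Definition sdcarrier of biaction : Type := (C * N)%type.

Variable a : biaction.
Definition sdprod := sdcarrier a.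
HB.instance Definition _ := GRing.Lmodule.on sdprod.
Implicit Types x y z : sdprod.

Let L0 c : baL a c 0 = 0.
Proof. by have := baL_linr a c (-1) 0 0; rewrite scaler0 addr0 scaleN1r addNr. Qed.
Let L0l n : baL a 0 n = 0.
Proof. by have := baL_lin a n (-1) 0 0; rewrite scaler0 addr0 scaleN1r addNr. Qed.
Let R0 c : baR a c 0 = 0.
Proof. by have := baR_linr a c (-1) 0 0; rewrite scaler0 addr0 scaleN1r addNr. Qed.
Let R0l n : baR a 0 n = 0.
Proof. by have := baR_lin a n (-1) 0 0; rewrite scaler0 addr0 scaleN1r addNr. Qed.
Let LD c n n' : baL a c (n + n') = baL a c n + baL a c n'.
Proof. by have := baL_linr a c 1 n n'; rewrite !scale1r. Qed.
Let LDl c c' n : baL a (c + c') n = baL a c n + baL a c' n.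
Proof. by have := baL_lin a n 1 c c'; rewrite !scale1r. Qed.
Let RD c n n' : baR a c (n + n') = baR a c n + baR a c n'.
Proof. by have := baR_linr a c 1 n n'; rewrite !scale1r. Qed.
Let RDl c c' n : baR a (c + c') n = baR a c n + baR a c' n.
Proof. by have := baR_lin a n 1 c c'; rewrite !scale1r. Qed.
Let LZ k c n : baL a c (k *: n) = k *: baL a c n.
Proof. by have := baL_linr a c k n 0; rewrite L0 !addr0. Qed.
Let LZl k c n : baL a (k *: c) n = k *: baL a c n.
Proof. by have := baL_lin a n k c 0; rewrite L0l !addr0. Qed.
Let RZ k c n : baR a c (k *: n) = k *: baR a c n.
Proof. by have := baR_linr a c k n 0; rewrite R0 !addr0. Qed.
Let RZl k c n : baR a (k *: c) n = k *: baR a c n.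
Proof. by have := baR_lin a n k c 0; rewrite R0l !addr0. Qed.

Definition sdM x y : sdprod :=
  (x.1 ** y.1, baL a x.1 y.2 + baR a y.1 x.2 + x.2 ** y.2).

Lemma sdMA : associative sdM.
Proof.
case=> [c n] [c' n'] [c2 n2]; rewrite /sdM /= amulA; congr (_, _).
rewrite !(LD, RD, amulDl, amulDr) baLM baRM baLR -!baL_mul -!baR_mul baC_mul amulA.
rewrite -!addrA; congr (_ + (_ + _)).
rewrite [LHS]addrCA; congr (_ + _); rewrite [RHS]addrCA; congr (_ + _).
exact: addrCA.
Qed.
Lemma sdMDl : left_distributive sdM +%R.
Proof.
move=> [c n] [c' n'] [d m]; rewrite /sdM /= !(LDl, RD, amulDl); congr (_, _).
by rewrite [RHS]addrACA; congr (_ + _); exact: addrACA.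
Qed.
Lemma sdMDr : right_distributive sdM +%R.
Proof.
move=> [d m] [c n] [c' n']; rewrite /sdM /= !(RDl, LD, amulDr); congr (_, _).
by rewrite [RHS]addrACA; congr (_ + _); exact: addrACA.
Qed.
Lemma sdMZl (k : l) x y : sdM (k *: x) y = k *: sdM x y.
Proof. by case: x y => [c n] [c' n']; rewrite /sdM /= !(LZl, RZ, amulZl) -!scalerDr. Qed.
Lemma sdMZr (k : l) x y : sdM x (k *: y) = k *: sdM x y.
Proof. by case: x y => [c n] [c' n']; rewrite /sdM /= !(LZ, RZl, amulZr) -!scalerDr. Qed.
HB.instance Definition _ := isNUAlgebra.Build l sdprod sdMA sdMDl sdMDr sdMZl sdMZr.

Lemma sd_mulE x y :
  x ** y = (x.1 ** y.1, baL a x.1 y.2 + baR a y.1 x.2 + x.2 ** y.2) :> sdprod.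
Proof. by []. Qed.

Lemma sdInL : linear (fun n : N => (0, n) : sdprod).
Proof. by move=> k x y; congr (_, _) => /=; rewrite ?scaler0 ?addr0. Qed.
Lemma sdInM : {morph (fun n : N => (0, n) : sdprod) : x y / x ** y}.
Proof. by move=> x y; rewrite sd_mulE /= amul0l L0l R0l !add0r. Qed.
Definition sdIn : algHom N sdprod := @AlgHom l N sdprod _ sdInL sdInM.
Definition sdProj : algHom sdprod C :=
  @AlgHom l sdprod C (fun x => x.1) (fun _ _ _ => erefl) (fun _ _ => erefl).
Lemma sdSecL : linear (fun c : C => (c, 0) : sdprod).
Proof. by move=> k x y; congr (_, _) => /=; rewrite ?scaler0 ?addr0. Qed.
Lemma sdSecM : {morph (fun c : C => (c, 0) : sdprod) : x y / x ** y}.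
Proof. by move=> x y; rewrite sd_mulE /= amul0l L0 R0 !addr0. Qed.
Definition sdSec : algHom C sdprod := @AlgHom l C sdprod _ sdSecL sdSecM.

Lemma sd_extension : isExtension sdIn sdProj.
Proof.
split=> [n n' [] //|[c n]|].
  split=> /= [->|[n' []//]]; by exists n.
by exists sdSec.
Qed.
End Semidirect.

Section ZeroHom.
Variable l : comPzRingType.
Implicit Types A B C N : nuAlgType l.

Lemma zero_linear (V W : lmodType l) : linear (fun _ : V => 0 : W).
Proof. by move=> k x y; rewrite scaler0 addr0. Qed.
Lemma zeroAlgM A B : {morph (fun _ : A => 0 : B) : x y / x ** y}.
Proof. by move=> x y; rewrite amul0l. Qed.
Definition zeroAlg A B : algHom A B := AlgHom (@zero_linear A B) (@zeroAlgM A B).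

Lemma zero_mulC N (n m : N) : n ** 0 = 0 ** m.
Proof. by rewrite amul0l amul0r. Qed.
Definition trivial_biaction C N : biaction C N :=
  @Biaction l C N (fun _ _ => 0) (fun _ _ => 0)
    (fun=> @zero_linear C N) (fun=> @zero_linear N N)
    (fun=> @zero_linear C N) (fun=> @zero_linear N N)
    (fun _ _ _ => erefl) (fun _ _ _ => erefl) (fun _ _ _ => erefl)
    (fun _ _ m => esym (amul0l m)) (fun _ n _ => esym (amul0r n)) (fun _ => @zero_mulC N).

Lemma trivial_mulE C N (x y : sdprod (trivial_biaction C N)) :
  x ** y = (x.1 ** y.1, x.2 ** y.2) :> sdprod _.
Proof. by rewrite sd_mulE /= !add0r. Qed.
End ZeroHom.

Section Excision.
Variables (l : comPzRingType) (T : triCategory) (Y : excisiveTheory l T).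
Implicit Types A B C N : nuAlgType l.

(** A zero map factors through the composite of the inclusion and the projection of a split
    extension, which is zero in a distinguished triangle. *)
Lemma hmap_zero A B : hmap Y (zeroAlg A B) = 0.
Proof.
pose b := trivial_biaction B B.
have e : compAlg (sdProj b) (sdIn b) = zeroAlg B B by exact: algHomP.
have -> : zeroAlg A B = compAlg (zeroAlg B B) (zeroAlg A B) by exact: algHomP.
by rewrite hmap_comp -e hmap_comp (dist_comp0 (bdry_dist Y (sd_extension b))) comp0m.
Qed.

(** The section [sdSec] is a homomorphism, not just a linear map, so Y applies to it and the
    triangle splits. Together with [sdIn_factor] this makes Y(N) the kernel of
    [hmap Y (sdProj b)]. *)
Lemma sdIn_monic C N (b : biaction C N) (W : T) (k k' : mor W (Y N)) :
  hmap Y (sdIn b) \oc k = hmap Y (sdIn b) \oc k' -> k = k'.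
Proof.
apply: (dist_split_monic (s := hmap Y (sdSec b)) (bdry_dist Y (sd_extension b))).
by rewrite -hmap_comp -hmap1; congr hmap; exact: algHomP.
Qed.

Lemma sdIn_factor C N (b : biaction C N) (W : T) (h : mor W (Y (sdprod b))) :
  hmap Y (sdProj b) \oc h = 0 -> exists k, h = hmap Y (sdIn b) \oc k.
Proof. exact: (dist_exact (bdry_dist Y (sd_extension b))). Qed.

Section Orthogonal.
Variables (A B : nuAlgType l) (f g : algHom A B).
Hypotheses (fg : forall x y, f x ** g y = 0) (gf : forall x y, g x ** f y = 0).

Lemma sumAlgL : linear (fun x => f x + g x).
Proof. by move=> k x y; rewrite !linearP scalerDr addrACA. Qed.
Lemma sumAlgM : {morph (fun x => f x + g x) : x y / x ** y}.
Proof. by move=> x y; rewrite amulDl !amulDr fg gf addr0 add0r !alg_funM. Qed.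
Definition sumAlg : algHom A B := AlgHom sumAlgL sumAlgM.

(** The sum is the diagonal of A followed by (x, y) |-> f x + g y, so it suffices that Y sends the
    diagonal to the sum of the two inclusions. *)
Lemma hmap_sum : hmap Y sumAlg = hmap Y f + hmap Y g.
Proof.
pose b := trivial_biaction A A.
pose d (x : A) : sdprod b := (x, x).
have dM : {morph d : x y / x ** y} by move=> x y; rewrite trivial_mulE.
pose D : algHom A (sdprod b) := @AlgHom _ A (sdprod b) d (fun _ _ _ => erefl) dM.
pose m (x : sdprod b) : B := f x.1 + g x.2.
have mL : linear m by move=> k x y; rewrite /m !linearP scalerDr addrACA.
have mM : {morph m : x y / x ** y}.
  by move=> x y; rewrite /m trivial_mulE /= amulDl !amulDr fg gf addr0 add0r !alg_funM.
pose M : algHom (sdprod b) B := AlgHom mL mM.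
have qM : {morph (fun x : sdprod b => x.2) : x y / x ** y}.
  by move=> x y; rewrite trivial_mulE.
pose q : algHom (sdprod b) A := @AlgHom _ (sdprod b) A _ (fun _ _ _ => erefl) qM.
(* The first projection kills this difference, so it comes from some k into the second summand; the
   second projection then shows k = 0. *)
have [k e] : exists k, hmap Y D - hmap Y (sdSec b) - hmap Y (sdIn b) = hmap Y (sdIn b) \oc k.
  apply: sdIn_factor; rewrite !compmB -!hmap_comp.
  have -> : compAlg (sdProj b) D = idAlg A by exact: algHomP.
  have -> : compAlg (sdProj b) (sdSec b) = idAlg A by exact: algHomP.
  have -> : compAlg (sdProj b) (sdIn b) = zeroAlg A A by exact: algHomP.
  by rewrite hmap_zero subrr subr0.
have k0 : k = 0.
  have := congr1 (comp (hmap Y q)) e; rewrite !compmB compA -!hmap_comp.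
  have -> : compAlg q D = idAlg A by exact: algHomP.
  have -> : compAlg q (sdSec b) = zeroAlg A A by exact: algHomP.
  have -> : compAlg q (sdIn b) = idAlg A by exact: algHomP.
  by rewrite hmap_zero hmap1 subr0 subrr comp1m.
move: e; rewrite k0 compm0 -addrA -opprD => /eqP; rewrite subr_eq0 => /eqP e.
have -> : sumAlg = compAlg M D by exact: algHomP.
rewrite hmap_comp e compDr -!hmap_comp; congr (_ + _); congr hmap; apply: algHomP => x /=.
  by rewrite /m /= linear0 addr0.
by rewrite /m /= linear0 add0r.
Qed.
End Orthogonal.
End Excision.

(** * Semigroup algebras, matrices and polynomials *)

Section LinearMaps.
Variables (l : comPzRingType) (V W : lmodType l) (f : V -> W).
Hypothesis fL : linear f.
Lemma lin0 : f 0 = 0.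
Proof. by have := fL (-1) 0 0; rewrite scaler0 addr0 scaleN1r addNr. Qed.
Lemma linD x y : f (x + y) = f x + f y.
Proof. by have := fL 1 x y; rewrite !scale1r. Qed.
Lemma linZ c x : f (c *: x) = c *: f x.
Proof. by have := fL c x 0; rewrite lin0 !addr0. Qed.
Lemma linN x : f (- x) = - f x.
Proof. by rewrite -scaleN1r linZ scaleN1r. Qed.
Lemma linB x y : f (x - y) = f x - f y.
Proof. by rewrite linD linN. Qed.
Lemma lin_sum (I : Type) (r : seq I) (F : I -> V) : f (\sum_(i <- r) F i) = \sum_(i <- r) f (F i).
Proof. by elim: r => [|i r IH]; rewrite ?big_nil ?lin0 // !big_cons linD IH. Qed.
End LinearMaps.

Lemma linear_comp (l : comPzRingType) (U V W : lmodType l) (g : V -> W) (f : U -> V) :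
  linear g -> linear f -> linear (fun x => g (f x)).
Proof. by move=> gL fL c x y; rewrite fL gL. Qed.
Lemma linear_add (l : comPzRingType) (V W : lmodType l) (f g : V -> W) :
  linear f -> linear g -> linear (fun x => f x + g x).
Proof. by move=> fL gL c x y; rewrite fL gL scalerDr addrACA. Qed.

Lemma dsum_ext (l : comPzRingType) (J : choiceType) (M : J -> lmodType l) (W : lmodType l)
    (f g : dsum M -> W) : linear f -> linear g ->
  (forall j a, f (dinj j a) = g (dinj j a)) -> f =1 g.
Proof.
move=> fL gL fg; apply: dsum_ind => [|x y IH IH'|//]; first by rewrite !lin0.
by rewrite !linD // IH IH'.
Qed.

Section SemigroupAlgebras.
Variables (l : comPzRingType) (P : semigroup0) (A : nuAlgType l).

Definition sgd (i : P) (a : A) : sgAlg P A := @dinj l P (fun=> A : lmodType l) i a.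

Lemma sgd_linear i : linear (sgd i).
Proof. exact: dinj_linear. Qed.
Lemma sgdM i j a b :
  sgd i a ** sgd j b = if sg_op i j is Some k then sgd k (a ** b) else 0.
Proof. exact: sgM_inj. Qed.
Lemma sg_ind (Q : sgAlg P A -> Prop) : Q 0 -> (forall f g, Q f -> Q g -> Q (f + g)) ->
  (forall i a, Q (sgd i a)) -> forall f, Q f.
Proof. exact: dsum_ind. Qed.
Lemma sg_ext (W : lmodType l) (f g : sgAlg P A -> W) : linear f -> linear g ->
  (forall i a, f (sgd i a) = g (sgd i a)) -> f =1 g.
Proof. exact: dsum_ext. Qed.

Section Lift.
Variables (B : nuAlgType l) (m : P -> A -> B).
Hypothesis mL : forall i, linear (m i).
Hypothesis mM : forall i j a b,
  m i a ** m j b = if sg_op i j is Some k then m k (a ** b) else 0.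

Let d : sgAlg P A -> B := dlift m.
Let dL : linear d := dlift_linear mL.
Let dE i a : d (sgd i a) = m i a := dlift_inj mL a.
Lemma sgLiftM : {morph d : x y / x ** y}.
Proof.
move=> x y; move: x; apply: sg_ind => [|x x' IH IH'|i a].
- by rewrite amul0l !(lin0 dL) amul0l.
- by rewrite amulDl !(linD dL) IH IH' amulDl.
move: y; apply: sg_ind => [|y y' IH IH'|j b].
- by rewrite amul0r !(lin0 dL) amul0r.
- by rewrite amulDr !(linD dL) IH IH' amulDr.
rewrite sgdM !dE mM; case: (sg_op i j) => [k|]; first exact: dE.
exact: lin0.
Qed.
Definition sgLift : algHom (sgAlg P A) B := @AlgHom l (sgAlg P A) B d dL sgLiftM.
Lemma sgLiftE i a : sgLift (sgd i a) = m i a. Proof. exact: dE. Qed.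
End Lift.
End SemigroupAlgebras.


Section Matrices.
Variables (l : comPzRingType) (S : choiceType).
Implicit Types A B : nuAlgType l.

Definition mE A (s t : S) (a : A) : matAlg A S := @sgd l (munits S) A (s, t) a.
Lemma mE_linear A s t : linear (@mE A s t).
Proof. exact: sgd_linear. Qed.
Lemma mE0 A s t : @mE A s t 0 = 0. Proof. exact: (lin0 (@mE_linear A s t)). Qed.
Lemma mEM A s t u v (a b : A) :
  mE s t a ** mE u v b = if t == u then mE s v (a ** b) else 0.
Proof. by rewrite [LHS]sgdM /= /munit_op /=; case: ifP. Qed.
Lemma mE_ext A (W : lmodType l) (f g : matAlg A S -> W) : linear f -> linear g ->
  (forall s t a, f (mE s t a) = g (mE s t a)) -> f =1 g.
Proof. by move=> fL gL fg; apply: sg_ext => // -[s t] a; exact: fg. Qed.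

Section MatMap.
Variables (A B : nuAlgType l) (f : algHom A B).
Let m (p : munits S) (a : A) : matAlg B S := mE p.1 p.2 (f a).
Lemma matMap_subproof1 p : linear (m p).
Proof. by move=> c x y; rewrite /m (alg_funL f) mE_linear. Qed.
Lemma matMap_subproof2 p q a b :
  m p a ** m q b = if sg_op p q is Some r then m r (a ** b) else 0.
Proof. by rewrite /m mEM /= /munit_op; case: ifP => //= _; rewrite alg_funM. Qed.
Definition matMap : algHom (matAlg A S) (matAlg B S) :=
  sgLift matMap_subproof1 matMap_subproof2.
Lemma matMapE s t a : matMap (mE s t a) = mE s t (f a).
Proof. exact: (sgLiftE matMap_subproof1). Qed.
Lemma matMap_corner s : compAlg matMap (matCorner A s) = compAlg (matCorner B s) f.
Proof. by apply: algHomP => a; exact: matMapE. Qed.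
End MatMap.
End Matrices.

Section Polynomials.
Variables (l : comPzRingType) (B : nuAlgType l).
Implicit Types p q : polyAlg B.

Let m0 (n : powers) (b : B) : B := if n == 0%N then b else 0.
Lemma ev0_subproof1 n : linear (m0 n).
Proof. by rewrite /m0; case: eqP => // _; exact: zero_linear. Qed.
Lemma ev0_subproof2 i j a b :
  m0 i a ** m0 j b = if sg_op i j is Some k then m0 k (a ** b) else 0.
Proof.
rewrite /m0 /= addn_eq0.
by case: eqP => _ /=; case: eqP => _ //=; rewrite ?amul0l ?amul0r.
Qed.
Definition ev0 : algHom (polyAlg B) B := sgLift ev0_subproof1 ev0_subproof2.

Definition ev1 : algHom (polyAlg B) B :=
  @sgLift l powers B B (fun _ b => b) (fun _ _ _ _ => erefl) (fun _ _ _ _ => erefl).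

(** Multiplication by t. The variable itself is not a polynomial over a nonunital algebra, so t
    exists only as an operator commuting with both multiplications. *)
Definition shift p : polyAlg B := dlift (fun n b => @sgd l powers B n.+1 b) p.
Let sL n : linear (fun b => @sgd l powers B n.+1 b).
Proof. exact: sgd_linear. Qed.
Lemma shift_linear : linear shift.
Proof. exact: (dlift_linear sL). Qed.
Lemma shift_sgd n b : shift (@sgd l powers B n b) = @sgd l powers B n.+1 b.
Proof. exact: (dlift_inj sL b). Qed.
Lemma shiftMl p q : shift (p ** q) = shift p ** q.
Proof.
move: p; apply: sg_ext => [c x y|c x y|i a].
- by rewrite amulDl amulZl shift_linear.
- by rewrite shift_linear amulDl amulZl.
move: q; apply: sg_ext => [c x y|c x y|j b].
- by rewrite amulDr amulZr shift_linear.
- by rewrite amulDr amulZr.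
by rewrite shift_sgd [_ ** _]sgdM [RHS]sgdM /= shift_sgd.
Qed.
Lemma shiftMr p q : shift (p ** q) = p ** shift q.
Proof.
move: p; apply: sg_ext => [c x y|c x y|i a].
- by rewrite amulDl amulZl shift_linear.
- by rewrite amulDl amulZl.
move: q; apply: sg_ext => [c x y|c x y|j b].
- by rewrite amulDr amulZr shift_linear.
- by rewrite shift_linear amulDr amulZr.
by rewrite shift_sgd [_ ** _]sgdM [RHS]sgdM /= shift_sgd addnS.
Qed.
Lemma ev0_shift p : ev0 (shift p) = 0.
Proof.
move: p; apply: sg_ext => [||n b].
- exact: (linear_comp (alg_funL ev0) shift_linear).
- exact: zero_linear.
by rewrite shift_sgd [LHS](sgLiftE ev0_subproof1).
Qed.
Lemma ev1_shift p : ev1 (shift p) = ev1 p.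
Proof.
move: p; apply: sg_ext => [||n b].
- exact: (linear_comp (alg_funL ev1) shift_linear).
- exact: alg_funL.
by rewrite shift_sgd [LHS]sgLiftE [RHS]sgLiftE.
Qed.
Lemma ev0_const b : ev0 (polyConst B b) = b.
Proof. exact: (sgLiftE ev0_subproof1). Qed.
Lemma ev1_const b : ev1 (polyConst B b) = b.
Proof. exact: sgLiftE. Qed.
End Polynomials.

Section Homotopy.
Variables (l : comPzRingType) (T : triCategory) (Y : excisiveTheory l T).
Hypothesis Yh : homotopyInvariant Y.

(** Both evaluations are retractions of [polyConst], which Y inverts, so Y does not distinguish
    them. *)
Lemma hmap_homotopy (A B : nuAlgType l) (H : algHom A (polyAlg B)) :
  hmap Y (compAlg (ev0 B) H) = hmap Y (compAlg (ev1 B) H).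
Proof.
rewrite !hmap_comp; congr (_ \oc _); apply: (iso_epic (Yh B)).
by rewrite -!hmap_comp; congr hmap; apply: algHomP => b; rewrite [LHS]ev0_const [RHS]ev1_const.
Qed.
End Homotopy.

Lemma mul_sum4 (l : comPzRingType) (A : nuAlgType l) (p q u v p' q' u' v' : A) :
  (p + q + (u + v)) ** (p' + q' + (u' + v')) =
  ((p ** p' + p ** q' + (p ** u' + p ** v')) + (q ** p' + q ** q' + (q ** u' + q ** v'))) +
  ((u ** p' + u ** q' + (u ** u' + u ** v')) + (v ** p' + v ** q' + (v ** u' + v ** v'))).
Proof. by rewrite !amulDl !amulDr. Qed.

(* The column (1 - t^2, t) and the row (1 - t^2, 2t - t^3) have product 1 and
   interpolate between the two standard coordinate vectors; conjugating by them
   rotates the first diagonal corner of a 2 x 2 matrix into the second. *)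
Section Rotation.
Variables (l : comPzRingType) (B : nuAlgType l).
Local Notation D := (polyAlg B).
Local Notation t := (@shift l B).
Implicit Types (i j k : bool) (p q : D) (a b c : bool -> bool -> D).

Definition colv i p : D := if i then t p else p - t (t p).
Definition rowv i p : D := if i then t p + t p - t (t (t p)) else p - t (t p).

Lemma colv_linear i : linear (colv i).
Proof.
move=> k p q; rewrite /colv; case: i; first exact: shift_linear.
by rewrite !shift_linear scalerBr opprD addrACA.
Qed.
Lemma rowv_linear i : linear (rowv i).
Proof.
move=> k p q; rewrite /rowv; case: i; rewrite !shift_linear.
  by rewrite scalerBr scalerDr opprD (addrACA (k *: t p)) [LHS]addrACA.
by rewrite scalerBr opprD addrACA.
Qed.
Lemma colvMl i p q : colv i (p ** q) = colv i p ** q.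
Proof. by rewrite /colv; case: i; rewrite ?amulBl -!shiftMl. Qed.
Lemma colvMr i p q : colv i (p ** q) = p ** colv i q.
Proof. by rewrite /colv; case: i; rewrite ?amulBr -!shiftMr. Qed.
Lemma rowvMl i p q : rowv i (p ** q) = rowv i p ** q.
Proof. by rewrite /rowv; case: i; rewrite ?(amulBl, amulDl) -!shiftMl. Qed.
Lemma rowvMr i p q : rowv i (p ** q) = p ** rowv i q.
Proof. by rewrite /rowv; case: i; rewrite ?(amulBr, amulDr) -!shiftMr. Qed.
(** The entry 2t - t^3 is (1 - (1 - t^2)^2) / t, the value for which row times column is 1. *)
Lemma row_col p : rowv false (colv false p) + rowv true (colv true p) = p.
Proof.
have tB := linB (@shift_linear l B).
rewrite /rowv /colv /= !tB; move: (t (t p)) (t (t (t (t p)))) => u v.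
by rewrite -(addrA p (- u)) -opprD -(addrA u u) subrK.
Qed.
Lemma ev0_colv i p : ev0 B (colv i p) = if i then 0 else ev0 B p.
Proof. by rewrite /colv; case: i; rewrite ?(linB (alg_funL _)) ev0_shift ?subr0. Qed.
Lemma ev0_rowv i p : ev0 B (rowv i p) = if i then 0 else ev0 B p.
Proof.
rewrite /rowv; case: i; rewrite (linB (alg_funL _)) ?(linD (alg_funL _)) !ev0_shift ?subr0 //.
by rewrite addr0.
Qed.
Lemma ev1_colv i p : ev1 B (colv i p) = if i then ev1 B p else 0.
Proof. by rewrite /colv; case: i; rewrite ?(linB (alg_funL _)) !ev1_shift ?subrr. Qed.
Lemma ev1_rowv i p : ev1 B (rowv i p) = if i then ev1 B p else 0.
Proof.
rewrite /rowv; case: i; rewrite (linB (alg_funL _)) ?(linD (alg_funL _)) !ev1_shift ?subrr //.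
by rewrite addrK.
Qed.

Arguments colv : simpl never.
Arguments rowv : simpl never.

Definition rot a : D :=
  (colv false (rowv false (a false false)) + colv false (rowv true (a false true))) +
  (colv true (rowv false (a true false)) + colv true (rowv true (a true true))).

Let hom_sum4 (f : algHom D B) p q u v : f ((p + q) + (u + v)) = (f p + f q) + (f u + f v).
Proof. by rewrite !(linD (alg_funL f)). Qed.
Lemma ev0_rot a : ev0 B (rot a) = ev0 B (a false false).
Proof. by rewrite hom_sum4 !ev0_colv !ev0_rowv !addr0. Qed.
Lemma ev1_rot a : ev1 B (rot a) = ev1 B (a true true).
Proof. by rewrite hom_sum4 !ev1_colv !ev1_rowv !add0r. Qed.

(** The hypothesis says that [a i j] multiplies like a block at (i, j). The inner factors then add
    up to row times column, which is 1. *)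
Lemma rot_mul a b c :
  (forall i j k m, a i j ** b k m = if j == k then c i m else 0) -> rot a ** rot b = rot c.
Proof.
move=> ab.
have E i j k m : colv i (rowv j (a i j)) ** colv k (rowv m (b k m)) =
    if j == k then colv i (rowv j (colv j (rowv m (c i m)))) else 0.
  rewrite -colvMl -rowvMl -colvMr -rowvMr ab; case: eqP => [<-|_] //.
  by rewrite !(lin0 (@colv_linear _), lin0 (@rowv_linear _)).
have F i m : colv i (rowv false (colv false (rowv m (c i m)))) +
    colv i (rowv true (colv true (rowv m (c i m)))) = colv i (rowv m (c i m)).
  by rewrite -(linD (@colv_linear _)) row_col.
rewrite mul_sum4 !E !eqxx /= ?addr0 ?add0r /rot.
by congr (_ + _); rewrite [LHS]addrACA; congr (_ + _); exact: F.
Qed.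
End Rotation.

(** * Matricial stability *)

Section RotationLinear.
Variables (l : comPzRingType) (B : nuAlgType l).

Lemma rotP (c : l) (a b : bool -> bool -> polyAlg B) :
  rot (fun i j => c *: a i j + b i j) = c *: rot a + rot b.
Proof.
have L i j : linear (fun p : polyAlg B => colv i (rowv j p)).
  by apply: linear_comp; [exact: colv_linear|exact: rowv_linear].
rewrite /rot !L !scalerDr [RHS]addrACA.
by congr (_ + _); exact: addrACA.
Qed.
Lemma rot0 (a : bool -> bool -> polyAlg B) : (forall i j, a i j = 0) -> rot a = 0.
Proof.
move=> a0; rewrite /rot !a0.
by rewrite !(lin0 (@rowv_linear _ _ _)) !(lin0 (@colv_linear _ _ _)) !addr0.
Qed.
Lemma eq_rot (a b : bool -> bool -> polyAlg B) : (forall i j, a i j = b i j) -> rot a = rot b.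
Proof. by move=> ab; rewrite /rot !ab. Qed.
End RotationLinear.

(* For a row index p and a column index q, both different from s, the element
   [turn s p q b] interpolates between b at (p, q) and b at (s, s). *)
Section Turn.
Variables (l : comPzRingType) (B : nuAlgType l) (S : choiceType) (s : S).

Definition turn (p q : S) (b : B) : polyAlg (matAlg B S) :=
  rot (fun i j => polyConst _ (mE (if i then s else p) (if j then s else q) b)).

(** Only the inner index q has to avoid s: the two inner positions q and s must be told apart. *)
Lemma turnM p q r b c : q != s -> turn p q b ** turn q r c = turn p r (b ** c).
Proof.
move=> qs; apply: rot_mul => i j k m; rewrite -alg_funM mEM.
case: j k => [] [] /=; rewrite ?eqxx // ?(negbTE qs) ?[s == q]eq_sym ?(negbTE qs) //;
  exact: (lin0 (alg_funL (polyConst _))).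
Qed.
Lemma turnM0 p q q' r b c : b ** c = 0 -> turn p q b ** turn q' r c = 0.
Proof.
move=> bc; rewrite -(rot0 (a := fun _ _ : bool => 0 : polyAlg (matAlg B S))) //.
apply: rot_mul => i j k m; rewrite -alg_funM mEM bc mE0 !if_same.
exact: (lin0 (alg_funL (polyConst _))).
Qed.
Lemma ev0_turn p q b : ev0 _ (turn p q b) = mE p q b.
Proof. by rewrite ev0_rot ev0_const. Qed.
Lemma ev1_turn p q b : ev1 _ (turn p q b) = mE s s b.
Proof. by rewrite ev1_rot ev1_const. Qed.
End Turn.

Section Stability.
Variables (l : comPzRingType) (T : triCategory) (Y : excisiveTheory l T) (S : choiceType).
Hypotheses (Yh : homotopyInvariant Y) (Ys : matrixStable S Y).
Variables (s t : S) (st : s != t).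

Section Link.
Variables (A B : nuAlgType l) (Phi : bool -> bool -> A -> B).
Hypothesis PhiL : forall i j, linear (Phi i j).
Hypothesis PhiM : forall i j k x y, Phi i j x ** Phi j k y = Phi i k (x ** y).

Let ix (i : bool) := if i then t else s.
Let h (x : A) : polyAlg (matAlg B S) :=
  rot (fun i j => polyConst _ (mE (ix i) (ix j) (Phi i j x))).
Let hL : linear h.
Proof.
move=> c x y; rewrite /h -rotP; apply: eq_rot => i j.
by rewrite PhiL mE_linear (alg_funL (polyConst _)).
Qed.
Let hM : {morph h : x y / x ** y}.
Proof.
move=> x y; symmetry; apply: rot_mul => i j k m; rewrite -alg_funM mEM.
have -> : (ix j == ix k) = (j == k).
  by case: j k => [] [] /=; rewrite ?eqxx // ?[t == s]eq_sym (negbTE st).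
case: eqP => [<-|_]; first by rewrite PhiM.
exact: (lin0 (alg_funL (polyConst _))).
Qed.

(** The indices s and t keep the blocks [Phi i j] apart, although their images in B need not be
    orthogonal; the rotation then moves the corner at s to the corner at t. *)
Lemma hmap_link_corner (f g : algHom A B) : f =1 Phi false false -> g =1 Phi true true ->
  hmap Y (matCorner B s) \oc hmap Y f = hmap Y (matCorner B t) \oc hmap Y g.
Proof.
move=> fE gE; rewrite -!hmap_comp; have := hmap_homotopy Yh (AlgHom hL hM).
have -> : compAlg (ev0 (matAlg B S)) (AlgHom hL hM) = compAlg (matCorner B s) f.
  by apply: algHomP => x; rewrite [LHS]ev0_rot ev0_const -fE.
have -> // : compAlg (ev1 (matAlg B S)) (AlgHom hL hM) = compAlg (matCorner B t) g.
by apply: algHomP => x; rewrite [LHS]ev1_rot ev1_const -gE.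
Qed.
End Link.

Lemma hmap_corner_eq (B : nuAlgType l) : hmap Y (matCorner B s) = hmap Y (matCorner B t).
Proof.
have := @hmap_link_corner B B (fun _ _ x => x) (fun _ _ _ _ _ => erefl) (fun _ _ _ _ _ => erefl)
  (idAlg B) (idAlg B).
by rewrite hmap1 !compm1; apply.
Qed.

(* The maps [Phi i j] form a homomorphism from the 2 x 2 matrices over A. *)
Lemma hmap_link (A B : nuAlgType l) (Phi : bool -> bool -> A -> B) (f g : algHom A B) :
  (forall i j, linear (Phi i j)) ->
  (forall i j k x y, Phi i j x ** Phi j k y = Phi i k (x ** y)) ->
  f =1 Phi false false -> g =1 Phi true true -> hmap Y f = hmap Y g.
Proof.
move=> PhiL PhiM fE gE; apply: (iso_monic (Ys B s)).
by rewrite (hmap_link_corner PhiL PhiM fE gE) hmap_corner_eq.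
Qed.
End Stability.

(** * The universal property of the Cohn algebra *)

Section FreeAlgebra.
Variables (l : comPzRingType) (G : choiceType) (B : nuAlgType l) (g : G -> B).

Fixpoint wordEval (x : G) (w : seq G) : B := if w is y :: w' then g x ** wordEval y w' else g x.
Lemma wordEval_cat x w y w' : wordEval x (w ++ y :: w') = wordEval x w ** wordEval y w'.
Proof. by elim: w x => [|z w IH] x //=; rewrite IH amulA. Qed.

Let m (u : words G) (c : l^o) : B := (c : l) *: wordEval u.1 u.2.
Lemma freeLift_subproof1 u : linear (m u).
Proof. by move=> c x y; rewrite /m scalerDl scalerA. Qed.
Lemma freeLift_subproof2 u v (c d : l^o) :
  m u c ** m v d = if sg_op u v is Some w then m w (c ** d) else 0.
Proof. by rewrite /m /= amulZl amulZr scalerA wordEval_cat. Qed.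
Definition freeLift : algHom (freeAlg l G) B := sgLift freeLift_subproof1 freeLift_subproof2.
Lemma freeLift_gen x : freeLift (fgen l x) = g x.
Proof. by rewrite [LHS](sgLiftE freeLift_subproof1) /m scale1r. Qed.
End FreeAlgebra.

Lemma free_ind (l : comPzRingType) (G : choiceType) (Q : freeAlg l G -> Prop) :
  Q 0 -> (forall x y, Q x -> Q y -> Q (x + y)) -> (forall c x, Q x -> Q (c *: x)) ->
  (forall g, Q (fgen l g)) -> (forall g x, Q x -> Q (fgen l g ** x)) -> forall x, Q x.
Proof.
move=> Q0 QD QZ Qg QM; apply: sg_ind => // -[x w] c.
have -> : @sgd l (words G) l^o (x, w) c = (c : l) *: @sgd l (words G) l^o (x, w) (1 : l^o).
  rewrite -(linZ (@sgd_linear l (words G) l^o (x, w))); congr (sgd _ _).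
  by rewrite /GRing.scale /= mulr1.
apply: QZ; elim: w x => [|y w IH] x; first exact: Qg.
have -> : @sgd l (words G) l^o (x, y :: w) (1 : l^o) =
    fgen l x ** @sgd l (words G) l^o (y, w) (1 : l^o).
  by rewrite [RHS]sgdM /=; congr (@sgd l (words G) l^o _ _); exact: esym (mulr1 _).
exact: QM.
Qed.

Section CohnAlgebra.
Variables (l : comPzRingType) (E : graph).
Local Notation C := (cohn l E).
Local Notation V := (cV l).
Local Notation Ed := (cE l).
Local Notation St := (cS l).

Record cohnData (B : nuAlgType l) := CohnData {
  dV : vert E -> B;
  dE : edge E -> B;
  dS : edge E -> B;
  dVV : forall v w, dV v ** dV w = if v == w then dV v else 0;
  dVE : forall e, dV (src e) ** dE e = dE e;
  dEV : forall e, dE e ** dV (rng e) = dE e;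
  dVS : forall e, dV (rng e) ** dS e = dS e;
  dSV : forall e, dS e ** dV (src e) = dS e;
  dSE : forall e f, dS e ** dE f = if e == f then dV (rng e) else 0
}.

Section Lift.
Variables (B : nuAlgType l) (d : cohnData B).
Let g (x : pgen E) : B :=
  match x with inl (inl v) => dV d v | inl (inr e) => dE d e | inr e => dS d e end.
Let f := freeLift g.

Let K0 : f 0 = 0. Proof. exact: (lin0 (alg_funL f)). Qed.
Let KP (c : l) x y : f x = 0 -> f y = 0 -> f (c *: x + y) = 0.
Proof. by move=> fx fy; rewrite (alg_funL f) fx fy scaler0 addr0. Qed.
Let KMl a x : f x = 0 -> f (a ** x) = 0.
Proof. by move=> fx; rewrite alg_funM fx amul0r. Qed.
Let KMr a x : f x = 0 -> f (x ** a) = 0.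
Proof. by move=> fx; rewrite alg_funM fx amul0l. Qed.
Let kerI : ideal (freeAlg l (pgen E)) :=
  @Ideal l (freeAlg l (pgen E))
    (@Submodule l (freeAlg l (pgen E)) (fun x => f x = 0) K0 KP) KMl KMr.

Lemma cohnLift_subproof x : cohn_ideal l E x -> f x = 0.
Proof.
move/(_ kerI); apply => {}x [a [b [r ->]]]; change (f (a - b) = 0).
rewrite (linB (alg_funL f)) -[RHS](subrr (f a)); congr (_ - _).
case: a b / r => [v w|e|e|e|e|e e']; rewrite ?alg_funM.
- rewrite !freeLift_gen /= dVV; case: eqP => _; last exact: K0.
  exact: freeLift_gen.
- by rewrite !freeLift_gen /= dVE.
- by rewrite !freeLift_gen /= dEV.
- by rewrite !freeLift_gen /= dVS.
- by rewrite !freeLift_gen /= dSV.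
- rewrite !freeLift_gen /= dSE; case: eqP => _; last exact: K0.
  exact: freeLift_gen.
Qed.

Let h : C -> B := quotLift (f : {linear freeAlg l (pgen E) -> B}).
Let hL : linear h := quotLift_linear cohnLift_subproof.
Let hE x : h (quotProj (cohn_ideal l E) x) = f x := quotLift_pi cohnLift_subproof x.
Let hM : {morph h : x y / x ** y}.
Proof.
move=> x y; have [x' <-] := quotPi_surj x; have [y' <-] := quotPi_surj y.
by rewrite -[quotPi _ x']/(quotProj _ x') -[quotPi _ y']/(quotProj _ y') -alg_funM !hE alg_funM.
Qed.
Definition cohnLift : algHom C B := AlgHom hL hM.
Lemma cohnLiftV v : cohnLift (V v) = dV d v.
Proof. by rewrite [LHS]hE freeLift_gen. Qed.
Lemma cohnLiftE e : cohnLift (Ed e) = dE d e.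
Proof. by rewrite [LHS]hE freeLift_gen. Qed.
Lemma cohnLiftS e : cohnLift (St e) = dS d e.
Proof. by rewrite [LHS]hE freeLift_gen. Qed.
End Lift.

Lemma cohn_ind (Q : C -> Prop) :
  Q 0 -> (forall x y, Q x -> Q y -> Q (x + y)) -> (forall c x, Q x -> Q (c *: x)) ->
  (forall v, Q (V v)) -> (forall e, Q (Ed e)) -> (forall e, Q (St e)) ->
  (forall v x, Q x -> Q (V v ** x)) -> (forall e x, Q x -> Q (Ed e ** x)) ->
  (forall e x, Q x -> Q (St e ** x)) -> forall x, Q x.
Proof.
move=> Q0 QD QZ QV QE QS QVM QEM QSM x; have [y <-] := quotPi_surj x.
rewrite -[quotPi _ y]/(quotProj (cohn_ideal l E) y).
move: y; apply: free_ind => [|y z Qy Qz|c y Qy|[[v|e]|e]|[[v|e]|e] y Qy].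
- by rewrite (lin0 (alg_funL _)).
- by rewrite (linD (alg_funL _)); exact: QD.
- by rewrite (linZ (alg_funL _)); exact: QZ.
- exact: QV.
- exact: QE.
- exact: QS.
- by rewrite alg_funM; exact: QVM.
- by rewrite alg_funM; exact: QEM.
- by rewrite alg_funM; exact: QSM.
Qed.

Lemma cohn_ext (B : nuAlgType l) (f g : algHom C B) :
  (forall v, f (V v) = g (V v)) -> (forall e, f (Ed e) = g (Ed e)) ->
  (forall e, f (St e) = g (St e)) -> f = g.
Proof.
move=> fV fE fS; apply: algHomP.
apply: cohn_ind => // [|x y IH IH'|c x IH|v x IH|e x IH|e x IH].
- by rewrite !(lin0 (alg_funL _)).
- by rewrite (linD (alg_funL f)) IH IH' (linD (alg_funL g)).
- by rewrite (linZ (alg_funL f)) IH (linZ (alg_funL g)).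
- by rewrite !alg_funM fV IH.
- by rewrite !alg_funM fE IH.
- by rewrite !alg_funM fS IH.
Qed.
End CohnAlgebra.

(** * Words over an infinite set *)

Section SequenceInjection.
Variable X : choiceType.
Implicit Types (A B : set X) (w : seq X).

(** Zorn's lemma for the graphs of partial injections between A and B: a maximal one exhausts A or
    B, since otherwise one more pair could be added. *)
Lemma set_comparable A B :
  (exists f : X -> X, (forall x, A x -> B (f x)) /\ set_inj A f) \/
  (exists f : X -> X, (forall x, B x -> A (f x)) /\ set_inj B f).
Proof.
pose P (G : set (X * X)) := (forall p, G p -> A p.1 /\ B p.2) /\
  (forall p q, G p -> G q -> p.1 = q.1 <-> p.2 = q.2).
have [|G [[GAB Ginj] Gmax]] := @Zorn_bigcup (X * X)%type P.
  move=> F FP Ft; split; first by move=> p [G FG Gp]; exact: (FP _ FG).1.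
  move=> p q [G FG Gp] [H FH Hq]; have [GH|HG] := Ft _ _ FG FH.
    by apply: (FP _ FH).2 => //; exact: GH.
  by apply: (FP _ FG).2 => //; exact: HG.
have [domG|/existsNP[a /not_implyP[Aa nGa]]] :=
    pselect (forall x, A x -> exists y, G (x, y)).
  left; have /choice[f fP] : forall x, exists y, A x -> G (x, y).
    by move=> x; have [/domG[y Gy]|nA] := pselect (A x); [exists y|exists x => /nA].
  exists f; split=> [x Ax|x y]; first exact: (GAB _ (fP x Ax)).2.
  by rewrite !inE => Ax Ay /(Ginj _ _ (fP x Ax) (fP y Ay)).2.
have [ranG|/existsNP[b /not_implyP[Bb nGb]]] :=
    pselect (forall y, B y -> exists x, G (x, y)).
  right; have /choice[f fP] : forall y, exists x, B y -> G (x, y).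
    by move=> y; have [/ranG[x Gx]|nB] := pselect (B y); [exists x|exists y => /nB].
  exists f; split=> [y By|x y]; first exact: (GAB _ (fP y By)).1.
  by rewrite !inE => Bx By /(Ginj _ _ (fP x Bx) (fP y By)).1.
exfalso; apply: (Gmax (G `|` [set (a, b)])).
  split; first by move=> p; left.
  by move=> /(_ (a, b)) GG; apply: nGa; exists b; apply: GG; right.
split=> [p [/GAB //|-> //]|p q [Gp|->] [Gq|->] //=]; first exact: Ginj.
- split=> e; first by case: nGa; exists p.2; rewrite -e -surjective_pairing.
  by case: nGb; exists p.1; rewrite -e -surjective_pairing.
- split=> e; first by case: nGa; exists q.2; rewrite e -surjective_pairing.
  by case: nGb; exists q.1; rewrite e -surjective_pairing.
Qed.

Definition wordsIn A w := forall x, x \in w -> A x.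

Section Code.
Variables (A : set X) (c0 c1 : X) (h : X -> X).
Hypotheses (Ac0 : A c0) (Ac1 : A c1) (c01 : c0 <> c1).
(** Respells a word with letters in A: the mark c0 announces a letter of A kept as it is, the mark
    c1 a foreign letter replaced by its image under h. *)
Definition code w := flatten
  [seq if pselect (A x) is left _ then [:: c0; x] else [:: c1; h x] | x <- w].
Lemma code_in w : (forall x, x \in w -> ~ A x -> A (h x)) -> wordsIn A (code w).
Proof.
elim: w => [|x w IH] hw y //=; rewrite mem_cat => /orP[|]; last first.
  by apply: IH => z zw; apply: hw; rewrite inE zw orbT.
case: pselect => Ax; rewrite !inE => /orP[] /eqP -> //.
by apply: hw => //; rewrite inE eqxx.
Qed.
Lemma code_inj w w' :
  (forall x y, x \in w -> y \in w' -> ~ A x -> ~ A y -> h x = h y -> x = y) ->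
  code w = code w' -> w = w'.
Proof.
elim: w w' => [|x w IH] [|y w'] //=; rewrite /code /=; try by case: pselect.
move=> hi; have hi' := hi x y (mem_head _ _) (mem_head _ _).
have {}IH : code w = code w' -> w = w'.
  by apply: IH => u v uw vw; apply: hi; rewrite inE ?uw ?vw orbT.
case: pselect => Ax; case: pselect => Ay /=.
- by case=> -> /IH ->.
- by case=> /c01.
- by case=> /esym/c01.
- by case=> /hi' -> // /IH ->.
Qed.
End Code.

Hypothesis X_infinite : exists n : nat -> X, injective n.

(** Zorn's lemma runs over pairs of a set A with two distinct points and a map embedding the words
    over A into A. The order [le] is extension; values at other words are ignored. *)
Let good (p : set X * (seq X -> X)) :=
  [/\ exists c0 c1, [/\ p.1 c0, p.1 c1 & c0 <> c1],
      forall w, wordsIn p.1 w -> p.1 (p.2 w) &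
      forall w w', wordsIn p.1 w -> wordsIn p.1 w' -> p.2 w = p.2 w' -> w = w'].
Let le (p q : set X * (seq X -> X)) :=
  p.1 `<=` q.1 /\ forall w, wordsIn p.1 w -> p.2 w = q.2 w.

Let exists_good : exists p, good p.
Proof.
have [n ni] := X_infinite.
pose A := range n; have /choice[m mK] : forall x, exists k, A x -> n k = x.
  by move=> x; have [[k _ <-]|nA] := pselect (A x); [exists k|exists 0%N => /nA].
exists (A, fun w => n (choice.pickle (map m w))); split => /=.
- by exists (n 0%N), (n 1%N); split; [exists 0%N|exists 1%N|move/ni].
- by move=> w _; exists (choice.pickle (map m w)).
move=> w w' wA wA' /ni /(pcan_inj choice.pickleK) e.
have r u : wordsIn A u -> map n (map m u) = u.
  elim: u => [|x u IH] //= uA; rewrite mK ?IH // => [y yu|]; apply: uA; rewrite inE ?eqxx //.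
  by rewrite yu orbT.
by rewrite -(r w) // e r.
Qed.

(** Let (A, f) be maximal. If the complement of A embeds in A, every word can be coded over A and
    then embedded by f. Otherwise A embeds in its complement by h, and f extends to the words over
    the union of A and h(A), against maximality. *)
Lemma seq_injection : exists f : seq X -> X, injective f.
Proof.
have [p0 g0] := exists_good; have [n0 _] := X_infinite.
pose T := {p | good p}; pose R (s t : T) := `[< le (sval s) (sval t) >].
have Rxx t : R t t by apply/asboolP; split.
have Rtrans r s t : R r s -> R s t -> R r t.
  move=> /asboolP[rs rs'] /asboolP[st st']; apply/asboolP; split.
    exact: subset_trans st.
  by move=> w wr; rewrite rs' // st' // => x /wr /rs.
have [F Ft|t tmax] :=
    @ZL_preorder T (exist _ p0 g0) R Rxx Rtrans.
  have [[s0 Fs0]|F0] := pselect (exists s, F s); last first.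
    by exists (exist _ p0 g0) => s Fs; case: F0; exists s.
  pose A : set X := [set x | exists2 s, F s & (sval s).1 x].
  (* Words are finite, so in a chain all letters of a word lie in one member. *)
  have Aw w : wordsIn A w -> exists2 s, F s & wordsIn (sval s).1 w.
    elim: w => [|x w IH] wA; first by exists s0.
    have [s Fs ws] : exists2 s, F s & wordsIn (sval s).1 w.
      by apply: IH => y yw; apply: wA; rewrite inE yw orbT.
    have [t Ft' xt] := wA x (mem_head _ _).
    have [/asboolP[st _]|/asboolP[ts _]] := Ft _ _ Fs Ft'.
      by exists t => // y; rewrite inE => /orP[/eqP -> //|/ws /st].
    by exists s => // y; rewrite inE => /orP[/eqP ->|/ws //]; exact: ts.
  have /choice[f fP] : forall w, exists y, forall s, F s -> wordsIn (sval s).1 w ->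
      y = (sval s).2 w.
    move=> w; have [[s Fs ws]|nw] := pselect (exists2 s, F s & wordsIn (sval s).1 w).
      exists ((sval s).2 w) => t Ft' wt.
      by have [/asboolP[_ ->]|/asboolP[_ ->]] := Ft _ _ Fs Ft'.
    by exists (n0 0%N) => s Fs ws; case: nw; exists s.
  have gA : good (A, f).
    split=> /=.
    - have [[c0 [c1 [? ? ?]]] _ _] := svalP s0.
      by exists c0, c1; split => //; exists s0.
    - move=> w /Aw[s Fs ws]; rewrite (fP _ _ Fs ws); exists s => //.
      by have [_ + _] := svalP s; apply.
    move=> w w' wA wA'; have [|s Fs ws] := Aw (w ++ w').
      by move=> x; rewrite mem_cat => /orP[/wA|/wA'].
    have sw : wordsIn (sval s).1 w by move=> x xw; apply: ws; rewrite mem_cat xw.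
    have sw' : wordsIn (sval s).1 w' by move=> x xw; apply: ws; rewrite mem_cat xw orbT.
    by rewrite (fP _ _ Fs sw) (fP _ _ Fs sw'); have [_ _] := svalP s; apply.
  exists (exist _ _ gA) => s Fs; apply/asboolP; split=> [x sx|w ws] /=; first by exists s.
  by rewrite (fP _ _ Fs ws).
have [] := svalP t; move defA: (sval t).1 => A; move deff: (sval t).2 => f.
move=> [c0 [c1 [Ac0 Ac1 c01]]] fA fi.
have [[h [hA hi]]|[h [hA hi]]] := set_comparable A (~` A); last first.
  exists (fun w => f (code A c0 c1 h w)) => w w' /fi e.
  apply: (@code_inj A c0 c1 h c01); last first.
    by apply: e; apply: code_in => // x _ /hA.
  by move=> x y _ _ nAx nAy; apply: hi; rewrite inE.
exfalso; have /choice[k kP] : forall x, exists y, (h @` A) x -> A y /\ h y = x.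
  move=> x; have [[y Ay <-]|nx] := pselect ((h @` A) x); first by exists y.
  by exists x => /nx.
pose A' := A `|` h @` A.
(* A word with a new letter is coded over A and its value is pushed by h out of A, so it cannot
   collide with the value of an old word. *)
pose f' w := if pselect (wordsIn A w) is left _ then f w else h (f (code A c0 c1 k w)).
have kA x : A' x -> ~ A x -> A (k x) /\ h (k x) = x by move=> [Ax /(_ Ax)|/kP].
have cA w : wordsIn A' w -> wordsIn A (code A c0 c1 k w).
  by move=> wA; apply: code_in => // x /wA /kA xA /xA[].
have g' : good (A', f').
  split=> /=; first by exists c0, c1; split => //; left.
    move=> w wA; rewrite /f'; case: pselect => wA'; first by left; exact: fA.
    by right; exists (f (code A c0 c1 k w)) => //; apply/fA/cA.
  move=> w w' wA wA'; rewrite /f'; case: pselect => w1; case: pselect => w2 e.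
  - exact: fi.
  - by case: (hA (f (code A c0 c1 k w'))); [apply/fA/cA|rewrite -e; exact: fA].
  - by case: (hA (f (code A c0 c1 k w))); [apply/fA/cA|rewrite e; exact: fA].
  have /fi e' : f (code A c0 c1 k w) = f (code A c0 c1 k w').
    by apply: hi e; rewrite inE; apply/fA/cA.
  apply: (@code_inj A c0 c1 k c01); last by apply: e'; exact: cA.
  move=> x y xw yw nAx nAy kxy.
  by have [_ <-] := kA _ (wA _ xw) nAx; have [_ <-] := kA _ (wA' _ yw) nAy; rewrite kxy.
have /asboolP[/= A'A _] : R (exist _ _ g') t.
  apply: tmax; apply/asboolP; split=> /= [x|w]; rewrite defA ?deff => wA; first by left.
  by rewrite /f'; case: pselect.
by apply: (hA c0 Ac0); rewrite -defA; apply: A'A; right; exists c0.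
Qed.
End SequenceInjection.

(** * Actions of the Cohn algebra on matrices *)

(* Pairs (f, g) of linear endomorphisms with (f, g) (f', g') = (f f', g' g): the first
   component is a left operator, the second one a right operator. *)
Section Biend.
Variables (l : comPzRingType) (N : lmodType l).

Record biend := Biend {
  bel : N -> N; ber : N -> N; bel_lin : linear bel; ber_lin : linear ber
}.
HB.instance Definition _ := gen_eqMixin biend.
HB.instance Definition _ := gen_choiceMixin biend.
Implicit Types f g h : biend.

Lemma biendP f g : bel f =1 bel g -> ber f =1 ber g -> f = g.
Proof.
case: f g => [f f' fL f'L] [g g' gL g'L] /= /funext fg /funext fg'; subst g g'.
by congr Biend; exact: Prop_irrelevance.
Qed.

Lemma opp_linear (W : lmodType l) (f : N -> W) : linear f -> linear (fun x => - f x).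
Proof. by move=> fL c x y; rewrite fL opprD scalerN. Qed.
Lemma scale_linear (W : lmodType l) (c : l) (f : N -> W) : linear f -> linear (fun x => c *: f x).
Proof. by move=> fL k x y; rewrite fL scalerDr !scalerA mulrC. Qed.

Definition biend0 := Biend (@zero_linear l N N) (@zero_linear l N N).
Definition biendD f g :=
  Biend (linear_add (bel_lin f) (bel_lin g)) (linear_add (ber_lin f) (ber_lin g)).
Definition biendN f := Biend (opp_linear (bel_lin f)) (opp_linear (ber_lin f)).
Definition biendZ (c : l) f := Biend (scale_linear c (bel_lin f)) (scale_linear c (ber_lin f)).
Definition biendM f g :=
  Biend (linear_comp (bel_lin f) (bel_lin g)) (linear_comp (ber_lin g) (ber_lin f)).

Lemma biendDA : associative biendD.
Proof. by move=> f g h; apply: biendP => x /=; rewrite addrA. Qed.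
Lemma biendDC : commutative biendD.
Proof. by move=> f g; apply: biendP => x /=; rewrite addrC. Qed.
Lemma biend0D : left_id biend0 biendD.
Proof. by move=> f; apply: biendP => x /=; rewrite add0r. Qed.
Lemma biendND : left_inverse biend0 biendN biendD.
Proof. by move=> f; apply: biendP => x /=; rewrite addNr. Qed.
HB.instance Definition _ := GRing.isZmodule.Build biend biendDA biendDC biend0D biendND.

Lemma biendZA a b f : biendZ a (biendZ b f) = biendZ (a * b) f.
Proof. by apply: biendP => x /=; rewrite scalerA. Qed.
Lemma biendZ1 : left_id 1 biendZ.
Proof. by move=> f; apply: biendP => x /=; rewrite scale1r. Qed.
Lemma biendZDr : right_distributive biendZ +%R.
Proof. by move=> a f g; apply: biendP => x /=; rewrite scalerDr. Qed.
Lemma biendZDl f : {morph biendZ^~ f : a b / a + b}.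
Proof. by move=> a b; apply: biendP => x /=; rewrite scalerDl. Qed.
HB.instance Definition _ :=
  GRing.Zmodule_isLmodule.Build l biend biendZA biendZ1 biendZDr biendZDl.

Lemma biendMA : associative biendM.
Proof. by move=> f g h; apply: biendP. Qed.
Lemma biendMDl : left_distributive biendM +%R.
Proof. by move=> f g h; apply: biendP => x //=; rewrite (linD (ber_lin h)). Qed.
Lemma biendMDr : right_distributive biendM +%R.
Proof. by move=> f g h; apply: biendP => x //=; rewrite (linD (bel_lin f)). Qed.
Lemma biendMZl (c : l) f g : biendM (c *: f) g = c *: biendM f g.
Proof. by apply: biendP => x //=; rewrite (linZ (ber_lin g)). Qed.
Lemma biendMZr (c : l) f g : biendM f (c *: g) = c *: biendM f g.
Proof. by apply: biendP => x //=; rewrite (linZ (bel_lin f)). Qed.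
HB.instance Definition _ :=
  isNUAlgebra.Build l biend biendMA biendMDl biendMDr biendMZl biendMZr.
End Biend.

Section PartialMaps.
Variables (l : comPzRingType) (B : nuAlgType l) (S : choiceType).
Implicit Types (f g : S -> option S).
Local Notation M := (matAlg B S).

Let ml f (p : munits S) (b : B) : M := if f p.1 is Some s then mE s p.2 b else 0.
Let mr f (p : munits S) (b : B) : M := if f p.2 is Some t then mE p.1 t b else 0.
Let mlL f p : linear (ml f p).
Proof. by rewrite /ml; case: (f _) => [s|]; [exact: mE_linear|exact: zero_linear]. Qed.
Let mrL f p : linear (mr f p).
Proof. by rewrite /mr; case: (f _) => [s|]; [exact: mE_linear|exact: zero_linear]. Qed.

(** Left multiplication by the matrix with entries 1 at (f s, s), and for [colMap] right
    multiplication by the one with entries 1 at (t, f t). Such matrices may have infinitely many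
    entries, so only the operators exist. *)
Definition rowMap f : M -> M := dlift (ml f).
Definition colMap f : M -> M := dlift (mr f).
Lemma rowMap_linear f : linear (rowMap f). Proof. exact: (dlift_linear (mlL f)). Qed.
Lemma colMap_linear f : linear (colMap f). Proof. exact: (dlift_linear (mrL f)). Qed.
Lemma rowMapE f s t b : rowMap f (mE s t b) = if f s is Some s' then mE s' t b else 0.
Proof. exact: (dlift_inj (mlL f)). Qed.
Lemma colMapE f s t b : colMap f (mE s t b) = if f t is Some t' then mE s t' b else 0.
Proof. exact: (dlift_inj (mrL f)). Qed.

Lemma rowMap_comp f g n : rowMap f (rowMap g n) = rowMap (obind f \o g) n.
Proof.
move: n; apply: mE_ext => [||s t b].
- by apply: linear_comp; exact: rowMap_linear.
- exact: rowMap_linear.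
rewrite !rowMapE /=; case: (g s) => [u|] /=; first by rewrite rowMapE.
exact: (lin0 (@rowMap_linear f)).
Qed.
Lemma colMap_comp f g n : colMap f (colMap g n) = colMap (obind f \o g) n.
Proof.
move: n; apply: mE_ext => [||s t b].
- by apply: linear_comp; exact: colMap_linear.
- exact: colMap_linear.
rewrite !colMapE /=; case: (g t) => [u|] /=; first by rewrite colMapE.
exact: (lin0 (@colMap_linear f)).
Qed.
Lemma rowMap_None n : rowMap (fun=> None) n = 0.
Proof.
move: n; apply: mE_ext => [||s t b]; [exact: rowMap_linear|exact: zero_linear|].
by rewrite rowMapE.
Qed.
Lemma colMap_None n : colMap (fun=> None) n = 0.
Proof.
move: n; apply: mE_ext => [||s t b]; [exact: colMap_linear|exact: zero_linear|].
by rewrite colMapE.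
Qed.
Lemma rowcolMap f g n : rowMap f (colMap g n) = colMap g (rowMap f n).
Proof.
move: n; apply: mE_ext => [||s t b].
- by apply: linear_comp; [exact: rowMap_linear|exact: colMap_linear].
- by apply: linear_comp; [exact: colMap_linear|exact: rowMap_linear].
rewrite rowMapE colMapE; case Eg: (g t) => [t'|]; case Ef: (f s) => [s'|];
  by rewrite ?rowMapE ?colMapE ?Eg ?Ef ?(lin0 (@rowMap_linear f)) ?(lin0 (@colMap_linear g)).
Qed.

Let bilin_ext (F G : M -> M -> M) : (forall m, linear (F^~ m)) -> (forall n, linear (F n)) ->
  (forall m, linear (G^~ m)) -> (forall n, linear (G n)) ->
  (forall s t b u v c, F (mE s t b) (mE u v c) = G (mE s t b) (mE u v c)) ->
  forall n m, F n m = G n m.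
Proof.
move=> Fl Fr Gl Gr FG n m; move: n; apply: mE_ext => // s t b.
by move: m; apply: mE_ext.
Qed.
Let mulLl (m : M) : linear (fun n => n ** m). Proof. exact: amul_linear_l. Qed.
Let mulLr (n : M) : linear (fun m => n ** m). Proof. exact: amul_linear_r. Qed.

Lemma rowMapM f n m : rowMap f (n ** m) = rowMap f n ** m.
Proof.
move: n m; apply: bilin_ext => [m|n|m|n|s t b u v c].
- exact: (linear_comp (rowMap_linear f) (mulLl m)).
- exact: (linear_comp (rowMap_linear f) (mulLr n)).
- exact: (linear_comp (mulLl m) (rowMap_linear f)).
- exact: mulLr.
rewrite mEM rowMapE; case tu: (t == u); last first.
  by rewrite (lin0 (rowMap_linear f)); case: (f s) => [s'|]; rewrite ?amul0l ?mEM ?tu.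
by rewrite rowMapE; case: (f s) => [s'|]; rewrite ?amul0l ?mEM ?tu.
Qed.
Lemma colMapM f n m : colMap f (n ** m) = n ** colMap f m.
Proof.
move: n m; apply: bilin_ext => [m|n|m|n|s t b u v c].
- exact: (linear_comp (colMap_linear f) (mulLl m)).
- exact: (linear_comp (colMap_linear f) (mulLr n)).
- exact: mulLl.
- exact: (linear_comp (mulLr n) (colMap_linear f)).
rewrite mEM colMapE; case tu: (t == u); last first.
  by rewrite (lin0 (colMap_linear f)); case: (f v) => [v'|]; rewrite ?amul0r ?mEM ?tu.
by rewrite colMapE; case: (f v) => [v'|]; rewrite ?amul0r ?mEM ?tu.
Qed.

Definition partial_inverse f g := forall s t, f s = Some t <-> g t = Some s.
(** On the right, the matrix of f moves column indices by the inverse g; this is associativity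
    across that matrix and becomes [baC_mul]. *)
Lemma rowMap_colMap f g n m : partial_inverse f g -> n ** rowMap f m = colMap g n ** m.
Proof.
move=> fg; move: n m; apply: bilin_ext => [m|n|m|n|s t b u v c].
- exact: mulLl.
- exact: (linear_comp (mulLr n) (rowMap_linear f)).
- exact: (linear_comp (mulLl m) (colMap_linear g)).
- exact: mulLr.
rewrite rowMapE colMapE.
case fu: (f u) => [u'|]; case gt: (g t) => [t'|]; rewrite ?amul0r ?amul0l ?mEM //.
- suff -> : (t == u') = (t' == u) by [].
  apply/eqP/eqP => [tu|tu]; first by move/fg: fu; rewrite -tu gt => -[].
  by move/fg: gt; rewrite tu fu => -[].
- by case: eqP => // tu; move/fg: fu; rewrite -tu gt.
- by case: eqP => // tu; move/fg: gt; rewrite tu fu.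
Qed.

Definition pmapBiend f g : biend M := Biend (rowMap_linear f) (colMap_linear g).
End PartialMaps.

(* A labelled set on which the edges act by partial injections with disjoint ranges. *)
Record branching (E : graph) (S : choiceType) := Branching {
  br_lab : S -> option (vert E);
  br_op : edge E -> S -> S;
  br_lab_op : forall e s, br_lab s = Some (rng e) -> br_lab (br_op e s) = Some (src e);
  br_inj : forall e f s t, br_lab s = Some (rng e) -> br_lab t = Some (rng f) ->
    br_op e s = br_op f t -> e = f /\ s = t
}.

Section Action.
Variables (l : comPzRingType) (E : graph) (S : choiceType) (b : branching E S) (B : nuAlgType l).
Local Notation C := (cohn l E).
Local Notation M := (matAlg B S).

Definition actV v (s : S) := if br_lab b s == Some v then Some s else None.
Definition actE e (s : S) := if br_lab b s == Some (rng e) then Some (br_op b e s) else None.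
Definition actS e (s : S) :=
  if pselect (exists t, br_lab b t = Some (rng e) /\ s = br_op b e t) is left h
  then Some (projT1 (cid h)) else None.

Lemma actSP e s t : actS e s = Some t <-> br_lab b t = Some (rng e) /\ s = br_op b e t.
Proof.
rewrite /actS; case: pselect => [h|nh]; last by split=> // ?; case: nh; exists t.
case: cid => u [lu su] /=; split=> [[<-//]|[lt st]].
by have [_ ->] := br_inj lu lt (etrans (esym su) st).
Qed.
Lemma actEP e s t : actE e s = Some t <-> br_lab b s = Some (rng e) /\ t = br_op b e s.
Proof.
rewrite /actE; case: eqP => [ls|nls]; last by split=> // -[].
by split=> [[<-]|[_ ->]].
Qed.
Lemma actE_S e : partial_inverse (actE e) (actS e).
Proof. by move=> s t; rewrite actEP actSP. Qed.
Lemma actS_E e : partial_inverse (actS e) (actE e).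
Proof. by move=> s t; rewrite actEP actSP. Qed.
Lemma actV_V v : partial_inverse (actV v) (actV v).
Proof.
by move=> s t; rewrite /actV; split; case: eqP => // e [<-]; rewrite e eqxx.
Qed.

Let VV v w : obind (actV v) \o actV w = if v == w then actV v else fun=> None.
Proof.
apply/funext => s /=; rewrite /actV; case: eqP => [sw|sw] /=; last first.
  by case: eqP => // ->; case: eqP.
by rewrite sw (inj_eq Some_inj) eq_sym; case: eqP => // ->; rewrite sw eqxx.
Qed.
Let VE e : obind (actV (src e)) \o actE e = actE e.
Proof.
apply/funext => s /=; rewrite /actE; case: eqP => //= se.
by rewrite /actV br_lab_op // eqxx.
Qed.
Let EV e : obind (actE e) \o actV (rng e) = actE e.
Proof. by apply/funext => s /=; rewrite /actE /actV; case: eqP => //= ->; rewrite eqxx. Qed.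
Let VS e : obind (actV (rng e)) \o actS e = actS e.
Proof.
apply/funext => s /=; case se: (actS e s) => [t|] //=.
by have [lt _] := (actSP _ _ _).1 se; rewrite /actV lt eqxx.
Qed.
Let SV e : obind (actS e) \o actV (src e) = actS e.
Proof.
apply/funext => s /=; rewrite /actV; case: eqP => // ns /=; symmetry.
case se: (actS e s) => [t|] //; have [lt st] := (actSP _ _ _).1 se.
by case: ns; rewrite st br_lab_op.
Qed.
Let SE e f : obind (actS e) \o actE f = if e == f then actV (rng e) else fun=> None.
Proof.
apply/funext => s /=; rewrite /actE; case: (eqVneq (br_lab b s)) => /= [sf|sf]; last first.
  by case: eqP => // ->; rewrite /actV (negbTE sf).
case: eqP => [->|ef]; last first.
  case se: (actS _ _) => [t|] //; have [lt st] := (actSP _ _ _).1 se.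
  by have [/esym] := br_inj sf lt st.
by rewrite /actV sf eqxx; apply/actSP.
Qed.

Let P := @pmapBiend l B S.
Let PM f g f' g' f2 g2 : obind f \o f' = f2 -> obind g' \o g = g2 -> P f g ** P f' g' = P f2 g2.
Proof.
by move=> <- <-; apply: biendP => n; [exact: rowMap_comp|exact: colMap_comp].
Qed.
Let P0 : P (fun=> None) (fun=> None) = 0.
Proof. by apply: biendP => n; [exact: rowMap_None|exact: colMap_None]. Qed.

Let gV v := P (actV v) (actV v).
Let gE e := P (actE e) (actS e).
Let gS e := P (actS e) (actE e).
Let gVV v w : gV v ** gV w = if v == w then gV v else 0.
Proof.
by rewrite /gV (PM (VV v w) (VV w v)) [w == v]eq_sym; case: eqP => [->|_] //; exact: P0.
Qed.
Let gSE e f : gS e ** gE f = if e == f then gV (rng e) else 0.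
Proof. by rewrite /gV (PM (SE e f) (SE f e)) [f == e]eq_sym; case: eqP => [->|_] //; exact: P0. Qed.

Definition actData : cohnData E (biend M) :=
  @CohnData l E (biend M) gV gE gS gVV
    (fun e => PM (VE e) (SV e)) (fun e => PM (EV e) (VS e))
    (fun e => PM (VS e) (EV e)) (fun e => PM (SV e) (VE e)) gSE.
Definition act : algHom C (biend M) := cohnLift actData.

(** The operators of C(E) are generated by partial injections paired with their inverses, so each
    law of a biaction has to be checked on those only. *)
Lemma act_ind (Q : biend M -> Prop) : Q 0 -> (forall x y, Q x -> Q y -> Q (x + y)) ->
  (forall c x, Q x -> Q (c *: x)) -> (forall x y, Q x -> Q y -> Q (x ** y)) ->
  (forall f g, partial_inverse f g -> Q (pmapBiend B f g)) -> forall c, Q (act c).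
Proof.
move=> Q0 QD QZ QM QP.
have QV v : Q (act (cV l v)) by rewrite cohnLiftV; apply: QP; exact: actV_V.
have QE e : Q (act (cE l e)) by rewrite cohnLiftE; apply: QP; exact: actE_S.
have QS e : Q (act (cS l e)) by rewrite cohnLiftS; apply: QP; exact: actS_E.
apply: cohn_ind => // [|x y Qx Qy|c x Qx|v x Qx|e x Qx|e x Qx].
- by rewrite (lin0 (alg_funL _)).
- by rewrite (linD (alg_funL _)); exact: QD.
- by rewrite (linZ (alg_funL _)); exact: QZ.
- by rewrite alg_funM; exact: QM.
- by rewrite alg_funM; exact: QM.
- by rewrite alg_funM; exact: QM.
Qed.

Let L (c : C) (n : M) := bel (act c) n.
Let R (c : C) (n : M) := ber (act c) n.
Let L1 n : linear (L^~ n). Proof. by move=> k x y; rewrite /L (alg_funL act). Qed.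
Let R1 n : linear (R^~ n). Proof. by move=> k x y; rewrite /R (alg_funL act). Qed.
Let LM c c' n : L (c ** c') n = L c (L c' n). Proof. by rewrite /L alg_funM. Qed.
Let RM c c' n : R (c ** c') n = R c' (R c n). Proof. by rewrite /R alg_funM. Qed.
Let LR c c' n : L c (R c' n) = R c' (L c n).
Proof.
rewrite /L /R; move: n; apply: (act_ind (Q := fun b' =>
    forall n, bel (act c) (ber b' n) = ber b' (bel (act c) n)))
  => [n|x y Hx Hy n|k x Hx n|x y Hx Hy n|f g _ n].
- exact: (lin0 (bel_lin _)).
- by rewrite (linD (bel_lin _)) Hx Hy.
- by rewrite (linZ (bel_lin _)) Hx.
- by rewrite Hy Hx.
move: n; apply: (act_ind (Q := fun b' => forall n, bel b' (colMap g n) = colMap g (bel b' n)))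
  => [n|x y Hx Hy n|k x Hx n|x y Hx Hy n|f' g' _ n].
- by rewrite (lin0 (colMap_linear g)).
- by rewrite (linD (colMap_linear g)) -Hx -Hy.
- by rewrite (linZ (colMap_linear g)) -Hx.
- by rewrite -Hx -Hy.
exact: rowcolMap.
Qed.
Let Lmul c n m : L c (n ** m) = L c n ** m.
Proof.
rewrite /L; move: n m; apply: (act_ind (Q := fun b' => forall n m, bel b' (n ** m) = bel b' n ** m))
  => [n m|x y Hx Hy n m|k x Hx n m|x y Hx Hy n m|f g _ n m].
- by rewrite amul0l.
- by rewrite amulDl -Hx -Hy.
- by rewrite amulZl -Hx.
- by rewrite -Hx -Hy.
exact: rowMapM.
Qed.
Let Rmul c n m : R c (n ** m) = n ** R c m.
Proof.
rewrite /R; move: n m; apply: (act_ind (Q := fun b' => forall n m, ber b' (n ** m) = n ** ber b' m))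
  => [n m|x y Hx Hy n m|k x Hx n m|x y Hx Hy n m|f g _ n m].
- by rewrite amul0r.
- by rewrite amulDr -Hx -Hy.
- by rewrite amulZr -Hx.
- by rewrite -Hy -Hx.
exact: colMapM.
Qed.
Let Cmul c n m : n ** L c m = R c n ** m.
Proof.
rewrite /L /R; move: n m; 
  apply: (act_ind (Q := fun b' => forall n m, n ** bel b' m = ber b' n ** m))
  => [n m|x y Hx Hy n m|k x Hx n m|x y Hx Hy n m|f g fg n m].
- by rewrite amul0l amul0r.
- by rewrite amulDl amulDr Hx Hy.
- by rewrite amulZl amulZr Hx.
- by rewrite Hx Hy.
exact: rowMap_colMap.
Qed.

Definition cohnAction : biaction C M :=
  @Biaction l C M L R L1 (fun c => bel_lin (act c)) R1 (fun c => ber_lin (act c))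
    LM RM LR Lmul Rmul Cmul.

Lemma cohnAction_LV v n : baL cohnAction (cV l v) n = rowMap (actV v) n.
Proof. by rewrite /= /L cohnLiftV. Qed.
Lemma cohnAction_LE e n : baL cohnAction (cE l e) n = rowMap (actE e) n.
Proof. by rewrite /= /L cohnLiftE. Qed.
Lemma cohnAction_LS e n : baL cohnAction (cS l e) n = rowMap (actS e) n.
Proof. by rewrite /= /L cohnLiftS. Qed.
Lemma cohnAction_RV v n : baR cohnAction (cV l v) n = colMap (actV v) n.
Proof. by rewrite /= /R cohnLiftV. Qed.
Lemma cohnAction_RE e n : baR cohnAction (cE l e) n = colMap (actS e) n.
Proof. by rewrite /= /R cohnLiftE. Qed.
Lemma cohnAction_RS e n : baR cohnAction (cS l e) n = colMap (actE e) n.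
Proof. by rewrite /= /R cohnLiftS. Qed.
End Action.

(* Simplification would unfold these down to sums over words. *)
Opaque sgLift freeLift cohnLift polyConst matMap ev0 ev1 act cohnAction.

Lemma compAlgE (l : comPzRingType) (A B C : nuAlgType l) (g : algHom B C) (f : algHom A B) x :
  compAlg g f x = g (f x).
Proof. by []. Qed.

(** * The inclusion of the vertices *)

Section FunctionAlgebra.
Variables (l : comPzRingType) (I : choiceType).

Lemma chi_ind (Q : funAlg l I -> Prop) : Q 0 -> (forall x y, Q x -> Q y -> Q (x + y)) ->
  (forall c i, Q (c *: chi l i)) -> forall x, Q x.
Proof.
move=> Q0 QD Qc; apply: (@dsumAlg_ind l I (fun=> l^o : nuAlgType l)) => // i a.
suff -> : dinj i a = (a : l) *: chi l i by [].
by apply: dsumP => j; rewrite dsumZE /chi; have [<-|ij] := eqVneq i j;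
  rewrite ?dinj_id ?dinj_neq // ?scaler0 //; exact: esym (mulr1 _).
Qed.
Lemma fun_ext (B : nuAlgType l) (f g : algHom (funAlg l I) B) :
  (forall i, f (chi l i) = g (chi l i)) -> f = g.
Proof.
move=> fg; apply: algHomP; apply: chi_ind => [|x y IH IH'|c i].
- by rewrite !(lin0 (alg_funL _)).
- by rewrite (linD (alg_funL f)) IH IH' (linD (alg_funL g)).
- by rewrite (linZ (alg_funL f)) fg (linZ (alg_funL g)).
Qed.
Lemma chiM (i j : I) : chi l i ** chi l j = if i == j then chi l i else 0.
Proof. by case: eqP => [<-|/eqP ij]; [exact: chi_idem|exact: dinjM_neq]. Qed.
End FunctionAlgebra.

(* S is an index set that contains a base point, the vertices, the edges and, for an edge e
   and an element s, an element e s. *)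
Section Coding.
Variables (E : graph) (S : choiceType).
Definition codeDom := option (vert E + edge E + edge E * S).
Variables (c : codeDom -> S) (c_inj : injective c).

Definition basept : S := c None.
Definition vpt (v : vert E) : S := c (Some (inl (inl v))).
Definition ept (e : edge E) : S := c (Some (inl (inr e))).
Definition opt (e : edge E) (s : S) : S := c (Some (inr (e, s))).

Definition decode (s : S) : codeDom :=
  if pselect (exists x, c x = s) is left h then projT1 (cid h) else None.
Lemma codeK x : decode (c x) = x.
Proof.
rewrite /decode; case: pselect => [h|[]]; last by exists x.
by case: cid => y /= /c_inj.
Qed.

(** Labels are sources of paths. For [lab1] the path e of length one is the point [ept e]; for
    [lab0] it is [opt e (vpt (rng e))]. Points [opt e s] with s not composable with e carry labels
    too and merely enlarge the module. *)
Definition lab1 (s : S) : option (vert E) :=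
  match decode s with Some (inl (inr e)) => Some (src e) | Some (inr (e, _)) => Some (src e)
  | _ => None end.
Definition lab0 (s : S) : option (vert E) :=
  match decode s with Some (inl (inl v)) => Some v | Some (inr (e, _)) => Some (src e)
  | _ => None end.

Lemma opt_inj e f s t : opt e s = opt f t -> e = f /\ s = t.
Proof. by move/c_inj => [-> ->]. Qed.
Lemma vpt_inj : injective vpt. Proof. by move=> v w /c_inj[]. Qed.

(* On these labels the Cohn algebra acts through the paths of positive length only: the
   points [vpt v] carry no label and are killed. *)
Definition branching1 : branching E S.
Proof.
exists lab1 opt => [e s _|e f s t _ _]; last exact: opt_inj.
by rewrite /lab1 /opt codeK.
Defined.

(* Here the points [vpt v] are the trivial paths, which gives the Fock representation. *)
Definition branching0 : branching E S.
Proof.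
exists lab0 opt => [e s _|e f s t _ _]; last exact: opt_inj.
by rewrite /lab0 /opt codeK.
Defined.
End Coding.

Section VertexInclusion.
Variables (l : comPzRingType) (E : graph) (S : choiceType).
Variables (c : codeDom E S -> S) (c_inj : injective c).
Local Notation C := (cohn l E).
Local Notation A := (funAlg l (vert E)).
Local Notation s0 := (basept c).
Local Notation bv := (vpt c).
Local Notation be := (ept c).
Local Notation br := (branching1 c_inj).
Local Notation act B := (@cohnAction l E S br B).
Local Notation D B := (sdprod (act B)).

Let bv_s0 v : bv v != s0. Proof. by apply/eqP => /c_inj. Qed.
Let bv_be v e : (bv v == be e) = false. Proof. by apply/eqP => /c_inj. Qed.
Let be_bv v e : (be e == bv v) = false. Proof. by apply/eqP => /c_inj. Qed.
Let bv_bv v w : (bv v == bv w) = (v == w). Proof. exact: (inj_eq (vpt_inj c_inj)). Qed.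
Let be_be e f : (be e == be f) = (e == f).
Proof. by apply/eqP/eqP => [/c_inj[]|->]. Qed.

Let actV_bv v w : actV br v (bv w) = None.
Proof. by rewrite /actV /= /lab1 codeK. Qed.
Let actE_bv e w : actE br e (bv w) = None.
Proof. by rewrite /actE /= /lab1 codeK. Qed.
Let actS_bv e w : actS br e (bv w) = None.
Proof. by case s: actS => [t|] //; have [_ /c_inj] := (actSP _ _ _ _).1 s. Qed.
Let actS_be e f : actS br e (be f) = None.
Proof. by case s: actS => [t|] //; have [_ /c_inj] := (actSP _ _ _ _).1 s. Qed.
Let actV_be v e : actV br v (be e) = if src e == v then Some (be e) else None.
Proof. by rewrite /actV /= /lab1 codeK //= (inj_eq Some_inj). Qed.

(** The point [vpt v] has no label and is not of the form [opt e s], so every generator kills it.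
    Matrices supported on these points are thus orthogonal to the copy of C(E) in the semidirect
    product. *)
Lemma cohnAction_baL0 (B : nuAlgType l) x v t b : baL (act B) x (mE (bv v) t b) = 0.
Proof.
have z y : baL (act B) y 0 = 0 := lin0 (baL_linr (act B) y).
have L1 n := baL_lin (act B) n.
move: x; apply: cohn_ind => [|x y Hx Hy|k x Hx|w|e|e|w x Hx|e x Hx|e x Hx];
  rewrite ?baLM ?(lin0 (L1 _)) ?(linD (L1 _)) ?(linZ (L1 _)) ?Hx ?Hy ?addr0 ?scaler0 ?z //.
- by rewrite cohnAction_LV rowMapE actV_bv.
- by rewrite cohnAction_LE rowMapE actE_bv.
- by rewrite cohnAction_LS rowMapE actS_bv.
Qed.
Lemma cohnAction_baR0 (B : nuAlgType l) x v t b : baR (act B) x (mE t (bv v) b) = 0.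
Proof.
have z y : baR (act B) y 0 = 0 := lin0 (baR_linr (act B) y).
have L1 n := baR_lin (act B) n.
have HV w : baR (act B) (cV l w) (mE t (bv v) b) = 0.
  by rewrite cohnAction_RV colMapE actV_bv.
have HE e : baR (act B) (cE l e) (mE t (bv v) b) = 0.
  by rewrite cohnAction_RE colMapE actS_bv.
have HS e : baR (act B) (cS l e) (mE t (bv v) b) = 0.
  by rewrite cohnAction_RS colMapE actE_bv.
move: x; apply: cohn_ind => [|x y Hx Hy|k x Hx|w|e|e|w x Hx|e x Hx|e x Hx];
  by rewrite ?baRM ?(lin0 (L1 _)) ?(linD (L1 _)) ?(linZ (L1 _)) ?HV ?HE ?HS ?Hx ?Hy
    ?addr0 ?scaler0 ?z.
Qed.

Section Coefficients.
Variables (A' B : nuAlgType l) (f : algHom A' B).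

Lemma cohnAction_map x n :
  baL (act B) x (matMap S f n) = matMap S f (baL (act A') x n) /\
  baR (act B) x (matMap S f n) = matMap S f (baR (act A') x n).
Proof.
have rm g m : rowMap g (matMap S f m) = matMap S f (rowMap g m).
  move: m; apply: mE_ext => [||s t b].
  - by apply: linear_comp; [exact: rowMap_linear|exact: alg_funL].
  - by apply: linear_comp; [exact: alg_funL|exact: rowMap_linear].
  rewrite matMapE !rowMapE; case: (g s) => [u|]; first by rewrite matMapE.
  by rewrite (lin0 (alg_funL _)).
have cm g m : colMap g (matMap S f m) = matMap S f (colMap g m).
  move: m; apply: mE_ext => [||s t b].
  - by apply: linear_comp; [exact: colMap_linear|exact: alg_funL].
  - by apply: linear_comp; [exact: alg_funL|exact: colMap_linear].
  rewrite matMapE !colMapE; case: (g t) => [u|]; first by rewrite matMapE.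
  by rewrite (lin0 (alg_funL _)).
have HV v m : baL (act B) (cV l v) (matMap S f m) = matMap S f (baL (act A') (cV l v) m) /\
    baR (act B) (cV l v) (matMap S f m) = matMap S f (baR (act A') (cV l v) m).
  by rewrite !cohnAction_LV !cohnAction_RV rm cm.
have HE e m : baL (act B) (cE l e) (matMap S f m) = matMap S f (baL (act A') (cE l e) m) /\
    baR (act B) (cE l e) (matMap S f m) = matMap S f (baR (act A') (cE l e) m).
  by rewrite !cohnAction_LE !cohnAction_RE rm cm.
have HS e m : baL (act B) (cS l e) (matMap S f m) = matMap S f (baL (act A') (cS l e) m) /\
    baR (act B) (cS l e) (matMap S f m) = matMap S f (baR (act A') (cS l e) m).
  by rewrite !cohnAction_LS !cohnAction_RS rm cm.
move: x n; apply: cohn_ind => // [n|x y Hx Hy n|k x Hx n|v x Hx n|e x Hx n|e x Hx n].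
- rewrite !(lin0 (baL_lin (act B) _)) !(lin0 (baR_lin (act B) _)).
  rewrite !(lin0 (baL_lin (act A') _)) !(lin0 (baR_lin (act A') _)).
  by rewrite !(lin0 (alg_funL _)).
- rewrite !(linD (baL_lin _ _)) !(linD (baR_lin _ _)) (Hx n).1 (Hx n).2 (Hy n).1 (Hy n).2.
  by rewrite !(linD (alg_funL (matMap S f))).
- rewrite !(linZ (baL_lin _ _)) !(linZ (baR_lin _ _)) (Hx n).1 (Hx n).2.
  by rewrite !(linZ (alg_funL (matMap S f))).
- by rewrite !baLM !baRM (Hx n).1 (HV _ _).1 (HV _ _).2 (Hx _).2.
- by rewrite !baLM !baRM (Hx n).1 (HE _ _).1 (HE _ _).2 (Hx _).2.
- by rewrite !baLM !baRM (Hx n).1 (HS _ _).1 (HS _ _).2 (Hx _).2.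
Qed.

Let h (x : D A') : D B := (x.1, matMap S f x.2).
Let hL : linear h.
Proof. by move=> k x y; rewrite /h (alg_funL (matMap S f)). Qed.
Let hM : {morph h : x y / x ** y}.
Proof.
move=> x y; rewrite sd_mulE /h /= [RHS]sd_mulE /=.
rewrite (cohnAction_map x.1 y.2).1 (cohnAction_map y.1 x.2).2.
by rewrite !(linD (alg_funL (matMap S f))) alg_funM.
Qed.
Definition sdMap : algHom (D A') (D B) := @AlgHom l (D A') (D B) h hL hM.
End Coefficients.

Section Fock.
Variables (B : nuAlgType l) (p : vert E -> B).
Hypothesis pM : forall v w, p v ** p w = if v == w then p v else 0.

Let fV v : D B := (cV l v, mE (bv v) (bv v) (p v)).
Let fE e : D B := (cE l e, mE (be e) (bv (rng e)) (p (rng e))).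
Let fS e : D B := (cS l e, mE (bv (rng e)) (be e) (p (rng e))).
Let fVV v w : fV v ** fV w = if v == w then fV v else 0.
Proof.
rewrite sd_mulE /= cohnAction_baL0 cohnAction_baR0 !add0r mEM bv_bv cVV pM.
by case: eqP => [<-|].
Qed.
Let fVE e : fV (src e) ** fE e = fE e.
Proof.
rewrite sd_mulE /= cohnAction_baR0 mEM bv_be !addr0 cVE.
by rewrite cohnAction_LV rowMapE actV_be eqxx.
Qed.
Let fEV e : fE e ** fV (rng e) = fE e.
Proof. by rewrite sd_mulE /= cohnAction_baL0 cohnAction_baR0 !add0r mEM eqxx cEV pM eqxx. Qed.
Let fVS e : fV (rng e) ** fS e = fS e.
Proof. by rewrite sd_mulE /= cohnAction_baL0 cohnAction_baR0 !add0r mEM eqxx cVS pM eqxx. Qed.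
Let fSV e : fS e ** fV (src e) = fS e.
Proof.
rewrite sd_mulE /= cohnAction_baL0 mEM be_bv !addr0 add0r cSV.
by rewrite cohnAction_RV colMapE actV_be eqxx.
Qed.
Let fSE e f : fS e ** fE f = if e == f then fV (rng e) else 0.
Proof.
rewrite sd_mulE /= cSE mEM be_be.
rewrite cohnAction_LS rowMapE actS_be cohnAction_RE colMapE actS_be !add0r.
by case: eqP => // <-; rewrite pM eqxx.
Qed.
(** C(E) already acts on paths of positive length; the matrix terms add the trivial paths, with e
    sending the trivial path at r(e) to [ept e]. The idempotents p v are the coefficients of the
    trivial paths. *)
Definition fockData : cohnData E (D B) := CohnData fVV fVE fEV fVS fSV fSE.
Definition fock : algHom C (D B) := cohnLift fockData.
End Fock.

Section FockHomotopy.
Let k x : polyAlg (D C) := polyConst _ ((x, 0) : D C).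
Let n s t x : polyAlg (D C) := polyConst _ ((0, mE s t x) : D C).

Let kk x y : k x ** k y = k (x ** y).
Proof.
by rewrite /k -alg_funM -[(x, 0)]/(sdSec (act C) x) -[(y, 0)]/(sdSec (act C) y) -alg_funM.
Qed.
Let nE s t x : n s t x = polyConst _ (sdIn (act C) (mE s t x)). Proof. by []. Qed.
Let nn s t u v x y : n s t x ** n u v y = if t == u then n s v (x ** y) else 0.
Proof.
rewrite !nE -!alg_funM mEM; case: eqP => // _.
by rewrite (lin0 (alg_funL (sdIn _))) (lin0 (alg_funL (polyConst _))).
Qed.
Let n0 s t : n s t 0 = 0.
Proof. by rewrite nE mE0 (lin0 (alg_funL (sdIn _))) (lin0 (alg_funL (polyConst _))). Qed.
Let kn x s t y : k x ** n s t y = polyConst _ (sdIn (act C) (baL (act C) x (mE s t y))).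
Proof.
rewrite /k /n -alg_funM sd_mulE /= amul0r amul0l addr0.
by rewrite (lin0 (baR_lin (act C) _)) addr0.
Qed.
Let nk x s t y : n s t y ** k x = polyConst _ (sdIn (act C) (baR (act C) x (mE s t y))).
Proof.
rewrite /k /n -alg_funM sd_mulE /= amul0l amul0r addr0.
by rewrite (lin0 (baL_lin (act C) _)) add0r.
Qed.
Let pc0 : polyConst _ (sdIn (act C) 0) = 0 :> polyAlg (D C).
Proof. by rewrite (lin0 (alg_funL (sdIn _))) (lin0 (alg_funL (polyConst _))). Qed.
Let kn0 x v t y : k x ** n (bv v) t y = 0. Proof. by rewrite kn cohnAction_baL0 pc0. Qed.
Let nk0 x v t y : n t (bv v) y ** k x = 0. Proof. by rewrite nk cohnAction_baR0 pc0. Qed.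
Let kVn e t y : k (cV l (src e)) ** n (be e) t y = n (be e) t y.
Proof. by rewrite kn cohnAction_LV rowMapE actV_be eqxx. Qed.
Let nkV e t y : n t (be e) y ** k (cV l (src e)) = n t (be e) y.
Proof. by rewrite nk cohnAction_RV colMapE actV_be eqxx. Qed.
Let kSn e f t y : k (cS l e) ** n (be f) t y = 0.
Proof. by rewrite kn cohnAction_LS rowMapE actS_be pc0. Qed.
Let nkE e f t y : n t (be f) y ** k (cE l e) = 0.
Proof. by rewrite nk cohnAction_RE colMapE actS_be pc0. Qed.

(** At t = 0, e sends the trivial path at r(e) to the path [ept e] with coefficient r(e); at t = 1,
    to the trivial path at s(e) with coefficient e. The relation e^* e = r(e) persists in between
    because row times column is 1. *)
Let gV v := k (cV l v) + n (bv v) (bv v) (cV l v).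
Let gE e := k (cE l e) + (colv false (n (be e) (bv (rng e)) (cV l (rng e))) +
  colv true (n (bv (src e)) (bv (rng e)) (cE l e))).
Let gS e := k (cS l e) + (rowv false (n (bv (rng e)) (be e) (cV l (rng e))) +
  rowv true (n (bv (rng e)) (bv (src e)) (cS l e))).

Let c0 i : colv i 0 = 0 :> polyAlg (D C). Proof. exact: (lin0 (@colv_linear _ _ i)). Qed.
Let r0 i : rowv i 0 = 0 :> polyAlg (D C). Proof. exact: (lin0 (@rowv_linear _ _ i)). Qed.
Let mul33 (x y z x' y' z' : polyAlg (D C)) : (x + (y + z)) ** (x' + (y' + z')) =
  (x ** x' + (x ** y' + x ** z')) +
  ((y ** x' + (y ** y' + y ** z')) + (z ** x' + (z ** y' + z ** z'))).
Proof. by rewrite !amulDl !amulDr. Qed.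
Let mul23 (x y x' y' z' : polyAlg (D C)) : (x + y) ** (x' + (y' + z')) =
  (x ** x' + (x ** y' + x ** z')) + (y ** x' + (y ** y' + y ** z')).
Proof. by rewrite !amulDl !amulDr. Qed.
Let mul32 (x y z x' y' : polyAlg (D C)) : (x + (y + z)) ** (x' + y') =
  (x ** x' + x ** y') + ((y ** x' + y ** y') + (z ** x' + z ** y')).
Proof. by rewrite !amulDl !amulDr. Qed.
Let mul22 (x y x' y' : polyAlg (D C)) : (x + y) ** (x' + y') =
  (x ** x' + x ** y') + (y ** x' + y ** y').
Proof. by rewrite !amulDl !amulDr. Qed.

Let gVV v w : gV v ** gV w = if v == w then gV v else 0.
Proof.
rewrite mul22 kk kn0 nk0 nn bv_bv cVV addr0 add0r; case: eqP => [<-|_] //.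
by rewrite addr0 /k -[(0, 0)]/(sdIn (act C) 0) pc0.
Qed.
Let gVE e : gV (src e) ** gE e = gE e.
Proof.
rewrite mul23 -!colvMr kk cVE kVn kn0 nk0 !nn bv_be eqxx cVE !c0.
by rewrite addr0 !add0r -addrA.
Qed.
Let gEV e : gE e ** gV (rng e) = gE e.
Proof.
rewrite mul32 -!colvMl kk cEV kn0 !nk0 !nn eqxx cVV eqxx cEV !c0.
by rewrite addr0 !add0r.
Qed.
Let gVS e : gV (rng e) ** gS e = gS e.
Proof.
rewrite mul23 -!rowvMr kk cVS !kn0 nk0 !nn eqxx cVV eqxx cVS !r0.
by rewrite !addr0 !add0r.
Qed.
Let gSV e : gS e ** gV (src e) = gS e.
Proof.
rewrite mul32 -!rowvMl kk cSV kn0 nkV nk0 !nn be_bv eqxx cSV !r0.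
by rewrite !addr0 !add0r.
Qed.
Let gSE e f : gS e ** gE f = if e == f then gV (rng e) else 0.
Proof.
rewrite mul33 -!rowvMl -!colvMr kk kSn kn0 nkE nk0 !nn be_be be_bv bv_be bv_bv !c0 !r0.
rewrite !addr0 !add0r ?addr0 cSE; case: eqP => [<-|ef].
  by rewrite eqxx cVV eqxx row_col.
by rewrite n0 !if_same !c0 !r0 addr0 addr0 /k -[(0, 0)]/(sdIn (act C) 0) pc0.
Qed.

Definition fockHomotopy : algHom C (polyAlg (D C)) :=
  cohnLift (@CohnData l E _ gV gE gS gVV gVE gEV gVS gSV gSE).

Let pairD x m : ((x, 0) : D C) + ((0, m) : D C) = (x, m).
Proof. by congr (_, _); [exact: addr0|exact: add0r]. Qed.
Let hom_sum3 (f : algHom (polyAlg (D C)) (D C)) x y z : f (x + (y + z)) = f x + (f y + f z).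
Proof. by rewrite !(linD (alg_funL f)). Qed.
Lemma fockHomotopy0 : compAlg (ev0 _) fockHomotopy = fock (@cVV l E).
Proof.
apply: cohn_ext => [v|e|e].
- rewrite /= cohnLiftV [RHS]cohnLiftV /= (linD (alg_funL (ev0 _))) !ev0_const.
  exact: pairD.
- rewrite /= cohnLiftE [RHS]cohnLiftE /= hom_sum3 !ev0_colv /= !ev0_const.
  by rewrite addr0; exact: pairD.
- rewrite /= cohnLiftS [RHS]cohnLiftS /= hom_sum3 !ev0_rowv /= !ev0_const.
  by rewrite addr0; exact: pairD.
Qed.

Let gV' v : polyAlg (matAlg C S) := turn s0 (bv v) (bv v) (cV l v).
Let gE' e : polyAlg (matAlg C S) := turn s0 (bv (src e)) (bv (rng e)) (cE l e).
Let gS' e : polyAlg (matAlg C S) := turn s0 (bv (rng e)) (bv (src e)) (cS l e).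
Let gVV' v w : gV' v ** gV' w = if v == w then gV' v else 0.
Proof.
have := cVV l v w; case: eqP => [<-|_] vw; last exact: turnM0.
by rewrite [LHS]turnM // vw.
Qed.
Let gVE' e : gV' (src e) ** gE' e = gE' e. Proof. by rewrite [LHS]turnM // cVE. Qed.
Let gEV' e : gE' e ** gV' (rng e) = gE' e. Proof. by rewrite [LHS]turnM // cEV. Qed.
Let gVS' e : gV' (rng e) ** gS' e = gS' e. Proof. by rewrite [LHS]turnM // cVS. Qed.
Let gSV' e : gS' e ** gV' (src e) = gS' e. Proof. by rewrite [LHS]turnM // cSV. Qed.
Let gSE' e f : gS' e ** gE' f = if e == f then gV' (rng e) else 0.
Proof.
have := cSE l e f; case: eqP => [<-|_] ef; last exact: turnM0.
by rewrite [LHS]turnM // ef.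
Qed.
(** Turns all indices [vpt v] to the base point at once, which connects [spread] to the corner
    embedding. *)
Definition cornerTurn : algHom C (polyAlg (matAlg C S)) :=
  cohnLift (@CohnData l E _ gV' gE' gS' gVV' gVE' gEV' gVS' gSV' gSE').

(* x |-> the sum over v and w of epsilon_(v,w) (x) v x w *)
Definition spread : algHom C (matAlg C S) := compAlg (ev0 _) cornerTurn.
Lemma spreadV v : spread (cV l v) = mE (bv v) (bv v) (cV l v).
Proof. by rewrite /= cohnLiftV ev0_turn. Qed.
Lemma spreadE e : spread (cE l e) = mE (bv (src e)) (bv (rng e)) (cE l e).
Proof. by rewrite /= cohnLiftE ev0_turn. Qed.
Lemma spreadS e : spread (cS l e) = mE (bv (rng e)) (bv (src e)) (cS l e).
Proof. by rewrite /= cohnLiftS ev0_turn. Qed.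
Lemma cornerTurn1 : compAlg (ev1 _) cornerTurn = matCorner C s0.
Proof.
apply: cohn_ext => [v|e|e] /=.
- by rewrite cohnLiftV ev1_turn.
- by rewrite cohnLiftE ev1_turn.
- by rewrite cohnLiftS ev1_turn.
Qed.

Lemma spread_baL0 x y : baL (act C) x (spread y) = 0.
Proof.
have L2 := baL_linr (act C) x.
move: y; apply: cohn_ind => [|y z Hy Hz|k' y Hy|w|e|e|w y Hy|e y Hy|e y Hy].
- by rewrite (lin0 (alg_funL _)) (lin0 L2).
- by rewrite (linD (alg_funL spread)) (linD L2) Hy Hz addr0.
- by rewrite (linZ (alg_funL spread)) (linZ L2) Hy scaler0.
- by rewrite spreadV cohnAction_baL0.
- by rewrite spreadE cohnAction_baL0.
- by rewrite spreadS cohnAction_baL0.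
- by rewrite alg_funM baL_mul spreadV cohnAction_baL0 amul0l.
- by rewrite alg_funM baL_mul spreadE cohnAction_baL0 amul0l.
- by rewrite alg_funM baL_mul spreadS cohnAction_baL0 amul0l.
Qed.
Lemma spread_baR0 x y : baR (act C) x (spread y) = 0.
Proof.
have L2 := baR_linr (act C) x.
move: y; apply: cohn_ind => [|y z Hy Hz|k' y Hy|w|e|e|w y Hy|e y Hy|e y Hy].
- by rewrite (lin0 (alg_funL _)) (lin0 L2).
- by rewrite (linD (alg_funL spread)) (linD L2) Hy Hz addr0.
- by rewrite (linZ (alg_funL spread)) (linZ L2) Hy scaler0.
- by rewrite spreadV cohnAction_baR0.
- by rewrite spreadE cohnAction_baR0.
- by rewrite spreadS cohnAction_baR0.
- by rewrite alg_funM baR_mul Hy amul0r.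
- by rewrite alg_funM baR_mul Hy amul0r.
- by rewrite alg_funM baR_mul Hy amul0r.
Qed.

Lemma sdSec_spread x y : sdSec (act C) x ** compAlg (sdIn (act C)) spread y = 0.
Proof.
rewrite sd_mulE /= spread_baL0 amul0r amul0l (lin0 (baR_lin (act C) _)) !addr0.
by [].
Qed.
Lemma spread_sdSec x y : compAlg (sdIn (act C)) spread x ** sdSec (act C) y = 0.
Proof.
rewrite sd_mulE /= spread_baR0 amul0r amul0l (lin0 (baL_lin (act C) _)) !addr0.
by [].
Qed.
Lemma fockHomotopy1 :
  compAlg (ev1 _) fockHomotopy = sumAlg sdSec_spread spread_sdSec.
Proof.
have hom_sum2 (f : algHom (polyAlg (D C)) (D C)) x y : f (x + y) = f x + f y.
  exact: linD (alg_funL f) _ _.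
apply: cohn_ext => [v|e|e].
- by rewrite /= cohnLiftV /= hom_sum2 !ev1_const cohnLiftV ev0_turn.
- by rewrite /= cohnLiftE /= hom_sum3 !ev1_colv /= !ev1_const add0r cohnLiftE ev0_turn.
- by rewrite /= cohnLiftS /= hom_sum3 !ev1_rowv /= !ev1_const add0r cohnLiftS ev0_turn.
Qed.
End FockHomotopy.

Section Isomorphism.
Variables (T : triCategory) (Y : excisiveTheory l T).
Hypotheses (Yh : homotopyInvariant Y) (Ys : matrixStable S Y).

Section Diagonal.
Variables (I : choiceType) (B : nuAlgType l) (p : I -> B) (b : I -> S).
Hypotheses (pM : forall i j, p i ** p j = if i == j then p i else 0) (bs0 : forall i, b i != s0).

Let tM i j : turn s0 (b i) (b i) (p i) ** turn s0 (b j) (b j) (p j) =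
  if i == j then turn s0 (b i) (b i) (p i) else 0.
Proof.
have := pM i j; case: eqP => [<-|_] ij; last exact: turnM0.
by rewrite turnM // ij.
Qed.
(** All diagonal positions turn to the base point simultaneously. The p i are orthogonal, so the
    turned idempotents stay orthogonal there, and b need not be injective. *)
Lemma hmap_diagonal (f : algHom (funAlg l I) B) (g : algHom (funAlg l I) (matAlg B S)) :
  (forall i, f (chi l i) = p i) -> (forall i, g (chi l i) = mE (b i) (b i) (p i)) ->
  hmap Y g = hmap Y (matCorner B s0) \oc hmap Y f.
Proof.
move=> fE gE; rewrite -hmap_comp; have := hmap_homotopy Yh (oidemHom tM).
have -> : compAlg (ev0 (matAlg B S)) (oidemHom tM) = g.
  by apply: fun_ext => i; rewrite compAlgE oidemHom_chi ev0_turn gE.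
have -> // : compAlg (ev1 (matAlg B S)) (oidemHom tM) = compAlg (matCorner B s0) f.
by apply: fun_ext => i; rewrite compAlgE oidemHom_chi ev1_turn compAlgE fE.
Qed.
End Diagonal.

Let mchiM (v w : vert E) : mE (bv v) (bv v) (chi l v) ** mE (bv w) (bv w) (chi l w) =
  if v == w then mE (bv v) (bv v) (chi l v) else 0.
Proof. by rewrite mEM bv_bv chiM; case: eqP => [<-|]. Qed.
Let diag : algHom A (matAlg A S) := oidemHom mchiM.
Let diagE v : diag (chi l v) = mE (bv v) (bv v) (chi l v).
Proof. exact: oidemHom_chi. Qed.

Let diag_baL0 x y : baL (act A) x (diag y) = 0.
Proof.
have L2 := baL_linr (act A) x.
move: y; apply: chi_ind => [|y z Hy Hz|k v].
- by rewrite (lin0 (alg_funL diag)) (lin0 L2).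
- by rewrite (linD (alg_funL diag)) (linD L2) Hy Hz addr0.
- by rewrite (linZ (alg_funL diag)) (linZ L2) diagE cohnAction_baL0 scaler0.
Qed.
Let diag_baR0 x y : baR (act A) x (diag y) = 0.
Proof.
have L2 := baR_linr (act A) x.
move: y; apply: chi_ind => [|y z Hy Hz|k v].
- by rewrite (lin0 (alg_funL diag)) (lin0 L2).
- by rewrite (linD (alg_funL diag)) (linD L2) Hy Hz addr0.
- by rewrite (linZ (alg_funL diag)) (linZ L2) diagE cohnAction_baR0 scaler0.
Qed.
Let phi : algHom A C := phiHom l E.
Let sec_diag x y : compAlg (sdSec (act A)) phi x ** compAlg (sdIn (act A)) diag y = 0.
Proof.
by rewrite sd_mulE [LHS]/= diag_baL0 amul0r amul0l (lin0 (baR_lin (act A) _)) !addr0.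
Qed.
Let diag_sec x y : compAlg (sdIn (act A)) diag x ** compAlg (sdSec (act A)) phi y = 0.
Proof.
by rewrite sd_mulE [LHS]/= diag_baR0 amul0r amul0l (lin0 (baL_lin (act A) _)) !addr0.
Qed.

Theorem phi_iso : isIso (hmap Y phi).
Proof.
pose fA := fock (@chiM l (vert E)).
(* The class of the quasi-homomorphism formed by the Fock representation with coefficients [chi l v]
   and by [sdSec]. *)
have [kappa kE] : exists kappa,
    hmap Y fA - hmap Y (sdSec (act A)) = hmap Y (sdIn (act A)) \oc kappa.
  apply: sdIn_factor; rewrite compmB -!hmap_comp.
  have -> : compAlg (sdProj (act A)) fA = idAlg C.
    apply: cohn_ext => [v|e|e] /=; by rewrite ?cohnLiftV ?cohnLiftE ?cohnLiftS.
  have -> : compAlg (sdProj (act A)) (sdSec (act A)) = idAlg C by exact: algHomP.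
  by rewrite subrr.
(* On the vertices the two representations differ by the projections onto the trivial paths, a
   diagonal matrix. *)
have k1 : kappa \oc hmap Y phi = hmap Y (matCorner A s0).
  have <- : hmap Y diag = hmap Y (matCorner A s0).
    rewrite (@hmap_diagonal (vert E) A (chi l (I:=vert E)) bv (@chiM l (vert E)) bv_s0
      (idAlg A) diag) //.
      by rewrite hmap1 compm1.
  apply: (@sdIn_monic _ _ Y _ _ (act A)); rewrite compA -kE compDl compNm -!hmap_comp.
  have -> : compAlg fA phi = sumAlg sec_diag diag_sec.
    apply: fun_ext => v; rewrite compAlgE oidemHom_chi cohnLiftV /= -[dlift _ _]/(phi (chi l v)).
    rewrite -[dlift _ _]/(diag (chi l v)) diagE oidemHom_chi.
    by congr (_, _); [exact: esym (addr0 _)|exact: esym (add0r _)].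
  by rewrite hmap_sum !hmap_comp [X in X - _]addrC addrK.
(* After extending coefficients along phi, the Fock representation is homotopic to [sdSec] plus
   [spread], and the latter to the corner. *)
have k2 : hmap Y (matMap S phi) \oc kappa = hmap Y (matCorner C s0).
  apply: (@sdIn_monic _ _ Y _ _ (act C)); rewrite compA -hmap_comp.
  have -> : compAlg (sdIn (act C)) (matMap S phi) = compAlg (sdMap phi) (sdIn (act A)).
    exact: algHomP.
  rewrite hmap_comp -compA -kE compmB -!hmap_comp.
  have -> : compAlg (sdMap phi) fA = compAlg (ev0 _) fockHomotopy.
    rewrite fockHomotopy0; apply: cohn_ext => [v|e|e].
    - by rewrite [LHS]/= !cohnLiftV /= matMapE oidemHom_chi.
    - by rewrite [LHS]/= !cohnLiftE /= matMapE oidemHom_chi.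
    - by rewrite [LHS]/= !cohnLiftS /= matMapE oidemHom_chi.
  have -> : compAlg (sdMap phi) (sdSec (act A)) = sdSec (act C).
    apply: algHomP => x; change ((x, matMap S phi 0) = (x, 0) :> D C).
    by rewrite (lin0 (alg_funL (matMap S phi))).
  rewrite (hmap_homotopy Yh) fockHomotopy1 hmap_sum hmap_comp [X in X - _]addrC addrK.
rewrite [RHS]hmap_comp; congr (_ \oc _); rewrite -cornerTurn1; exact: hmap_homotopy.
apply: (@iso_split _ _ _ _ (invm (hmap Y (matCorner A s0)) \oc kappa)
  (invm (hmap Y (matCorner A s0)) \oc kappa)).
  by rewrite -compA k1 (invP (Ys A s0)).1.
apply: (iso_monic (Ys C s0)).
rewrite compA -hmap_comp -[compAlg (matCorner C s0) phi]matMap_corner hmap_comp.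
by rewrite -compA invmKV // k2 compm1.
Qed.
End Isomorphism.
End VertexInclusion.

(** * The ideal K(E) *)

Section CuntzKrieger.
Variables (l : comPzRingType) (E : graph).
Local Notation C := (cohn l E).
Local Notation V := (cV l).
Local Notation Ed := (cE l).
Local Notation St := (cS l).
Local Notation q := (qv l).
Implicit Types (v w : vert E) (e f : edge E) (a b : seq (edge E)).

Lemma qsum_reg v : reg E v -> qsum l v = \sum_(e <- fset_set (out v)) Ed e ** St e.
Proof. by move=> [fin _]; rewrite /qsum fsbig_finite. Qed.
Lemma mem_out v e : reg E v -> (e \in fset_set (out v)) = (src e == v).
Proof.
move=> [fin _]; rewrite in_fset_set //.
by apply/idP/eqP => [/set_mem|ev]; last exact: mem_set.
Qed.
Lemma qsumE v e : reg E v -> qsum l v ** Ed e = if src e == v then Ed e else 0.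
Proof.
move=> rv; rewrite qsum_reg // [LHS](lin_sum (amul_linear_l (Ed e))).
have [ev|ev] := eqVneq (src e) v; last first.
  rewrite big1_seq // => f /andP[_]; rewrite mem_out // => /eqP fv.
  by rewrite -amulA cSE; case: eqP => [fe|_]; [rewrite -fe fv eqxx in ev|exact: amul0r].
rewrite (bigD1_seq e) /= ?mem_out ?ev ?fset_uniq // -amulA cSE eqxx cEV big1_seq ?addr0 //.
by move=> f /andP[/negPf fe _]; rewrite -amulA cSE fe amul0r.
Qed.
Lemma qsumS v e : reg E v -> St e ** qsum l v = if src e == v then St e else 0.
Proof.
move=> rv; rewrite qsum_reg // [LHS](lin_sum (amul_linear_r (St e))).
have [ev|ev] := eqVneq (src e) v; last first.
  rewrite big1_seq // => f /andP[_]; rewrite mem_out // => /eqP fv.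
  by rewrite amulA cSE; case: eqP => [fe|_]; [rewrite fe fv eqxx in ev|exact: amul0l].
rewrite (bigD1_seq e) /= ?mem_out ?ev ?fset_uniq // amulA cSE eqxx cVS big1_seq ?addr0 //.
by move=> f /andP[/negPf fe _]; rewrite amulA cSE eq_sym fe amul0l.
Qed.
Lemma cVE_if v e : V v ** Ed e = if src e == v then Ed e else 0.
Proof.
by rewrite -{1}(cVE l e) amulA cVV eq_sym; case: eqP => [<-|_]; rewrite ?cVE ?amul0l.
Qed.
Lemma cSV_if v e : St e ** V v = if src e == v then St e else 0.
Proof. by rewrite -{1}(cSV l e) -amulA cVV; case: eqP => [_|_]; rewrite ?cSV ?amul0r. Qed.
Lemma qE0 v e : reg E v -> q v ** Ed e = 0.
Proof. by move=> rv; rewrite /qv amulBl qsumE // cVE_if subrr. Qed.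
Lemma Sq0 v e : reg E v -> St e ** q v = 0.
Proof. by move=> rv; rewrite /qv amulBr qsumS // cSV_if subrr. Qed.
Lemma Vq v w : V v ** q w = if v == w then q w else 0.
Proof. by rewrite /qv amulBr cVV cVqsum; case: eqP => [<-|_]; rewrite ?subrr. Qed.
Lemma qV v w : q v ** V w = if v == w then q v else 0.
Proof. by rewrite /qv amulBl cVV qsumcV; case: eqP => _; rewrite ?subrr. Qed.

(** A path is a list of edges with its end v, which the empty list cannot record. *)
Definition start a v : vert E := if a is e :: _ then src e else v.
Fixpoint composable a v : bool :=
  if a is e :: a' then (rng e == start a' v) && composable a' v else true.
Fixpoint pathE a v : C := if a is e :: a' then Ed e ** pathE a' v else V v.
Fixpoint pathS a v : C := if a is e :: a' then pathS a' v ** St e else V v.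

Lemma cV_pathE w a v : V w ** pathE a v = if w == start a v then pathE a v else 0.
Proof.
case: a => [|e a] /=; first by rewrite cVV; case: eqP => // ->.
by rewrite amulA cVE_if eq_sym; case: eqP => // _; rewrite amul0l.
Qed.
Lemma pathS_cV w a v : pathS a v ** V w = if start a v == w then pathS a v else 0.
Proof.
case: a => [|e a] /=; first by rewrite cVV; case: eqP.
by rewrite -amulA cSV_if; case: eqP => // _; rewrite amul0r.
Qed.
Lemma cS_pathE e f a v : composable (f :: a) v ->
  St e ** pathE (f :: a) v = if e == f then pathE a v else 0.
Proof.
move=> /= /andP[fa _]; rewrite amulA cSE; case: eqP => [->|_]; last exact: amul0l.
by rewrite cV_pathE fa.
Qed.
Lemma pathS_cE e f a v : composable (f :: a) v ->
  pathS (f :: a) v ** Ed e = if f == e then pathS a v else 0.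
Proof.
move=> /= /andP[fa _]; rewrite -amulA cSE; case: eqP => [_|_]; last exact: amul0r.
by rewrite pathS_cV eq_sym fa.
Qed.
Lemma cE_pathE e a v : Ed e ** pathE a v = if rng e == start a v then pathE (e :: a) v else 0.
Proof.
rewrite -{1}(cEV l e) -amulA cV_pathE; case: eqP => // _.
exact: amul0r.
Qed.
Lemma pathS_cS e a v : pathS a v ** St e = if rng e == start a v then pathS (e :: a) v else 0.
Proof.
rewrite -{1}(cVS l e) amulA pathS_cV eq_sym; case: eqP => // _.
exact: amul0l.
Qed.

Let assoc5 (x y z t u : C) : x ** (y ** z) ** (t ** u) = x ** (y ** (z ** t) ** u).
Proof. by rewrite !amulA. Qed.
Let assoc4 (x y z t : C) : x ** (y ** z ** t) = x ** y ** (z ** t).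
Proof. by rewrite !amulA. Qed.
(** Equal leading edges cancel and different ones give 0. If one path runs out first, the remaining
    edge meets q_v or q_w, and q_v e = 0 = e^* q_w. *)
Lemma path_orth a v b w : reg E v -> reg E w -> composable a v -> composable b w ->
  q v ** pathS a v ** (pathE b w ** q w) = if (a == b) && (v == w) then q v else 0.
Proof.
move=> rv rw; elim: a b => [|e a IH] [|f b] ca cb.
- by rewrite eqxx [_ && _]/= /= Vq qV eqxx eqxx qvM.
- by rewrite [pathS _ _]/= qV eqxx !amulA qE0 // !amul0l.
- by rewrite [pathE _ _]/= Vq eqxx -!amulA Sq0 // !amul0r.
rewrite eqseq_cons [pathS _ _]/= assoc5 cS_pathE //; case: eqP => /= [ef|_].
  by move: ca cb => /= /andP[_ ca] /andP[_ cb]; rewrite -IH //; exact: assoc4.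
by rewrite amul0r amul0l amul0r.
Qed.

Definition rpath : choiceType :=
  {p : seq (edge E) * reg E | composable p.1 (set_val p.2)}.
Implicit Types (p r s : rpath).
Definition prange p : reg E := (val p).2.
Lemma prangeP p : reg E (set_val (prange p)). Proof. exact: set_valP. Qed.
Definition rpath0 (v : reg E) : rpath := Sub ([::], v) isT.

Definition ppair : choiceType := {x : rpath * rpath | prange x.1 == prange x.2}.
Definition ppair_op (x y : ppair) : option ppair :=
  if (val x).2 == (val y).1 then insub ((val x).1, (val y).2) else None.
Lemma ppair_op_some (x y : ppair) : (val x).2 = (val y).1 ->
  exists2 z, ppair_op x y = Some z & val z = ((val x).1, (val y).2).
Proof.
move=> xy; rewrite /ppair_op xy eqxx; case: insubP => [z _ zE|]; first by exists z.
by rewrite /= (eqP (valP x)) xy (valP y).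
Qed.
Lemma ppair_op_none (x y : ppair) : (val x).2 <> (val y).1 -> ppair_op x y = None.
Proof. by move=> /eqP/negPf; rewrite /ppair_op => ->. Qed.
Lemma ppair_opA (x y z : ppair) :
  obind (fun u => ppair_op u z) (ppair_op x y) = obind (ppair_op x) (ppair_op y z).
Proof.
have [xy|xy] := pselect ((val x).2 = (val y).1); last first.
  rewrite (ppair_op_none xy) /=; have [yz|yz] := pselect ((val y).2 = (val z).1); last first.
    by rewrite ppair_op_none.
  have [u -> uE] := ppair_op_some yz; rewrite /= ppair_op_none // uE.
  exact: xy.
have [u -> uE] := ppair_op_some xy; have [yz|yz] := pselect ((val y).2 = (val z).1); last first.
  by rewrite (ppair_op_none yz) /= ppair_op_none // uE.
have [t -> tE] := ppair_op_some yz; rewrite /=.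
have [|a -> aE] := @ppair_op_some u z; first by rewrite uE.
have [|b -> bE] := @ppair_op_some x t; first by rewrite tE.
by congr Some; apply: val_inj; rewrite aE bE uE tE.
Qed.
Definition ppairs : semigroup0 := Semigroup0 ppair_opA.
(* The direct sum over the regular vertices v of the matrix algebras indexed by the paths
   ending in v, which is isomorphic to K(E). *)
Definition pmat : nuAlgType l := sgAlg ppairs (l^o : nuAlgType l).
Definition pu (x : ppair) (c : l^o) : pmat := @sgd l ppairs l^o x c.

Definition pE p := pathE (val p).1 (set_val (prange p)).
Definition pS p := pathS (val p).1 (set_val (prange p)).
Definition pq p := q (set_val (prange p)).
Definition pelt p r : C := pE p ** pq p ** pS r.
Lemma rpath_orth p r : pq p ** pS p ** (pE r ** pq r) = if p == r then pq p else 0.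
Proof.
have e : ((val p).1 == (val r).1) && (set_val (prange p) == set_val (prange r)) = (p == r).
  apply/andP/eqP => [[/eqP e1 /eqP e2]|->]; last by rewrite !eqxx.
  by apply: val_inj; apply: injective_projections => //; exact: val_inj.
rewrite -e; apply: path_orth; [exact: prangeP|exact: prangeP|exact: (valP p)|exact: (valP r)].
Qed.
Lemma pq_same p r : prange p = prange r -> pq p = pq r.
Proof. by rewrite /pq => ->. Qed.

Let mpsi (x : ppairs) (c : l^o) : C := (c : l) *: pelt (val x).1 (val x).2.
Let mpsiL x : linear (mpsi x).
Proof. by move=> c y z; rewrite /mpsi scalerDl scalerA. Qed.
Let mpsiM x y (c d : l^o) :
  mpsi x c ** mpsi y d = if sg_op x y is Some z then mpsi z (c ** d) else 0.
Proof.
rewrite /mpsi amulZl amulZr scalerA /pelt.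
have ex : pq (val x).1 = pq (val x).2 by apply: pq_same; exact/eqP/(valP x).
have e1 : pq (val x).1 ** pq (val x).1 = pq (val x).1 by rewrite /pq qvM eqxx.
have -> : pE (val x).1 ** pq (val x).1 ** pS (val x).2 **
    (pE (val y).1 ** pq (val y).1 ** pS (val y).2) =
  pE (val x).1 ** (pq (val x).2 ** pS (val x).2 ** (pE (val y).1 ** pq (val y).1)) ** pS (val y).2.
  by rewrite ex !amulA.
rewrite rpath_orth; case: eqP => xy; last by rewrite /= (ppair_op_none xy) amul0r amul0l scaler0.
by have [z /= -> ->] := ppair_op_some xy; rewrite -ex.
Qed.
Definition psiC : algHom pmat C := sgLift mpsiL mpsiM.
Lemma psiCE x c : psiC (pu x c) = (c : l) *: pelt (val x).1 (val x).2.
Proof. exact: (sgLiftE mpsiL). Qed.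

Lemma psiC_ck (m : pmat) : ck_ideal l E (psiC m).
Proof.
move: m; apply: sg_ind => [|m n Hm Hn|x c].
- by rewrite (lin0 (alg_funL psiC)); exact: sub0.
- by rewrite (linD (alg_funL psiC)); exact: subD.
rewrite psiCE; apply: subZ; rewrite /pelt; apply: idealMr; apply: idealMl.
by apply: idealGen_incl; exists (set_val (prange (val x).1)) => //; exact: prangeP.
Qed.

Lemma psiC_pelt a b (v : reg E) : composable a (set_val v) -> composable b (set_val v) ->
  exists m, psiC m = pathE a (set_val v) ** q (set_val v) ** pathS b (set_val v).
Proof.
move=> ca cb; pose p : rpath := Sub (a, v) ca; pose r : rpath := Sub (b, v) cb.
have pr : prange p == prange r by [].
by exists (pu (Sub (p, r) pr) 1); rewrite psiCE scale1r.
Qed.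

Let J0 : exists m, psiC m = 0.
Proof. by exists 0; exact: (lin0 (alg_funL psiC)). Qed.
Let JP (k : l) x y : (exists m, psiC m = x) -> (exists m, psiC m = y) ->
  exists m, psiC m = k *: x + y.
Proof. by move=> [m <-] [n <-]; exists (k *: m + n); exact: (alg_funL psiC). Qed.
Let JD x y : (exists m, psiC m = x) -> (exists m, psiC m = y) -> exists m, psiC m = x + y.
Proof. by move=> hx hy; have := JP 1 hx hy; rewrite scale1r. Qed.
Let JZ (k : l) x : (exists m, psiC m = x) -> exists m, psiC m = k *: x.
Proof. by move=> hx; have := JP k hx J0; rewrite addr0. Qed.

Let J_gen (F : C -> C) : linear F ->
  (forall a b (v : reg E), composable a (set_val v) -> composable b (set_val v) ->
     exists m, psiC m = F (pathE a (set_val v) ** q (set_val v) ** pathS b (set_val v))) ->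
  forall x, (exists m, psiC m = x) -> exists m, psiC m = F x.
Proof.
move=> FL Fp _ [m <-]; move: m; apply: sg_ind => [|m n [m' mE] [n' nE]|x c].
- by rewrite (lin0 (alg_funL psiC)) (lin0 FL).
- by exists (m' + n'); rewrite !(linD (alg_funL psiC)) mE nE (linD FL).
have [p r] : rpath * rpath by exact: (val x).
rewrite psiCE (linZ FL); apply: JZ; rewrite /pelt /pE /pS /pq -(eqP (valP x)).
apply: Fp; first exact: (valP (val x).1).
by rewrite (eqP (valP x)); exact: (valP (val x).2).
Qed.

Let JMl y x : (exists m, psiC m = x) -> exists m, psiC m = y ** x.
Proof.
have JV u z : (exists m, psiC m = z) -> exists m, psiC m = V u ** z.
  apply: (@J_gen (fun z => V u ** z)); first exact: amul_linear_r.
  move=> a b v ca cb; rewrite !amulA cV_pathE; case: eqP => _; first exact: psiC_pelt.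
  by rewrite !amul0l.
have JE e z : (exists m, psiC m = z) -> exists m, psiC m = Ed e ** z.
  apply: (@J_gen (fun z => Ed e ** z)); first exact: amul_linear_r.
  move=> a b v ca cb; rewrite 2!amulA cE_pathE; case: eqP => ea; last by rewrite !amul0l.
  by apply: psiC_pelt => //=; rewrite ea eqxx.
have JS e z : (exists m, psiC m = z) -> exists m, psiC m = St e ** z.
  apply: (@J_gen (fun z => St e ** z)); first exact: amul_linear_r.
  move=> [|f a] b v ca cb; rewrite 2!amulA.
    by rewrite -(amulA (St e)) /= Vq eqxx Sq0 ?amul0l //; exact: set_valP.
  rewrite cS_pathE //; case: eqP => _; last by rewrite !amul0l.
  by apply: psiC_pelt => //; case/andP: ca.
move: y x; apply: cohn_ind =>
  // [x _|y z Hy Hz x Hx|k y Hy x Hx|u y Hy x Hx|e y Hy x Hx|e y Hy x Hx].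
- by rewrite amul0l.
- by rewrite amulDl; apply: JD; [exact: Hy|exact: Hz].
- by rewrite amulZl; apply: JZ; exact: Hy.
- by rewrite -amulA; apply: JV; exact: Hy.
- by rewrite -amulA; apply: JE; exact: Hy.
- by rewrite -amulA; apply: JS; exact: Hy.
Qed.
Let JMr y x : (exists m, psiC m = x) -> exists m, psiC m = x ** y.
Proof.
have JV u z : (exists m, psiC m = z) -> exists m, psiC m = z ** V u.
  apply: (@J_gen (fun z => z ** V u)); first exact: amul_linear_l.
  move=> a b v ca cb; rewrite -amulA pathS_cV; case: eqP => _; first exact: psiC_pelt.
  by rewrite amul0r.
have JS e z : (exists m, psiC m = z) -> exists m, psiC m = z ** St e.
  apply: (@J_gen (fun z => z ** St e)); first exact: amul_linear_l.
  move=> a b v ca cb; rewrite -amulA pathS_cS; case: eqP => ea; last by rewrite amul0r.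
  by apply: psiC_pelt => //=; rewrite ea eqxx.
have JE e z : (exists m, psiC m = z) -> exists m, psiC m = z ** Ed e.
  apply: (@J_gen (fun z => z ** Ed e)); first exact: amul_linear_l.
  move=> a [|f b] v ca cb.
    rewrite [pathS _ _]/= -(amulA (pathE _ _)) qV eqxx -amulA qE0 ?amul0r //; exact: set_valP.
  rewrite -amulA pathS_cE //; case: eqP => _; last by rewrite amul0r.
  by apply: psiC_pelt => //; case/andP: cb.
move: y x; apply: cohn_ind =>
  // [x _|y z Hy Hz x Hx|k y Hy x Hx|u y Hy x Hx|e y Hy x Hx|e y Hy x Hx].
- by rewrite amul0r.
- by rewrite amulDr; apply: JD; [exact: Hy|exact: Hz].
- by rewrite amulZr; apply: JZ; exact: Hy.
- by rewrite amulA; apply: Hy; exact: JV.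
- by rewrite amulA; apply: Hy; exact: JE.
- by rewrite amulA; apply: Hy; exact: JS.
Qed.

(** Generators lengthen, shorten or kill the paths in a q_v b^* on either side, so the image of
    [psiC] is an ideal, and it contains every q_v. *)
Lemma psiC_surj x : ck_ideal l E x -> exists m, psiC m = x.
Proof.
pose J : ideal C := @Ideal l C (@Submodule l C (fun x => exists m, psiC m = x) J0 JP) JMl JMr.
move/(_ J); apply => _ [v rv ->]; pose v' : reg E := SigSub (mem_set rv).
have [m mE] := @psiC_pelt [::] [::] v' isT isT.
by exists m; rewrite mE /= Vq eqxx qV eqxx.
Qed.

Section Fock.
Variables (S : choiceType) (c : codeDom E S -> S) (c_inj : injective c).
Local Notation b0 := (branching0 c_inj).
Let Lf := baL (@cohnAction l E S b0 (l^o : nuAlgType l)).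

Definition pointOf a v : S := foldr (opt c) (vpt c v) a.
Definition point p : S := pointOf (val p).1 (set_val (prange p)).

Lemma pointOf_inj a v b w : pointOf a v = pointOf b w -> a = b /\ v = w.
Proof.
elim: a b => [|e a IH] [|f b] /= => [/(vpt_inj c_inj)//|/c_inj //|/c_inj //|].
by case/(opt_inj c_inj) => -> /IH[-> ->].
Qed.
Lemma point_inj : injective point.
Proof.
move=> p r /pointOf_inj[e1 e2]; apply: val_inj; apply: injective_projections => //.
exact: val_inj.
Qed.
Lemma lab0_pointOf a v : lab0 c (pointOf a v) = Some (start a v).
Proof. by case: a => [|e a]; rewrite /lab0 /= codeK. Qed.

Lemma fock_pathE a v t x : composable a v ->
  Lf (pathE a v) (mE (vpt c v) t x) = mE (pointOf a v) t x.
Proof.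
elim: a => [|e a IH] /= ca.
  rewrite /Lf cohnAction_LV rowMapE /actV /=.
  by rewrite (lab0_pointOf [::] v) /= eqxx.
case/andP: ca => ea ca; rewrite /Lf baLM [baL _ _ (mE _ _ _)]IH //.
by rewrite cohnAction_LE rowMapE /actE /= lab0_pointOf (eqP ea) eqxx.
Qed.
Lemma fock_q v t x : reg E v -> Lf (q v) (mE (vpt c v) t x) = mE (vpt c v) t x.
Proof.
move=> rv; have L1 := baL_lin (@cohnAction l E S b0 (l^o : nuAlgType l)) (mE (vpt c v) t x).
rewrite /Lf /qv (linB L1) qsum_reg // (lin_sum L1) big1 ?subr0 => [|e _].
  exact: (@fock_pathE [::] v).
rewrite baLM cohnAction_LS rowMapE.
case s: (actS _ _ _) => [u|]; first by have [_ /c_inj] := (actSP _ _ _ _).1 s.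
exact: (lin0 (baL_linr _ _)).
Qed.
(** In the Fock representation the operator p q_v r^* is a matrix unit: it takes the path r to p and
    kills the other paths of this kind. *)
Lemma fock_pelt p r s t x : prange p = prange r ->
  Lf (pelt p r) (mE (point s) t x) = if r == s then mE (point p) t x else 0.
Proof.
move=> pr; have E1 u u' : prange u = prange u' ->
    Lf (pE u ** pq u') (mE (vpt c (set_val (prange u'))) t x) = mE (point u) t x.
  move=> uu; rewrite /Lf baLM [baL _ (pq u') _]fock_q; last exact: prangeP.
  by rewrite -uu; apply: fock_pathE; exact: (valP u).
rewrite -(E1 s s erefl) /Lf -baLM /pelt.
have -> : pE p ** pq p ** pS r ** (pE s ** pq s) = pE p ** (pq r ** pS r ** (pE s ** pq s)).
  by rewrite (pq_same pr) !amulA.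
rewrite rpath_orth; case: eqP => [<-|_]; first exact: E1.
by rewrite amul0r (lin0 (baL_lin _ _)).
Qed.

Lemma mE_coef (s t u w : S) (x : l^o) :
  (mE s t x : matAlg (l^o : nuAlgType l) S) (u, w) = if (s, t) == (u, w) then x else 0.
Proof.
by case: eqP => [[<- <-]|/eqP ne]; [exact: dinj_id|exact: dinj_neq].
Qed.
(** Each coefficient of m is an entry of the operator of [psiC m], whence injectivity. The column
    [basept c] is arbitrary, as left operators do not move columns. *)
Lemma fock_coef (m : pmat) (x : ppair) :
  Lf (psiC m) (mE (point (val x).2) (basept c) (1 : l^o)) (point (val x).1, basept c) = m x.
Proof.
move: m; apply: sg_ind => [|m n Hm Hn|y k].
- rewrite (lin0 (alg_funL psiC)) /Lf.
  by rewrite (lin0 (baL_lin (@cohnAction l E S b0 (l^o : nuAlgType l)) _)).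
- rewrite (linD (alg_funL psiC)) /Lf.
  rewrite (linD (baL_lin (@cohnAction l E S b0 (l^o : nuAlgType l)) _)).
  by rewrite [LHS]dsumDE [RHS]dsumDE -Hm -Hn.
rewrite psiCE /Lf (linZ (baL_lin (@cohnAction l E S b0 (l^o : nuAlgType l)) _)).
rewrite [baL _ _ _]fock_pelt; last exact/eqP/(valP y).
rewrite [LHS]dsumZE; have [<-|xy] := eqVneq y x.
  by rewrite eqxx mE_coef eqxx [RHS]dinj_id; exact: mulr1.
rewrite [RHS]dinj_neq //; case: eqP => [e2|_]; last exact: scaler0.
rewrite mE_coef; case: eqP => [[/point_inj e1]|_]; last exact: scaler0.
case/eqP: xy; apply: val_inj.
by rewrite [val y]surjective_pairing [val x]surjective_pairing e1 e2.
Qed.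
Lemma psiC_inj m n : psiC m = psiC n -> m = n.
Proof. by move=> mn; apply: dsumP => x; rewrite -!fock_coef mn. Qed.
End Fock.
End CuntzKrieger.

Section AlgIso.
Variables (l : comPzRingType) (A B : nuAlgType l) (f : algHom A B).
Hypotheses (fi : injective f) (fs : forall b, exists a, f a = b).

Lemma hmap_bij (T : triCategory) (Y : excisiveTheory l T) : isIso (hmap Y f).
Proof.
have /choice[g gK] := fs.
have gL : linear g by move=> k x y; apply: fi; rewrite (alg_funL f) !gK.
have gM : {morph g : x y / x ** y} by move=> x y; apply: fi; rewrite alg_funM !gK.
exists (hmap Y (AlgHom gL gM)); split; rewrite -hmap_comp -hmap1; congr hmap; apply: algHomP => x.
  by apply: fi; rewrite compAlgE gK.
by rewrite compAlgE [LHS]gK.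
Qed.
End AlgIso.

Section IdealInclusion.
Variables (l : comPzRingType) (E : graph) (S : choiceType).
Variables (c : codeDom E S -> S) (c_inj : injective c).
Local Notation P := (pmat l E).
Local Notation K := (ckAlg l E).
Local Notation A := (funAlg l (reg E)).
Local Notation s0 := (basept c).
Local Notation pt := (point c).
Implicit Types (p r : rpath E) (x y : ppair E).

Let psi_fun (m : P) : K := IdealElt (introT (sub_predP _ _) (psiC_ck m)).
Let psiL : linear psi_fun.
Proof. by move=> k m n; apply: val_inj; exact: (alg_funL (psiC l E)). Qed.
Let psiM : {morph psi_fun : m n / m ** n}.
Proof. by move=> m n; apply: val_inj; exact: (alg_funM (psiC l E)). Qed.
Definition psi : algHom P K := AlgHom psiL psiM.

Lemma psi_bij : injective psi /\ forall k, exists m, psi m = k.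
Proof.
split=> [m n /(congr1 (@ival _ _ _)) mn|k]; first exact: (psiC_inj c_inj mn).
have [m mk] := psiC_surj (ivalP k).
by exists m; apply: val_inj.
Qed.

Let vv_subproof (v : reg E) : prange (rpath0 v) == prange (rpath0 v). Proof. by []. Qed.
Definition vpair (v : reg E) : ppair E := Sub (rpath0 v, rpath0 v) (vv_subproof v).

Lemma pu_linear x : linear (@pu l E x). Proof. exact: sgd_linear. Qed.
Lemma puM x y (a b : l^o) : pu x a ** pu y b =
  if ppair_op x y is Some z then pu z (a ** b) else 0.
Proof. exact: sgdM. Qed.

Let puvM (v w : reg E) : pu (vpair v) (1 : l^o) ** pu (vpair w) (1 : l^o) =
  if v == w then pu (vpair v) (1 : l^o) else 0.
Proof.
rewrite puM; case: eqP => [<-|vw].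
  have [z -> zE] := @ppair_op_some E (vpair v) (vpair v) erefl.
  by have -> : z = vpair v; [exact: val_inj|congr pu; exact: mulr1].
by rewrite ppair_op_none // => /(congr1 (@prange E)).
Qed.
Let qq : algHom A P := oidemHom puvM.

Lemma psi_qq : compAlg psi qq = qHom l E.
Proof.
apply: fun_ext => v; rewrite compAlgE oidemHom_chi [RHS]oidemHom_chi.
apply: val_inj; change (psiC l E (pu (vpair v) 1) = qv l (set_val v)).
by rewrite psiCE scale1r /pelt /pE /pS /pq /= Vq eqxx qV eqxx.
Qed.

(** Collects the matrix blocks of all regular vertices in one matrix algebra; the coefficient chi_v
    remembers the vertex to which a block belongs. *)
Let mg (x : ppairs E) (a : l^o) : matAlg A S :=
  mE (pt (val x).1) (pt (val x).2) ((a : l) *: chi l (prange (val x).1)).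
Let mgL (x : ppairs E) : linear (mg x).
Proof. by move=> k a b; rewrite /mg -mE_linear scalerDl scalerA. Qed.
Let mgM (x y : ppairs E) (a b : l^o) :
  mg x a ** mg y b = if sg_op x y is Some z then mg z (a ** b) else 0.
Proof.
rewrite /mg mEM (inj_eq (point_inj c_inj)); case: eqP => xy.
  have [z /= -> ->] := ppair_op_some xy.
  by rewrite amulZl amulZr scalerA (eqP (valP x)) xy chiM eqxx.
by rewrite /= ppair_op_none.
Qed.
Let g : algHom P (matAlg A S) := sgLift mgL mgM.
Let gE (x : ppairs E) a : g (pu x a) = mg x a. Proof. exact: (sgLiftE mgL). Qed.

Section Theory.
Variables (T : triCategory) (Y : excisiveTheory l T).
Hypotheses (Yh : homotopyInvariant Y) (Ys : matrixStable S Y).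
Variables (t : S) (st : s0 != t).

Let g_qq_iso : isIso (hmap Y g \oc hmap Y qq).
Proof.
rewrite -hmap_comp.
rewrite (@hmap_diagonal l E S c T Y Yh _ A (chi l (I:=reg E)) (fun v => pt (rpath0 v)) (@chiM l _) _
  (idAlg A)) //; first by rewrite hmap1 compm1; exact: Ys.
  by move=> v; apply/eqP => /c_inj.
by move=> v; rewrite compAlgE oidemHom_chi gE /mg scale1r.
Qed.

(** For [false] the path p is stored in the matrix index and the coefficient keeps the trivial path;
    for [true] the index is the base point and p sits in the coefficient. The diagonal blocks are
    thus [matMap S qq] after g, and the corner embedding. *)
Let left_pt (i : bool) p := if i then s0 else pt p.
Let left_path (i : bool) p := if i then p else rpath0 (prange p).
Let ppath_subproof (i j : bool) x :
  prange (left_path i (val x).1) == prange (left_path j (val x).2).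
Proof. by case: i j => [] []; exact: (valP x). Qed.
Let ppath i j x : ppair E :=
  Sub (left_path i (val x).1, left_path j (val x).2) (ppath_subproof i j x).
Let mPhi i j (x : ppairs E) (a : l^o) : matAlg P S :=
  mE (left_pt i (val x).1) (left_pt j (val x).2) (pu (ppath i j x) a).
Let mPhiL i j (x : ppairs E) : linear (mPhi i j x).
Proof. by move=> k a b; rewrite /mPhi pu_linear mE_linear. Qed.
Let Phi i j : P -> matAlg P S := dlift (mPhi i j).
Let PhiL i j : linear (Phi i j). Proof. exact: (dlift_linear (mPhiL i j)). Qed.
Let PhiE i j (x : ppairs E) a : Phi i j (pu x a) = mPhi i j x a.
Proof. exact: (dlift_inj (mPhiL i j)). Qed.

Let PhiM i j k m n : Phi i j m ** Phi j k n = Phi i k (m ** n).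
Proof.
move: m; apply: sg_ext => [d m m'|d m m'|x a].
- by rewrite PhiL amulDl amulZl.
- by rewrite amulDl amulZl PhiL.
move: n; apply: sg_ext => [d n n'|d n n'|y b].
- by rewrite PhiL amulDr amulZr.
- by rewrite amulDr amulZr PhiL.
rewrite -!/(pu _ _) puM !PhiE /mPhi mEM.
have [xy|xy] := pselect ((val x).2 = (val y).1).
  have [z -> zE] := ppair_op_some xy.
  rewrite {1}xy eqxx puM PhiE /mPhi zE /=.
  have [|u -> uE] := @ppair_op_some E (ppath i j x) (ppath j k y); first by rewrite /= xy.
  congr (mE _ _ (pu _ _)); apply: val_inj; rewrite uE /= zE.
  by case: i j {u uE} => [] [].
rewrite (ppair_op_none xy) (lin0 (PhiL _ _)).
case: eqP => // e; rewrite puM ppair_op_none ?mE0 //= => e'.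
move: e e'; case: j => /= [_|e _]; first exact: xy.
by apply: xy; exact: (point_inj c_inj e).
Qed.

Let h_g_iso : isIso (hmap Y (matMap S qq) \oc hmap Y g).
Proof.
rewrite -hmap_comp.
rewrite (hmap_link Yh Ys st (Phi := Phi) PhiL PhiM (f := compAlg (matMap S qq) g)
  (g := matCorner P s0)); first exact: Ys.
  apply: sg_ext => [||x a]; [exact: alg_funL|exact: PhiL|].
  rewrite -/(pu x a) PhiE compAlgE gE /mg matMapE (linZ (alg_funL qq)) oidemHom_chi.
  rewrite /mPhi -(linZ (@pu_linear _)); congr (mE _ _ (pu _ _)); last exact: mulr1.
  by apply: val_inj; rewrite /= (eqP (valP x)).
apply: sg_ext => [||x a]; [exact: alg_funL|exact: PhiL|].
rewrite -/(pu x a) PhiE /mPhi /= -[LHS]/(mE s0 s0 (pu x a)); congr (mE _ _ (pu _ _)).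
by apply: val_inj; rewrite /= -surjective_pairing.
Qed.

Theorem q_iso : isIso (hmap Y (qHom l E)).
Proof.
rewrite -psi_qq hmap_comp; apply: iso_comp.
  by have [? ?] := psi_bij; exact: hmap_bij.
(* Two-out-of-six for [qq], g and [matMap S qq]. *)
exact: iso_2of6 g_qq_iso h_g_iso.
Qed.
End Theory.
End IdealInclusion.

(** * The linear splitting *)

Section FreeModule.
Variables (l : comPzRingType) (I : choiceType) (W : lmodType l) (F : I -> W).
Let m (i : I) (c : l^o) : W := (c : l) *: F i.
Let mL i : linear (m i).
Proof. by move=> c x y; rewrite /m scalerDl scalerA. Qed.
Definition freeMap : funAlg l I -> W := dlift m.
Lemma freeMap_linear : linear freeMap. Proof. exact: (dlift_linear mL). Qed.
Lemma freeMap_chi i : freeMap (chi l i) = F i.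
Proof. by rewrite [LHS](dlift_inj mL) /m scale1r. Qed.
End FreeModule.

Lemma chi_ext (l : comPzRingType) (I : choiceType) (W : lmodType l) (f g : funAlg l I -> W) :
  linear f -> linear g -> (forall i, f (chi l i) = g (chi l i)) -> f =1 g.
Proof.
move=> fL gL fg; apply: chi_ind => [|x y IH IH'|c i]; first by rewrite !lin0.
  by rewrite !linD // IH IH'.
by rewrite !linZ // fg.
Qed.

(* Choose one edge e_v out of each regular vertex v.  The Cohn algebra acts on the free
   module with basis the symbols [Some (a, v, b)], which stand for a v b^* with b written
   backwards, and [None], which stands for 1, subject to the rewriting rule
   e_v e_v^* = v - sum of the other e e^*.  Applying an element to [None] yields its
   normal form, and the normal form is zero on the ideal K(E). *)
Section NormalForm.
Variables (l : comPzRingType) (E : graph).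
Local Notation C := (cohn l E).
Local Notation K := (ck_ideal l E).
Local Notation V := (cV l).
Local Notation Ed := (cE l).
Local Notation St := (cS l).
Implicit Types (u v w : vert E) (e f g : edge E) (a b : seq (edge E)).

Definition nfIdx : choiceType := option (seq (edge E) * vert E * seq (edge E)).
Local Notation Z := (funAlg l nfIdx).
Definition zb a v b : Z := chi l (Some (a, v, b) : nfIdx).
Definition zstar : Z := chi l (None : nfIdx).

Definition chosen v : option (edge E) :=
  if pselect (reg E v) is left h then Some (projT1 (cid h.2)) else None.
Definition special e := chosen (src e) == Some e.
Lemma special_reg e : special e -> reg E (src e).
Proof. by rewrite /special /chosen; case: pselect. Qed.
Lemma special_exists v : reg E v -> exists2 e, special e & src e = v.
Proof.
move=> rv; case ce: (chosen v) => [e|]; last by move: ce; rewrite /chosen; case: pselect.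
have ev : src e = v.
  by move: ce; rewrite /chosen; case: pselect => // h [<-]; case: cid.
by exists e => //; rewrite /special ev ce.
Qed.
Lemma special_uniq e f : special e -> special f -> src e = src f -> e = f.
Proof. by move=> /eqP se /eqP sf ef; move: se; rewrite ef sf => -[]. Qed.

Definition others e b : Z :=
  \sum_(g <- fset_set (out (src e)) | g != e) zb [:: g] (rng g) (g :: b).

Definition opV w (i : nfIdx) : Z :=
  if i is Some (a, v, b) then (if start a v == w then zb a v b else 0) else zb [::] w [::].
Definition opE e (i : nfIdx) : Z :=
  match i with
  | None => zb [:: e] (rng e) [::]
  | Some (a, v, b) =>
      if start a v != rng e then 0
      else match a, b with
           | [::], f :: b' => if (f == e) && special e then zb [::] (src e) b' - others e b'
                              else zb [:: e] v b
           | _, _ => zb (e :: a) v b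
           end
  end.
Definition opS e (i : nfIdx) : Z :=
  match i with
  | None => zb [::] (rng e) [:: e]
  | Some (f :: a, v, b) => if (e == f) && (start a v == rng e) then zb a v b else 0
  | Some ([::], v, b) => if src e == v then zb [::] (rng e) (e :: b) else 0
  end.

Definition leftOp (F : nfIdx -> Z) : biend Z :=
  Biend (freeMap_linear F) (@zero_linear l Z Z).
Lemma leftOpE F i : bel (leftOp F) (chi l i) = F i. Proof. exact: freeMap_chi. Qed.
Let leftOpM F G H : (forall i, freeMap F (G i) = H i) -> leftOp F ** leftOp G = leftOp H.
Proof.
move=> FG; apply: biendP => [|x]; last by [].
apply: chi_ext => [||i]; try exact: bel_lin.
have -> : bel (leftOp F ** leftOp G) (chi l i) = freeMap F (freeMap G (chi l i)) by [].
by rewrite freeMap_chi FG leftOpE.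
Qed.
Let leftOp0 : leftOp (fun=> 0) = 0.
Proof.
apply: biendP => [|x]; last by [].
by apply: chi_ext => [||i]; [exact: bel_lin|exact: zero_linear|exact: leftOpE].
Qed.
Let opL0 (F : nfIdx -> Z) : freeMap F 0 = 0 :> Z. Proof. exact: (lin0 (freeMap_linear F)). Qed.
Let opLB (F : nfIdx -> Z) x y : freeMap F (x - y) = freeMap F x - freeMap F y :> Z.
Proof. exact: (linB (freeMap_linear F)). Qed.
Let opL_others (F : nfIdx -> Z) e b : freeMap F (others e b) =
  \sum_(g <- fset_set (out (src e)) | g != e) F (Some ([:: g], rng g, g :: b)) :> Z.
Proof.
rewrite /others -!(big_filter _ (fun g => g != e)) (lin_sum (freeMap_linear F)).
by apply: eq_bigr => g _; exact: freeMap_chi.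
Qed.
Let opL (F : nfIdx -> Z) a v b : freeMap F (zb a v b) = F (Some (a, v, b)) :> Z.
Proof. exact: freeMap_chi. Qed.

Let gV w := leftOp (opV w).
Let gE e := leftOp (opE e).
Let gS e := leftOp (opS e).
Let gVV v w : gV v ** gV w = if v == w then gV v else 0.
Proof.
have -> : (if v == w then gV v else 0) = leftOp (if v == w then opV v else fun=> 0).
  by case: eqP => // _; rewrite leftOp0.
apply: leftOpM => -[[[a u] b]|] /=; last first.
  by rewrite opL /= eq_sym; case: eqP => [->|].
case: eqP => [<-|uw]; first by rewrite opL /= eq_sym; case: eqP => [->|] //=; rewrite eqxx.
by rewrite opL0; case: eqP => //= ->; case: eqP.
Qed.
Let gVE e : gV (src e) ** gE e = gE e.
Proof.
apply: leftOpM => -[[[a u] b]|] /=; last by rewrite opL /= eqxx.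
case: eqP => /= _; last exact: opL0.
have E1 a' u' b' : freeMap (opV (src e)) (zb (e :: a') u' b') = zb (e :: a') u' b'.
  by rewrite opL /= eqxx.
case: a => [|f a]; last exact: E1.
case: b => [|f b]; first exact: E1.
case: ifP => [/andP[_ se]|_]; last exact: E1.
rewrite opLB opL /= eqxx opL_others /others; congr (_ - _).
rewrite big_seq_cond [RHS]big_seq_cond; apply: eq_bigr => g /andP[].
by rewrite mem_out /=; [move=> -> _|exact: special_reg].
Qed.
Let gEV e : gE e ** gV (rng e) = gE e.
Proof.
apply: leftOpM => -[[[a u] b]|] /=; last by rewrite opL /= eqxx.
by case: eqP => au /=; [rewrite opL /= au eqxx|exact: opL0].
Qed.
Let gVS e : gV (rng e) ** gS e = gS e.
Proof.
apply: leftOpM => -[[[[|f a] u] b]|] /=; last by rewrite opL /= eqxx.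
  by case: eqP => _; [rewrite opL /= eqxx|exact: opL0].
by case: ifP => [/andP[_ au]|_]; [rewrite opL /= au|exact: opL0].
Qed.
Let gSV e : gS e ** gV (src e) = gS e.
Proof.
apply: leftOpM => -[[[[|f a] u] b]|] /=; last by rewrite opL /= eqxx.
  by case: (eqVneq u (src e)) => [->|_]; [rewrite opL /= eqxx|exact: opL0].
case: eqP => [fe|fe]; first by rewrite opL.
by rewrite opL0; case: eqP => // ef; case: fe; rewrite ef.
Qed.
Let gSE e f : gS e ** gE f = if e == f then gV (rng e) else 0.
Proof.
have -> : (if e == f then gV (rng e) else 0) = leftOp (if e == f then opV (rng e) else fun=> 0).
  by case: eqP => // _; rewrite leftOp0.
have E1 a u b : start a u = rng f -> freeMap (opS e) (zb (f :: a) u b) =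
    (if e == f then opV (rng e) else fun=> 0) (Some (a, u, b)).
  move=> au; rewrite opL /= au; case: eqP => [->|_] //=.
  by rewrite au eqxx.
apply: leftOpM => -[[[a u] b]|]; last first.
  by rewrite opL /=; case: eqP => [->|_] //=; rewrite eqxx.
rewrite [opE _ _]/=; case: eqP => [au|au]; last first.
  by rewrite opL0; case: eqP => // ->; rewrite /=; case: eqP.
case: a au => [|h a] au; last exact: E1.
case: b => [|h b]; first exact: E1.
case: ifP => [/andP[/eqP -> sf]|_]; last exact: E1.
rewrite opLB opL /= opL_others.
have rf := special_reg sf.
have [ef|ef] := eqVneq e f.
  rewrite ef eqxx /= big1 ?subr0; last by move=> g gf; rewrite /= eq_sym (negbTE gf).
  by move: au => /= ->; rewrite eqxx.
have mem g : (g \in fset_set (out (src f))) = (src g == src f) by exact: mem_out.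
(* For e different from the chosen edge f but with the same source, the summand g = e of [others]
   cancels the contribution of the vertex, giving e^* f = 0. *)
case: eqP => esf.
  rewrite -big_filter (bigD1_seq e) /= ?filter_uniq ?fset_uniq ?mem_filter ?mem ?esf ?ef ?eqxx //=.
  rewrite big1 ?addr0 ?subrr // => g ge.
  by rewrite eq_sym (negbTE ge).
rewrite big1_seq ?subr0 // => g /andP[_]; rewrite mem => /eqP gf.
by rewrite /=; case: (e =P g) => // eg; case: esf; rewrite eg.
Qed.

Definition nfAction : algHom C (biend Z) :=
  cohnLift (@CohnData l E _ gV gE gS gVV gVE gEV gVS gSV gSE).
Definition nfAct (x : C) (z : Z) : Z := bel (nfAction x) z.
Lemma nfActV v i : nfAct (V v) (chi l i) = opV v i.
Proof. by rewrite /nfAct cohnLiftV leftOpE. Qed.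
Lemma nfActE e i : nfAct (Ed e) (chi l i) = opE e i.
Proof. by rewrite /nfAct cohnLiftE leftOpE. Qed.
Lemma nfActS e i : nfAct (St e) (chi l i) = opS e i.
Proof. by rewrite /nfAct cohnLiftS leftOpE. Qed.
Lemma nfAct_linear x : linear (nfAct x). Proof. exact: bel_lin. Qed.
Lemma nfAct_linear_l z : linear (nfAct^~ z).
Proof. by move=> k x y; rewrite /nfAct (alg_funL nfAction). Qed.
Lemma nfActM x y z : nfAct (x ** y) z = nfAct x (nfAct y z).
Proof. by rewrite /nfAct alg_funM. Qed.

(* The value of b^* for b written backwards. *)
Fixpoint wordS v b : C := if b is e :: b' then St e ** wordS (src e) b' else V v.
Definition nfVal (i : nfIdx) : C := if i is Some (a, v, b) then pathE l a v ** wordS v b else 0.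
Definition nfEval : Z -> C := freeMap nfVal.

Let nfEvalL : linear nfEval. Proof. exact: freeMap_linear. Qed.
Let nfEvalE a v b : nfEval (zb a v b) = pathE l a v ** wordS v b.
Proof. exact: freeMap_chi. Qed.
Let nfEval0 : nfEval 0 = 0. Proof. exact: (lin0 nfEvalL). Qed.
Let K0 : K 0. Proof. exact: sub0. Qed.

(* [F i] evaluates to [x] times the value of [i] modulo K(E); the symbol 1, which has no
   value in the Cohn algebra, is sent to [x] itself. *)
Let step x (F : nfIdx -> Z) :=
  forall i, K (nfEval (F i) - x ** nfVal i - (if i is None then x else 0)) /\ F i None = 0.

Lemma zb_None a v b : zb a v b None = 0.
Proof. exact: dinj_neq. Qed.

Let stepV w : step (V w) (opV w).
Proof.
move=> [[[a v] b]|]; rewrite /opV /nfVal.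
  rewrite subr0 amulA cV_pathE eq_sym; case: eqP => _; last first.
    by rewrite nfEval0 amul0l subrr.
  by rewrite nfEvalE subrr zb_None.
by rewrite amul0r subr0 nfEvalE zb_None /= cVV eqxx subrr.
Qed.
Let stepS e : step (St e) (opS e).
Proof.
move=> [[[[|f a] v] b]|]; rewrite /opS /nfVal.
- rewrite subr0 /= amulA cSV_if; case: eqP => [ev|_]; last first.
    by rewrite nfEval0 amul0l subrr.
  by rewrite nfEvalE zb_None /= amulA cVS ev subrr.
- rewrite subr0 [pathE _ _ _]/= !amulA cSE; case: eqP => [_|_] /=; last first.
    by rewrite nfEval0 !amul0l subrr.
  rewrite cV_pathE eq_sym; case: eqP => _; first by rewrite nfEvalE subrr zb_None.
  by rewrite nfEval0 !amul0l subrr.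
by rewrite amul0r subr0 nfEvalE zb_None /= amulA cVS cSV subrr.
Qed.
Let stepE e : step (Ed e) (opE e).
Proof.
move=> [[[a v] b]|]; last first.
  by rewrite /opE /nfVal amul0r subr0 nfEvalE zb_None /= cEV cEV subrr.
rewrite /nfVal subr0; have [av|av] := eqVneq (start a v) (rng e); last first.
  rewrite /opE (negbTE av) /= nfEval0 amulA cE_pathE eq_sym (negbTE av).
  by rewrite amul0l subrr.
have E1 : K (nfEval (zb (e :: a) v b) - Ed e ** (pathE l a v ** wordS v b)) /\
    zb (e :: a) v b None = 0.
  by rewrite nfEvalE zb_None /= amulA subrr.
rewrite /opE av eqxx /=; case: a av E1 => [|f a] av E1 //=.
case: b E1 => [|f b] E1 //; case: ifP => [/andP[/eqP fe se]|_] //.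
have re := special_reg se; rewrite {f}fe in E1 *; split; last first.
  rewrite [LHS]dsumDE zb_None add0r; apply/eqP; rewrite oppr_eq0 /others; apply/eqP.
  elim: (enum_fset _) => [|g s IH]; first by rewrite big_nil.
  by rewrite big_cons; case: ifP => _ //; rewrite dsumDE IH zb_None addr0.
(* The rewriting rule is the only operation that changes values, and the error is q_v b^* in
   K(E). *)
have -> : nfEval (zb [::] (src e) b - others e b) - Ed e ** (pathE l [::] v ** wordS v (e :: b)) =
    qv l (src e) ** wordS (src e) b.
  rewrite (linB nfEvalL) nfEvalE /others -big_filter (lin_sum nfEvalL) big_filter.
  rewrite /qv amulBl qsum_reg // (bigD1_seq e) ?fset_uniq ?mem_out // amulDl opprD addrA.
  rewrite [RHS]addrAC; congr (_ - _ - _); last first.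
    by have ve : v = rng e := av; rewrite /= ve (amulA (V _)) cVS amulA.
  rewrite -[LHS]big_filter -[X in _ = X ** _]big_filter [RHS](lin_sum (amul_linear_l _)).
  rewrite big_seq [RHS]big_seq; apply: eq_bigr => g.
  rewrite mem_filter mem_out // => /andP[_ /eqP ge].
  by rewrite nfEvalE /= cEV ge amulA.
by apply: igenMr; apply: (@idealGen_incl l C); exists (src e).
Qed.

Let stepP x F (xF : forall i, nfAct x (chi l i) = F i) : step x F ->
  forall z, K (nfEval (nfAct x z) - x ** nfEval z - (z None : l) *: x) /\ nfAct x z None = 0.
Proof.
move=> H.
have cL : linear (fun z : Z => (z None : l) *: x).
  by move=> k y z; rewrite dsumDE dsumZE scalerDl -scalerA.
have DL : linear (fun z => nfEval (nfAct x z) - x ** nfEval z - (z None : l) *: x).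
  apply: linear_add; last exact: opp_linear.
  apply: linear_add; first exact: (linear_comp nfEvalL (nfAct_linear x)).
  by apply: opp_linear; exact: (linear_comp (amul_linear_r x) nfEvalL).
apply: chi_ind => [|y z [Hy Ny] [Hz Nz]|k i].
- by split; [rewrite (lin0 DL)|rewrite (lin0 (nfAct_linear x))].
- split; first by rewrite (linD DL); exact: subD.
  by rewrite (linD (nfAct_linear x)) dsumDE Ny Nz addr0.
have [H1 H2] := H i; split; last by rewrite (linZ (nfAct_linear x)) dsumZE xF H2 scaler0.
rewrite (linZ DL); apply: subZ; rewrite xF [nfEval (chi _ _)]freeMap_chi.
have -> : (chi l i None : l) *: x = if i is None then x else 0; last exact: H1.
by case: i {H1 H2} => [i|]; [rewrite [X in X *: _]dinj_neq // scale0r|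
  rewrite [X in X *: _]dinj_id scale1r].
Qed.

Definition normalForm (x : C) : C := nfEval (nfAct x zstar).
Lemma normalForm_linear : linear normalForm.
Proof. exact: (linear_comp nfEvalL (nfAct_linear_l zstar)). Qed.

(** Each generator acts correctly modulo K(E) by [step], and after the first one the symbol 1 has
    coefficient 0, so the errors accumulate inside the ideal. *)
Lemma normalForm_congr x : K (normalForm x - x).
Proof.
suff [] : K (normalForm x - x) /\ nfAct x zstar None = 0 by [].
have L1 := nfAct_linear_l zstar.
have base y F (yF : forall i, nfAct y (chi l i) = F i) : step y F ->
    K (normalForm y - y) /\ nfAct y zstar None = 0.
  move=> /(stepP yF)/(_ zstar); rewrite [nfEval zstar]freeMap_chi amul0r subr0.
  by rewrite [zstar None]dinj_id scale1r.
have mul y z F (yF : forall i, nfAct y (chi l i) = F i) : step y F ->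
    K (normalForm z - z) /\ nfAct z zstar None = 0 ->
    K (normalForm (y ** z) - y ** z) /\ nfAct (y ** z) zstar None = 0.
  move=> /(stepP yF)/(_ (nfAct z zstar)) [H1 H2] [Kz z0]; rewrite nfActM; split=> //.
  move: H1; rewrite z0 scale0r subr0 => H1.
  have := subD H1 (idealMl y Kz); rewrite amulBr addrA subrK.
  by rewrite /normalForm nfActM.
move: x; apply: cohn_ind => [|x y [Hx Nx] [Hy Ny]|k x [Hx Nx]|v|e|e|v x Hx|e x Hx|e x Hx].
- by rewrite (lin0 normalForm_linear) subr0 (lin0 L1).
- rewrite (linD normalForm_linear) (linD L1) dsumDE Nx Ny addr0; split=> //.
  by rewrite opprD addrACA; exact: subD.
- rewrite (linZ normalForm_linear) (linZ L1) dsumZE Nx scaler0; split=> //.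
  by rewrite -scalerBr; exact: subZ.
- exact: (base _ _ (nfActV v) (stepV v)).
- exact: (base _ _ (nfActE e) (stepE e)).
- exact: (base _ _ (nfActS e) (stepS e)).
- exact: (mul _ _ _ (nfActV v) (stepV v)).
- exact: (mul _ _ _ (nfActE e) (stepE e)).
- exact: (mul _ _ _ (nfActS e) (stepS e)).
Qed.

Lemma nfAct_pathS b v : composable b v -> exists b', nfAct (pathS l b v) zstar = zb [::] v b'.
Proof.
have H b' : composable b v -> exists b2,
    nfAct (pathS l b v) (zb [::] (start b v) b') = zb [::] v b2.
  elim: b b' => [|e b IH] b' /=; first by exists b'; rewrite nfActV /= eqxx.
  move=> /andP[/eqP eb cb]; rewrite nfActM nfActS /= eqxx eb.
  exact: IH.
move=> cb; have [b2 e] := H [::] cb; exists b2; rewrite -e.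
have <- : nfAct (V (start b v)) zstar = zb [::] (start b v) [::] by exact: nfActV.
by rewrite -nfActM pathS_cV eqxx.
Qed.

(** The summand of the chosen edge is rewritten to v minus all other summands, so the full sum of
    the g g^* acts as v on this symbol. *)
Lemma nfAct_q v b : reg E v -> nfAct (qv l v) (zb [::] v b) = 0.
Proof.
move=> rv; have [e se ev] := special_exists rv.
have L1 := nfAct_linear_l (zb [::] v b).
rewrite /qv (linB L1) qsum_reg // (lin_sum L1) nfActV /= eqxx.
have ES g : src g = v -> nfAct (Ed g ** St g) (zb [::] v b) =
    if g == e then zb [::] v b - others e b else zb [:: g] (rng g) (g :: b).
  move=> gv; rewrite nfActM nfActS /= gv eqxx nfActE /= eqxx /= eqxx /=.
  have [->|ge] := eqVneq g e; first by rewrite se ev.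
  case: ifP => // sg; case/eqP: ge; apply: special_uniq => //.
  by rewrite gv ev.
rewrite (bigD1_seq e) /= ?mem_out ?ev ?fset_uniq // ES // eqxx.
suff -> : \sum_(g <- fset_set (out v) | g != e) nfAct (Ed g ** St g) (zb [::] v b) = others e b.
  by rewrite subrK subrr.
rewrite /others ev -[LHS]big_filter -[RHS]big_filter big_seq [RHS]big_seq.
apply: eq_bigr => g; rewrite mem_filter mem_out // => /andP[/negPf ge /eqP gv].
by rewrite ES // ge.
Qed.

(** K(E) is spanned by the a q_v b^*. Applied to the symbol 1, b^* yields a symbol with empty first
    path and vertex v, which q_v kills. *)
Lemma normalForm_ck x : K x -> normalForm x = 0.
Proof.
move=> /psiC_surj[m <-]; move: m; apply: sg_ext => [||y k].
- exact: (linear_comp normalForm_linear (alg_funL (psiC l E))).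
- exact: zero_linear.
rewrite -/(pu y k) psiCE (linZ normalForm_linear) /normalForm /pelt -amulA nfActM nfActM.
have [|b ->] := @nfAct_pathS (val (val y).2).1 (set_val (prange (val y).2)).
  exact: (valP (val y).2).
rewrite /pq -(eqP (valP y)) nfAct_q; last exact: prangeP.
by rewrite (lin0 (nfAct_linear _)) nfEval0 scaler0.
Qed.

Lemma leavitt_extension : isExtension (ckInc l E) (leavittProj l E).
Proof.
split=> [x y|x|].
- exact: val_inj.
- split=> [x0|[y ->]].
    have Kx : K x.
      by rewrite -[x]subr0; apply/quotPiP; rewrite [quotPi K x]x0 (lin0 (quotPi_linear K)).
    by exists (IdealElt (introT (sub_predP _ _) Kx)).
  rewrite -(lin0 (alg_funL (leavittProj l E))); apply/quotPiP.
  by rewrite subr0; exact: ivalP.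
(* Vanishing on K(E) lets the normal form descend to L(E); being congruent to the identity makes it
   a section. *)
pose n : {linear C -> C} := HB.pack normalForm
  (GRing.isLinear.Build l C C _ normalForm normalForm_linear).
have nK x : K x -> n x = 0 := @normalForm_ck x.
pose s : {linear leavitt l E -> C} := HB.pack (quotLift n)
  (GRing.isLinear.Build l (leavitt l E) C _ (quotLift n) (quotLift_linear nK)).
exists s => x; have [y <-] := quotPi_surj x.
rewrite [s _](quotLift_pi nK); apply/quotPiP; exact: normalForm_congr.
Qed.
End NormalForm.

(** * Encoding paths in the stabilizing set *)

Section Coding.
Variable E : graph.
Local Notation S := (stabSet E).

(** The four kinds of points are told apart as words of length at most two, which embed back into
    the set. *)
Lemma stabSet_coding : exists c : codeDom E S -> S, injective c.
Proof.
have [|f fi] := @seq_injection S; first by exists inr => m n [].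
pose k (x : codeDom E S) : seq S := match x with
  | None => [::]
  | Some (inl (inl v)) => [:: inl (inl v) : S]
  | Some (inl (inr e)) => [:: inl (inr e) : S]
  | Some (inr (e, s)) => [:: (inl (inr e) : S); s]
  end.
exists (f \o k) => x y /fi.
by case: x => [[[v|e]|[e s]]|]; case: y => [[[v'|e']|[e' s']]|] //=; congruence.
Qed.

Lemma stabSet_other (s : S) : exists t, s != t.
Proof.
by case: (eqVneq s (inr 0%N)) => [->|]; [exists (inr 1%N)|exists (inr 0%N)].
Qed.

Variables (l : comPzRingType) (T : triCategory) (Y : excisiveTheory l T).
Hypotheses (Yh : homotopyInvariant Y) (Ys : matrixStable S Y).

Lemma phiHom_iso : isIso (hmap Y (phiHom l E)).
Proof. by have [c ci] := stabSet_coding; refine (phi_iso ci Yh Ys). Qed.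
Lemma qHom_iso : isIso (hmap Y (qHom l E)).
Proof.
have [c ci] := stabSet_coding; have [t st] := stabSet_other (basept c).
exact: (q_iso ci Yh Ys st).
Qed.
End Coding.

(** * The algebra l^(I) (x) R as a sum of copies of R *)

Section Tensor.
Variables (l : comPzRingType) (R : nuAlgType l).

Lemma tens_mulE (A B : nuAlgType l) (a a' : A) (b b' : B) :
  (tens a b : tensAlg A B) ** (tens a' b' : tensAlg A B) = tens (a ** a') (b ** b').
Proof. exact: tensM_tens. Qed.

Section SumCopies.
Variable I : choiceType.
Local Notation D := (dsumAlg (fun _ : I => R)).
Local Notation A := (funAlg l I).

Let m (i : I) (r : R) : tensAlg A R := tens (chi l i) r.
Let mL i : linear (m i). Proof. exact: tens_linear_r. Qed.
Let f : D -> tensAlg A R := dlift m.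
Let fL : linear f. Proof. exact: (dlift_linear mL). Qed.
Let fE i r : f (dinj i r) = tens (chi l i) r. Proof. exact: (dlift_inj mL). Qed.
Let fM : {morph f : x y / x ** y}.
Proof.
move=> x y; move: x; apply: dsumAlg_ind => [|x x' IH IH'|i a].
- by rewrite amul0l (lin0 fL) amul0l.
- by rewrite amulDl !(linD fL) IH IH' amulDl.
move: y; apply: dsumAlg_ind => [|y y' IH IH'|j b].
- by rewrite amul0r (lin0 fL) amul0r.
- by rewrite amulDr !(linD fL) IH IH' amulDr.
rewrite !fE tens_mulE chiM; case: eqP => [<-|/eqP ij]; first by rewrite dinjM_id fE.
by rewrite dinjM_neq // (lin0 fL) tens0l.
Qed.
Definition sumCopies : algHom D (tensAlg A R) := AlgHom fL fM.
Lemma sumCopiesE i : compAlg sumCopies (dsumIn (fun _ : I => R) i) = chiTens R i.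
Proof. by apply: algHomP => r; exact: fE. Qed.

Lemma sumCopies_bij : injective sumCopies /\ forall u, exists x, sumCopies x = u.
Proof.
pose k (g : A) (r : R) : D := freeMap (fun i => dinj i r : D) g.
have kl r : linear (k^~ r) by exact: freeMap_linear.
have kr g : linear (k g).
  move=> c x y; move: g; apply: chi_ext => [||i]; first exact: freeMap_linear.
    by apply: linear_add; [apply: scale_linear|]; exact: freeMap_linear.
  by rewrite /k !freeMap_chi; exact: dinj_linear.
split.
  apply: (can_inj (g := tlift k)); apply: dsum_ext => [||i r].
  - exact: (linear_comp (tlift_linear kl kr) fL).
  - by [].
  by rewrite [sumCopies _]fE (tlift_tens kl kr) /k freeMap_chi.
have fD x y : sumCopies (x + y) = sumCopies x + sumCopies y := linD fL x y.
apply: tens_ind => [|u v [x <-] [y <-]|g r]; first by exists 0; exact: (lin0 fL).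
  by exists (x + y).
move: g; apply: chi_ind => [|g g' [x Hx] [y Hy]|c i].
- by exists 0; rewrite tens0l; exact: (lin0 fL).
- by exists (x + y); rewrite fD Hx Hy tensDl.
by exists (dinj i (c *: r)); rewrite [LHS]fE tensZr tensZl.
Qed.

Lemma sumCopies_iso (T : triCategory) (X : excisiveTheory l T) (U : choiceType)
    (X_add : additiveTheory U X) (small : exists f : I -> U, injective f)
    (P : T) (iota : I -> mor (X R) P) (hP : isDirectSum iota) :
  exists2 u : mor P (X (tensAlg A R)), isIso u & forall i, u \oc iota i = hmap X (chiTens R i).
Proof.
have [u1 [u1E _]] := hP _ (fun i => hmap X (dsumIn (fun _ : I => R) i)).
have u1i : isIso u1 := (X_add I small).2 (fun=> R) P iota hP u1 u1E.
exists (hmap X sumCopies \oc u1).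
  by apply: iso_comp => //; have [? ?] := sumCopies_bij; exact: hmap_bij.
by move=> i; rewrite -compA u1E -hmap_comp sumCopiesE.
Qed.
End SumCopies.
End Tensor.

(** * Classes of idempotents of C(E) tensored with R *)

Section VertexProjections.
Variables (l : comPzRingType) (E : graph) (R : nuAlgType l).
Variables (T : triCategory) (X : excisiveTheory l T) (S : choiceType).
Hypotheses (Xh : homotopyInvariant X) (Xs : matrixStable S X).
Variables (s t : S) (st : s != t).
Local Notation C := (cohn l E).
Local Notation V := (cV l).
Local Notation Ed := (cE l).
Local Notation St := (cS l).

Lemma cVid v : V v ** V v = V v :> C. Proof. by rewrite cVV eqxx. Qed.
Lemma cES_idem e : (Ed e ** St e) ** (Ed e ** St e) = Ed e ** St e :> C.
Proof. by rewrite amulA -(amulA (Ed e)) cSE eqxx cEV. Qed.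

Lemma hmap_tensIdem_sum (A : nuAlgType l) (p p' pp : A) (hp : p ** p = p) (hp' : p' ** p' = p')
    (hpp : pp ** pp = pp) : p ** p' = 0 -> p' ** p = 0 -> pp = p + p' ->
  hmap X (tensIdem R hpp) = hmap X (tensIdem R hp) + hmap X (tensIdem R hp').
Proof.
move=> pp0 p'p0 ppE.
have o1 x y : tensIdem R hp x ** tensIdem R hp' y = 0.
  by rewrite [LHS]tens_mulE pp0 tens0l.
have o2 x y : tensIdem R hp' x ** tensIdem R hp y = 0.
  by rewrite [LHS]tens_mulE p'p0 tens0l.
rewrite -(hmap_sum X o1 o2); congr hmap; apply: algHomP => x.
by rewrite /= ppE tensDl.
Qed.

(** The idempotents e e^* and r(e) are equivalent through e and e^*, which are the off-diagonal
    entries of the linking matrix [k]. *)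
Lemma hmap_edge e : hmap X (tensIdem R (cES_idem e)) = hmap X (tensIdem R (cVid (rng e))).
Proof.
pose k (i j : bool) : C := match i, j with
  | false, false => Ed e ** St e | false, true => Ed e | true, false => St e
  | true, true => V (rng e) end.
have kM i j n : k i j ** k j n = k i n.
  case: i j n => [] [] [] /=; rewrite ?cVid ?cEV ?cVS ?cSE ?eqxx ?cES_idem //.
  - by rewrite amulA cSE eqxx cVS.
  - by rewrite -amulA cSE eqxx cEV.
apply: (hmap_link Xh Xs st (Phi := fun i j r => tens (k i j) r : tensAlg C R)) => //.
  by move=> i j; exact: tens_linear_r.
by move=> i j n x y; rewrite tens_mulE kM.
Qed.

Let edges (r : seq (edge E)) : C := \sum_(e <- r) Ed e ** St e.
Let edges_orth e r : e \notin r ->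
  (Ed e ** St e) ** edges r = 0 /\ edges r ** (Ed e ** St e) = 0.
Proof.
move=> er; rewrite /edges (lin_sum (amul_linear_r _)) (lin_sum (amul_linear_l (Ed e ** St e))).
split; rewrite big1_seq // => f /andP[_ fr]; rewrite amulA -(amulA (Ed _)) cSE.
  by case: eqP => [ef|_]; [rewrite ef fr in er|rewrite amul0r amul0l].
by case: eqP => [fe|_]; [rewrite -fe fr in er|rewrite amul0r amul0l].
Qed.
Let edges_idem r : uniq r -> edges r ** edges r = edges r.
Proof.
elim: r => [|e r IH] /=; first by rewrite /edges big_nil amul0l.
move=> /andP[er ur]; rewrite /edges big_cons -/(edges r).
have [o1 o2] := edges_orth er.
by rewrite amulDl !amulDr o1 o2 cES_idem IH // addr0 add0r.
Qed.
Lemma hmap_edges r (ur : uniq r) :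
  hmap X (tensIdem R (edges_idem ur)) = \sum_(e <- r) hmap X (tensIdem R (cVid (rng e))).
Proof.
elim: r ur => [|e r IH] ur.
  rewrite big_nil -(hmap_zero X R (tensAlg C R)); congr hmap; apply: algHomP => x.
  by rewrite /= /edges big_nil tens0l.
have /= /andP[er ur'] := ur; have [o1 o2] := edges_orth er.
rewrite big_cons -(IH ur') -hmap_edge.
by apply: hmap_tensIdem_sum => //; rewrite /edges big_cons.
Qed.

Lemma qv_idem v : qv l v ** qv l v = qv l v :> C. Proof. by rewrite qvM eqxx. Qed.

Lemma hmap_qv v : reg E v -> hmap X (tensIdem R (qv_idem v)) =
  hmap X (tensIdem R (cVid v)) - \sum_(e <- fset_set (out v)) hmap X (tensIdem R (cVid (rng e))).
Proof.
move=> rv; apply/eqP; rewrite -subr_eq opprK; apply/eqP; symmetry.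
have ur : uniq (fset_set (out v)) := fset_uniq _.
rewrite -(hmap_edges ur); apply: hmap_tensIdem_sum.
- rewrite /edges (lin_sum (amul_linear_r _)) big1_seq // => e /andP[_ ev].
  by rewrite amulA qE0 // amul0l.
- rewrite /edges (lin_sum (amul_linear_l (qv l v))) big1_seq // => e /andP[_ ev].
  by rewrite -amulA Sq0 // amul0r.
by rewrite /qv qsum_reg // subrK.
Qed.
End VertexProjections.

(** * A column of the matrix I - A^t *)

Section MatrixColumn.
Variables (E : graph) (v : reg E) (W : zmodType) (g : vert E -> W).

Lemma reduced_adjacencyE w : reduced_adjacency v w =
  count (fun e => rng e == w) (fset_set (out (set_val v))).
Proof.
have [fin _] : reg E (set_val v) by exact: set_valP.
rewrite /reduced_adjacency -size_filter; apply: perm_size; apply: uniq_perm.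
- exact: fset_uniq.
- by rewrite filter_uniq // fset_uniq.
move=> e; rewrite mem_filter mem_out; last exact: set_valP.
rewrite in_fset_set; last by apply: sub_finite_set fin => f [].
by apply/idP/andP => [/set_mem[-> ->]|[/eqP ew /eqP ev]]; [rewrite !eqxx|apply: mem_set].
Qed.

Lemma matrix_column : \sum_(w \in [set: vert E]) g w *~ I_sub_At w v =
  g (set_val v) - \sum_(e <- fset_set (out (set_val v))) g (rng e).
Proof.
pose s := fset_set (out (set_val v)) : seq (edge E).
(* The column at v is supported on v and the ranges of the edges leaving v; this finite list
   replaces the sum over all vertices. *)
pose r := undup (set_val v :: map (@rng E) s).
have vr : set_val v \in r by rewrite mem_undup mem_head.
have er e : e \in s -> rng e \in r.
  by move=> es; rewrite mem_undup inE map_f ?orbT.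
rewrite (fsbigE r) ?undup_uniq //; last first.
  move=> w _ wr; rewrite /I_sub_At /incidence reduced_adjacencyE.
  have -> : (w == set_val v) = false by apply/eqP => wv; rewrite wv vr in wr.
  rewrite (eq_in_count (a2 := pred0)) ?count_pred0 ?subr0 //.
  by move=> e es /=; apply/eqP => ew; rewrite -ew er in wr.
rewrite (eq_bigl xpredT) => [|w]; last by rewrite in_setT.
have E1 w : g w *~ I_sub_At w v = g w *+ (w == set_val v) - \sum_(e <- s | rng e == w) g (rng e).
  rewrite /I_sub_At /incidence reduced_adjacencyE mulrzBr; congr (_ - _).
  rewrite (eq_bigr (fun=> g w)) => [|e /eqP -> //].
  by rewrite big_const_seq iter_addr_0.
rewrite (eq_bigr _ (fun w _ => E1 w)) sumrB (bigD1_seq (set_val v)) ?undup_uniq //= eqxx.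
rewrite big1 ?addr0 => [|w /negPf -> //]; congr (_ - _).
(* Exchanging the sums passes from edges grouped by range to a sum over the edges. *)
rewrite (exchange_big_dep xpredT) //= big_seq [RHS]big_seq; apply: eq_bigr => e es.
rewrite -big_filter (bigD1_seq (rng e)) ?filter_uniq ?undup_uniq //=; last first.
  by rewrite mem_filter eqxx er.
rewrite big1_seq ?addr0 // => w /andP[we]; rewrite mem_filter => /andP[/eqP ew _].
by rewrite ew eqxx in we.
Qed.
End MatrixColumn.

(** * The triangle *)

Section Transport.
Variables (T : triCategory).

Lemma triMor_inv (t t' : triangle T) u v w : triMor t t' u v w ->
  isIso u -> isIso v -> isIso w -> triMor t' t (invm u) (invm v) (invm w).
Proof.
move=> [e1 e2 e3] ui vi wi; split.
- apply: (iso_monic ui); rewrite invmKV // compA e1 -compA -Omf_comp.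
  by rewrite (invP wi).2 Omf1 compm1.
- apply: (iso_monic vi); rewrite invmKV // compA e2 -compA.
  by rewrite (invP ui).2 compm1.
- apply: (iso_monic wi); rewrite invmKV // compA e3 -compA.
  by rewrite (invP vi).2 compm1.
Qed.

Lemma dist_transport (t : triangle T) (a b c : T) (u : mor a (tA t)) (v : mor b (tB t))
    (w : mor c (tC t)) : isIso u -> isIso v -> isIso w -> dist t ->
  let t' := Triangle (invm u \oc td t \oc Omf w) (invm v \oc tf t \oc u)
              (invm w \oc tg t \oc v) in
  triMor t' t u v w /\ dist t'.
Proof.
move=> ui vi wi D t'.
have M : triMor t' t u v w by split; rewrite /= -compA invmKV.
split=> //; apply: (dist_iso (triMor_inv M ui vi wi)) => //; exact: iso_invm.
Qed.
End Transport.

Lemma graphTriangle_dist (l : comPzRingType) (E : graph) (kk : triCategory)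
    (j : excisiveTheory l kk) : homotopyInvariant j -> matrixStable (stabSet E) j ->
  dist (graphTriangle E j).
Proof.
move=> jh js; have qi := qHom_iso jh js; have pi := phiHom_iso jh js.
have D := bdry_dist j (leavitt_extension l E).
apply: (@dist_iso kk (Triangle _ _ _) (graphTriangle E j) (invm (hmap j (qHom l E)))
  (invm (hmap j (phiHom l E))) (idm _) _ (iso_invm qi) (iso_invm pi) (iso_idm _) D).
rewrite /graphTriangle; split => /=.
(* [boundary] is 0 unless the sequence is an extension, so the linear splitting is what makes it the
   true boundary map here. *)
- rewrite Omf1 compm1 /boundary; case: pselect => [x|]; last by case; exact: leavitt_extension.
  by congr (_ \oc bdry _ _); exact: Prop_irrelevance.
- by rewrite -compA (invP qi).2 compm1.
- by rewrite comp1m -compA (invP pi).2 compm1.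
Qed.

Section InducedIdentity.
Variables (l : comPzRingType) (kk T : triCategory) (j : excisiveTheory l kk).
Variables (X : excisiveTheory l T) (R : nuAlgType l) (F : triFunctor kk kk) (G : triFunctor kk T).
Variables (hF : theoryMorphism j (tensTheory R j) F) (hG : theoryMorphism j X G).

Lemma inducedId_iso A : isIso (inducedId hF hG A).
Proof. by apply: iso_comp; [exact: iso_eqhom|apply: tri_hom_iso; exact: iso_eqhom]. Qed.

Lemma inducedId_nat (A B : nuAlgType l) (f : algHom A B) :
  inducedId hF hG B \oc tri_hom G (tri_hom F (hmap j f)) =
  hmap X (tensHom R f) \oc inducedId hF hG A.
Proof.
rewrite /inducedId -compA -tri_hom_comp (mor_hom hF) tri_hom_comp compA.
by rewrite (mor_hom hG) -compA.
Qed.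
End InducedIdentity.


Theorem theorem5p4
    (l : comPzRingType) (E : graph) (R : nuAlgType l)
    (kk : triCategory) (j : excisiveTheory l kk) (hj : universalTheory (stabSet E) j)
    (T : triCategory) (X : excisiveTheory l T)
    (X_htpy : homotopyInvariant X) (X_stable : matrixStable (stabSet E) X)
    (X_add : additiveTheory (vert E) X)
    (F : triFunctor kk kk) (hF : theoryMorphism j (tensTheory R j) F)
    (G : triFunctor kk T) (hG : theoryMorphism j X G)
    (P : T) (iotaP : reg E -> mor (X R) P) (hP : isDirectSum iotaP)
    (Q : T) (iotaQ : vert E -> mor (X R) Q) (hQ : isDirectSum iotaQ) :
  exists (d : mor (Om (X (tensAlg (leavitt l E) R))) P) (h : mor P Q)
         (g : mor Q (X (tensAlg (leavitt l E) R))),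
    [/\ isMatrixMap (@I_sub_At E) iotaP iotaQ h,
        dist (Triangle d h g) &
        exists u v w,
          [/\ triMor (Triangle d h g) (mapTriangle G (mapTriangle F (graphTriangle E j))) u v w,
              isIso u /\ forall i, inducedId hF hG (funAlg l (reg E)) \oc u \oc iotaP i
                                   = hmap X (chiTens R i),
              isIso v /\ forall i, inducedId hF hG (funAlg l (vert E)) \oc v \oc iotaQ i
                                   = hmap X (chiTens R i) &
              inducedId hF hG (leavitt l E) \oc w = idm (X (tensAlg (leavitt l E) R))]].
Proof.
have [jh js _] := hj.
have phi_iso := phiHom_iso jh js.
pose th A := inducedId hF hG A.
have thi A : isIso (th A) := inducedId_iso hF hG A.
have [u0 u0i u0E] := sumCopies_iso X_add (ex_intro _ (@set_val _ _) val_inj) hP.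
have [v0 v0i v0E] := sumCopies_iso X_add (ex_intro _ id (@inj_id _)) hQ.
pose t := mapTriangle G (mapTriangle F (graphTriangle E j)).
have Dt : dist t.
  have D := graphTriangle_dist jh js.
  exact: (tri_dist G (tri_dist F D)).
pose u : mor P (tA t) := invm (th _) \oc u0.
pose v : mor Q (tB t) := invm (th _) \oc v0.
pose w : mor (X (tensAlg (leavitt l E) R)) (tC t) := invm (th _).
have ui : isIso u := iso_comp (iso_invm (thi _)) u0i.
have vi : isIso v := iso_comp (iso_invm (thi _)) v0i.
have wi : isIso w := iso_invm (thi _).
have [M D] := dist_transport ui vi wi Dt.
have uE i : th (funAlg l (reg E)) \oc u \oc iotaP i = hmap X (chiTens R i).
  by rewrite /u invmKV.
have vE i : th (funAlg l (vert E)) \oc v \oc iotaQ i = hmap X (chiTens R i).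
  by rewrite /v invmKV.
(* Transport supplies d, h and g together with the distinguished triangle; the matrix of h is what
   remains. *)
do 3!eexists; split; [|exact: D|exists u, v, w; split => //; exact: (invP (thi _)).2].
have Xphi_iso : isIso (hmap X (tensHom R (phiHom l E))).
  apply: (iso_cancelr (thi (funAlg l (vert E)))).
  rewrite -inducedId_nat; apply: iso_comp => //.
  by do 2!apply: tri_hom_iso.
move=> i; rewrite matrix_column.
have [s0 _] := stabSet_coding E; have [s1 s01] := stabSet_other (s0 None).
(* The columns are compared in X(C(E) (x) R), where the copy of X(R) at x is given by the idempotent
   x of C(E). *)
apply: (iso_monic vi); apply: (iso_monic (thi _)); apply: (iso_monic Xphi_iso).
have chiV x : hmap X (tensHom R (phiHom l E)) \oc (th _ \oc (v \oc iotaQ x)) =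
    hmap X (tensIdem R (cVid l x)).
  rewrite (compA (th _)) vE -hmap_comp; congr hmap; apply: algHomP => r.
  rewrite compAlgE [LHS]tmap_tens; congr tens; exact: oidemHom_chi.
rewrite !compmB !comp_sumr chiV (eq_bigr _ (fun e _ => chiV (rng e))).
rewrite -(hmap_qv R X_htpy X_stable s01); last exact: set_valP.
have [_ M2 _] := M; rewrite (compA v) M2 -(compA (tf t)) (compA (th _)).
(* Composing with phi cancels the inverse of j(phi) in f and leaves the inclusion after q, so the
   column at i becomes the class of q_i. *)
have tfE : hmap X (tensHom R (phiHom l E)) \oc (th (funAlg l (vert E)) \oc tf t) =
    hmap X (tensHom R (ckInc l E)) \oc hmap X (tensHom R (qHom l E)) \oc th _.
  rewrite compA -[X in X \oc _]inducedId_nat /t /= -compA -!tri_hom_comp.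
  rewrite -(compA (invm _)) invmKV //.
  by rewrite !tri_hom_comp compA inducedId_nat -compA inducedId_nat compA.
rewrite compA tfE -(compA _ (th _)) (compA (th _)) uE -!hmap_comp; congr hmap.
apply: algHomP => r; change (tmap R (ckInc l E) (tmap R (qHom l E) (tens (chi l i) r)) =
  tens (qv l (set_val i)) r).
by rewrite !tmap_tens; congr tens; change (ckInc l E (qHom l E (chi l i)) = qv l (set_val i));
  rewrite [qHom _ _ _]oidemHom_chi.
Qed.
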